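(* The capacity region of the finite-alphabet cognitive MAC $P_{Y|X_1,X_2}$ with decoding metric $q(x_1,x_2,y)$ contains $$\mathcal R^{bin}_{cog}=\text{closure of the convex hull of }\bigcup_P\mathcal R^{bin,*}_{cog}(P),$$ the union over all distributions $P=P_{X_1,X_2}P_{Y|X_1,X_2}$ on $\mathcal X_1\times\mathcal X_2\times\mathcal Y$ with $P_{Y|X_1,X_2}$ the channel, where $\mathcal R^{bin,*}_{cog}(P)$ is the set of $(R_1,R_2)$ for which there exist $R_{1,a},R_{1,b}\ge0$ with $R_1=R_{1,a}+R_{1,b}$, $R_{1,a}\le R_1'(P)$, $R_{1,b}+R_2\le R_2'(P)$, and either $R_{1,a}\le R_1''(P,R_{1,b}+R_2)$ or $R_{1,b}+R_2\le R_2''(P,R_{1,a})$.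
   Context: Cognitive MAC with mismatched decoding: finite alphabets $\mathcal X_1,\mathcal X_2,\mathcal Y$, memoryless channel $P_{Y|X_1,X_2}$, metric $q$. A code of rates $(R_1,R_2)$: encoder 1 sends $\mathbf x_1(W_1)$, $W_1\le2^{nR_1}$; encoder 2 knows $(W_1,W_2)$, $W_2\le 2^{nR_2}$, and sends $\mathbf x_2(W_1,W_2)$; messages uniform. Decoder outputs $(i,j)$ iff $\sum_t q(x_{1,t}(i),x_{2,t}(i,j),y_t)$ strictly exceeds the sum for all other $(i',j')$, else error. Capacity region = closure of the set of pairs achievable with vanishing average error probability. For a distribution $Q$: $\mathcal G_q(Q)=\{f: f_{X_1,X_2}=Q_{X_1,X_2},\ \mathbb E_f q\ge\mathbb E_Q q\}$; $\mathcal L_1(Q)=\{f\in\mathcal G_q(Q):f_{X_2,Y}=Q_{X_2,Y}\}$; $\mathcal L_2(Q)=\{f\in\mathcal G_q(Q):f_{X_1,Y}=Q_{X_1,Y}\}$; $\mathcal L_0(Q)=\{f\in\mathcal G_q(Q):f_Y=Q_Y\}$. $R_1'(P)=\min_{\tilde P\in\mathcal L_1(P)}I_{\tilde P}(X_1;Y,X_2)$; $R_2'(P)=\min_{\tilde P\in\mathcal L_2(P)}I_{\tilde P}(X_2;Y|X_1)$; $R_1''(P,R_2)=\min_{\tilde P\in\mathcal L_0(P)}[I_{\tilde P}(X_1;Y)+|I_{\tilde P}(X_2;Y|X_1)-R_2|^+]$; $R_2''(P,R_1)=\min_{\tilde P\in\mathcal L_0(P)}[I_{\tilde P}(X_2;Y)-I_{\tilde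 P}(X_2;X_1)+|I_{\tilde P}(X_1;Y,X_2)-R_1|^+]$; $|t|^+=\max\{0,t\}$. *)

(* Defs.v *)
From HB Require Import structures.
From mathcomp Require Import all_boot all_order all_algebra.
From mathcomp Require Import all_classical all_reals all_analysis.

Set Implicit Arguments.
Unset Strict Implicit.
Unset Printing Implicit Defensive.

Import Order.TTheory GRing.Theory Num.Theory.
Import numFieldNormedType.Exports.
Local Open Scope classical_set_scope.
Local Open Scope ring_scope.

Section CogMAC.
Variable R : realType.

Definition is_pmf (T : finType) (p : {ffun T -> R}) : Prop :=
  (forall t, 0 <= p t) /\ \sum_t p t = 1.

Definition marg (T U : finType) (f : T -> U) (p : {ffun T -> R}) : {ffun U -> R} :=
  [ffun u => \sum_(t | f t == u) p t].

Definition log2 (x : R) : R := ln x / ln 2.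

Definition entropy (U : finType) (p : {ffun U -> R}) : R :=
  - \sum_u (if p u == 0 then 0 else p u * log2 (p u)).

Definition Hf (T U : finType) (f : T -> U) (p : {ffun T -> R}) : R :=
  entropy (marg f p).

Variables (X1 X2 Y : finType).
Local Notation Tr := ((X1 * X2) * Y)%type.

Definition pX1 (t : Tr) : X1 := t.1.1.
Definition pX2 (t : Tr) : X2 := t.1.2.
Definition pY (t : Tr) : Y := t.2.
Definition pX1X2 (t : Tr) : X1 * X2 := t.1.
Definition pX1Y (t : Tr) : X1 * Y := (t.1.1, t.2).
Definition pX2Y (t : Tr) : X2 * Y := (t.1.2, t.2).
Definition pAll (t : Tr) : Tr := t.

Definition I_X1_YX2 (f : {ffun Tr -> R}) : R :=
  Hf pX1 f + Hf pX2Y f - Hf pAll f.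
Definition I_X2_Y_given_X1 (f : {ffun Tr -> R}) : R :=
  Hf pX1X2 f + Hf pX1Y f - Hf pAll f - Hf pX1 f.
Definition I_X1_Y (f : {ffun Tr -> R}) : R :=
  Hf pX1 f + Hf pY f - Hf pX1Y f.
Definition I_X2_Y (f : {ffun Tr -> R}) : R :=
  Hf pX2 f + Hf pY f - Hf pX2Y f.
Definition I_X2_X1 (f : {ffun Tr -> R}) : R :=
  Hf pX2 f + Hf pX1 f - Hf pX1X2 f.

Variable q : X1 -> X2 -> Y -> R.

Definition Eq (f : {ffun Tr -> R}) : R := \sum_t f t * q t.1.1 t.1.2 t.2.

Definition Gq (Q : {ffun Tr -> R}) : set {ffun Tr -> R} :=
  [set f | is_pmf f /\ marg pX1X2 f = marg pX1X2 Q /\ Eq Q <= Eq f].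
Definition L1 (Q : {ffun Tr -> R}) : set {ffun Tr -> R} :=
  [set f | Gq Q f /\ marg pX2Y f = marg pX2Y Q].
Definition L2 (Q : {ffun Tr -> R}) : set {ffun Tr -> R} :=
  [set f | Gq Q f /\ marg pX1Y f = marg pX1Y Q].
Definition L0 (Q : {ffun Tr -> R}) : set {ffun Tr -> R} :=
  [set f | Gq Q f /\ marg pY f = marg pY Q].

Definition pos (t : R) : R := Num.max 0 t.

(* the minima are written as infima (they are attained: compact sets, continuous objectives) *)
Definition R1' (P : {ffun Tr -> R}) : R := inf [set I_X1_YX2 f | f in L1 P].
Definition R2' (P : {ffun Tr -> R}) : R := inf [set I_X2_Y_given_X1 f | f in L2 P].
Definition R1'' (P : {ffun Tr -> R}) (R2 : R) : R :=
  inf [set I_X1_Y f + pos (I_X2_Y_given_X1 f - R2) | f in L0 P].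
Definition R2'' (P : {ffun Tr -> R}) (R1 : R) : R :=
  inf [set I_X2_Y f - I_X2_X1 f + pos (I_X1_YX2 f - R1) | f in L0 P].

Definition Rbin_star (P : {ffun Tr -> R}) : set (R * R) :=
  [set r | exists R1a R1b : R,
     (0 <= R1a) /\ (0 <= R1b) /\ (0 <= r.2) /\ (r.1 = R1a + R1b) /\
     (R1a <= R1' P) /\ (R1b + r.2 <= R2' P) /\
     (R1a <= R1'' P (R1b + r.2) \/ R1b + r.2 <= R2'' P R1a)].

Variable W : X1 -> X2 -> {ffun Y -> R}.

Definition joint (Q : {ffun (X1 * X2) -> R}) : {ffun Tr -> R} :=
  [ffun t => Q t.1 * W t.1.1 t.1.2 t.2].

Definition Rbin_union : set (R * R) :=
  [set r | exists Q : {ffun (X1 * X2) -> R}, is_pmf Q /\ Rbin_star (joint Q) r].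

Definition conv_hull (S : set (R * R)) : set (R * R) :=
  [set z | exists (n : nat) (w : 'I_n -> R) (p : 'I_n -> R * R),
     [/\ forall i, 0 <= w i, \sum_i w i = 1, forall i, S (p i) &
         z = (\sum_i w i * (p i).1, \sum_i w i * (p i).2)]].

Definition Rbin_cog : set (R * R) := closure (conv_hull Rbin_union).

Definition nmsg (n : nat) (r : R) : nat := Num.truncn (2 `^ (n%:R * r)).

Definition score (n M1 M2 : nat) (f1 : 'I_M1 -> 'I_n -> X1)
  (f2 : 'I_M1 -> 'I_M2 -> 'I_n -> X2) (i : 'I_M1) (j : 'I_M2)
  (y : {ffun 'I_n -> Y}) : R :=
  \sum_(t < n) q (f1 i t) (f2 i j t) (y t).

Definition decoded (n M1 M2 : nat) (f1 : 'I_M1 -> 'I_n -> X1)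
  (f2 : 'I_M1 -> 'I_M2 -> 'I_n -> X2) (i : 'I_M1) (j : 'I_M2)
  (y : {ffun 'I_n -> Y}) : bool :=
  [forall i' : 'I_M1, forall j' : 'I_M2,
     ((i', j') != (i, j)) ==> (score f1 f2 i' j' y < score f1 f2 i j y)].

Definition err_prob (n M1 M2 : nat) (f1 : 'I_M1 -> 'I_n -> X1)
  (f2 : 'I_M1 -> 'I_M2 -> 'I_n -> X2) (i : 'I_M1) (j : 'I_M2) : R :=
  \sum_(y : {ffun 'I_n -> Y} | ~~ decoded f1 f2 i j y)
     \prod_(t < n) W (f1 i t) (f2 i j t) (y t).

Definition avg_err (n M1 M2 : nat) (f1 : 'I_M1 -> 'I_n -> X1)
  (f2 : 'I_M1 -> 'I_M2 -> 'I_n -> X2) : R :=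
  (\sum_(i < M1) \sum_(j < M2) err_prob f1 f2 i j) / (M1 * M2)%:R.

Definition achievable (r : R * R) : Prop :=
  0 <= r.1 /\ 0 <= r.2 /\
  forall eps : R, 0 < eps -> exists N : nat, forall n : nat, (N <= n)%N ->
    exists (f1 : 'I_(nmsg n r.1) -> 'I_n -> X1)
           (f2 : 'I_(nmsg n r.1) -> 'I_(nmsg n r.2) -> 'I_n -> X2),
      avg_err f1 f2 <= eps.

Definition capacity_region : set (R * R) := closure achievable.

End CogMAC.

(* Main.v *)
(** Random coding with binning and superposition, analysed by the method of types.

    The message of user 1 is split, part [a] selecting [x1] and part [b] being carried, together
    with the message of user 2, by [x2].  Codebooks of independent words [x1] and [x2] are drawn,
    every message owns a list of about [2 ^ (n I(X1;X2))] candidate pairs, and the encoder sends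
    a candidate which is jointly typical for [Q].  Bounding the error by the sum over all
    candidates, instead of conditioning on the chosen one, costs only a factor
    [|K| P(typical) = 2 ^ o(n)], and then all codewords are independent.  A wrong pair can
    share [x1] with the sent pair, share [x2], or share nothing; the joint types which can win
    then lie near [L2], [L1] and [L0], and the union bound over the pairs (or only over the
    wrong [x1], or only over the wrong [x2]) gives the exponents of [R2'], [R1'], [R1''], [R2''].

    The alternative [R1a <= R1''] is reached when each [x1] has its own [x2] words
    (superposition), and [R1b + R2 <= R2''] when the [x2] words are shared by all [x1] (binning).
    Binning needs the second inequality to be strict, which shrinking the rates ensures unless
    [R1b + R2 = 0]; in that case user 2 has no message and superposition with the roles of the
    users exchanged, [x2] being the cloud, is used instead.

    Convex combinations are obtained by concatenating codes. *)
Require Import Defs.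
From HB Require Import structures.
From mathcomp Require Import all_boot all_order all_algebra.
From mathcomp Require Import all_classical all_reals all_analysis.
From mathcomp Require Import ring lra.
Import Order.TTheory GRing.Theory Num.Theory.
Import numFieldNormedType.Exports.
Local Open Scope classical_set_scope.
Local Open Scope ring_scope.
Set Implicit Arguments.
Unset Strict Implicit.
Unset Printing Implicit Defensive.

(** The decoder compares the words actually selected by the encoders, so every message, and not only
    the sent one, must have found a typical candidate. This calls for a union bound over
    exponentially many messages, whereas a bad word shared by all candidates of a message spoils the
    covering with a probability that is only exponentially small. The law of that word is therefore
    conditioned on having many typical partners, at the price of a factor 2; given such a word,
    failure is doubly exponentially small.

    The minima enter only through strict inequalities on [L1], [L2], [L0]. Empirical types satisfy
    the constraints of these classes only approximately; compactness yields a margin [mu] valid near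
    the classes, and all other slacks are chosen below it. Strictness comes from lowering a rate,
    which is impossible for a zero rate; the corresponding class of rivals must then be empty, and
    the boolean flags record this. *)

Section Pow2.
Variable R : realType.
Implicit Types x y : R.

Definition pow2 x : R := expR (x * ln 2).

Lemma ln2_gt0 : 0 < ln 2 :> R.
Proof. by rewrite ln_gt0 // ltr1n. Qed.

Lemma pow2_gt0 x : 0 < pow2 x. Proof. exact: expR_gt0. Qed.

Lemma pow2_ge0 x : 0 <= pow2 x. Proof. exact: expR_ge0. Qed.

Lemma pow2_0 : pow2 0 = 1. Proof. by rewrite /pow2 mul0r expR0. Qed.

Lemma pow2D x y : pow2 (x + y) = pow2 x * pow2 y.
Proof. by rewrite /pow2 mulrDl expRD. Qed.

Lemma ler_pow2 x y : (pow2 x <= pow2 y) = (x <= y).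
Proof. by rewrite /pow2 ler_expR ler_pM2r // ln2_gt0. Qed.

Lemma pow2_ge1 x : 0 <= x -> 1 <= pow2 x.
Proof. by move=> x0; rewrite -pow2_0 ler_pow2. Qed.

Lemma pow2_log2 x : 0 < x -> pow2 (log2 x) = x.
Proof.
by move=> x0; rewrite /pow2 /log2 divfK ?lnK //; apply: lt0r_neq0; exact: ln2_gt0.
Qed.

Lemma powR2E x : 2 `^ x = pow2 x.
Proof. by rewrite /powR pnatr_eq0. Qed.

Lemma pow2_sum (I : Type) (r : seq I) (F : I -> R) :
  pow2 (\sum_(i <- r) F i) = \prod_(i <- r) pow2 (F i).
Proof.
elim: r => [|i r IH]; first by rewrite !big_nil pow2_0.
by rewrite !big_cons pow2D IH.
Qed.

End Pow2.

(** * Codebooks with independent entries *)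

Section ProductPmf.
Variable R : realType.

Definition prodp (I S : finType) (p : S -> R) (c : {ffun I -> S}) : R :=
  \prod_i p (c i).

Lemma prodp_ge0 (I S : finType) (p : S -> R) (c : {ffun I -> S}) :
  (forall s, 0 <= p s) -> 0 <= prodp p c.
Proof. by move=> p0; apply: prodr_ge0. Qed.

Lemma sum_prodp_prod (I S : finType) (p : S -> R) (g : I -> S -> R) :
  \sum_(c : {ffun I -> S}) prodp p c * \prod_i g i (c i) =
  \prod_i \sum_s p s * g i s.
Proof.
rewrite bigA_distr_bigA /=; apply: eq_bigr => c _.
by rewrite /prodp big_split.
Qed.

Lemma sum_prodp (I S : finType) (p : S -> R) :
  \sum_s p s = 1 -> \sum_(c : {ffun I -> S}) prodp p c = 1.
Proof.
move=> p1; have := sum_prodp_prod p (fun (_ : I) _ => 1).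
rewrite (eq_bigr (prodp p)); last by move=> c _; rewrite big1 ?mulr1.
move=> ->; apply: big1 => i _; under eq_bigr do rewrite mulr1; exact: p1.
Qed.

Lemma sum_delta (S : finType) (F : S -> R) s :
  \sum_t (t == s)%:R * F t = F s.
Proof.
rewrite (bigD1 s) //= eqxx mul1r big1 ?addr0 // => t /negbTE ->.
by rewrite mul0r.
Qed.

Lemma sum_prodp_coord (I S : finType) (p : S -> R) (i : I) (F : S -> R) :
  \sum_s p s = 1 ->
  \sum_(c : {ffun I -> S}) prodp p c * F (c i) = \sum_s p s * F s.
Proof.
(* Expanding [F (c i)] over the indicators of [c i = s] makes the integrand a product over all
   coordinates, so that [sum_prodp_prod] applies; [sum_prodp_coord2] does the same with two
   coordinates. *)
move=> p1; pose g (s : S) k (t : S) : R := if k == i then (t == s)%:R else 1.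
transitivity (\sum_s F s * \sum_(c : {ffun I -> S}) prodp p c * \prod_k g s k (c k)).
  under [RHS]eq_bigr do rewrite mulr_sumr.
  rewrite exchange_big /=; apply: eq_bigr => c _.
  transitivity (\sum_s (s == c i)%:R * (prodp p c * F s)).
    by rewrite sum_delta.
  apply: eq_bigr => s _; rewrite (bigD1 i) //= big1 ?mulr1.
    by rewrite /g eqxx (eq_sym s); ring.
  by move=> k /negbTE ki; rewrite /g ki.
apply: eq_bigr => s _; rewrite sum_prodp_prod (bigD1 i) //= [X in _ * (_ * X)]big1.
  rewrite mulr1 mulrC; congr (_ * _); rewrite -[RHS](sum_delta p); apply: eq_bigr => t _.
  by rewrite /g eqxx mulrC.
move=> k /negbTE ki; rewrite /g ki; under eq_bigr do rewrite mulr1; exact: p1.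
Qed.

Lemma sum_prodp_coord2 (I S : finType) (p : S -> R) (i j : I)
    (F : S -> S -> R) :
  \sum_s p s = 1 -> i != j ->
  \sum_(c : {ffun I -> S}) prodp p c * F (c i) (c j) =
  \sum_s p s * \sum_t p t * F s t.
Proof.
move=> p1 ij.
pose g (s t : S) k (r : S) : R := if k == i then (r == s)%:R else
  if k == j then (r == t)%:R else 1.
transitivity (\sum_s \sum_t F s t *
    \sum_(c : {ffun I -> S}) prodp p c * \prod_k g s t k (c k)).
  under [RHS]eq_bigr do under eq_bigr do rewrite mulr_sumr.
  under [RHS]eq_bigr do rewrite exchange_big /=.
  rewrite exchange_big /=; apply: eq_bigr => c _.
  transitivity (\sum_s (s == c i)%:R * \sum_t (t == c j)%:R * (prodp p c * F s t)).
    by rewrite sum_delta sum_delta.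
  apply: eq_bigr => s _; rewrite mulr_sumr; apply: eq_bigr => t _.
  rewrite (bigD1 i) //= (bigD1 j) 1?eq_sym //= big1 ?mulr1.
    by rewrite /g eqxx (eq_sym j i) (negbTE ij) eqxx (eq_sym t); ring.
  by move=> k /andP[/negbTE ki /negbTE kj]; rewrite /g ki kj.
apply: eq_bigr => s _; rewrite mulr_sumr; apply: eq_bigr => t _.
rewrite sum_prodp_prod (bigD1 i) //= (bigD1 j) 1?eq_sym //=.
rewrite [X in _ * (_ * (_ * X))]big1; last first.
  move=> k /andP[/negbTE ki /negbTE kj]; rewrite /g ki kj.
  by under eq_bigr do rewrite mulr1; exact: p1.
have -> : \sum_s0 p s0 * g s t i s0 = p s.
  rewrite -[RHS](sum_delta p); apply: eq_bigr => r _.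
  by rewrite /g eqxx mulrC.
have -> : \sum_s0 p s0 * g s t j s0 = p t.
  rewrite -[RHS](sum_delta p); apply: eq_bigr => r _.
  by rewrite /g (eq_sym j i) (negbTE ij) eqxx mulrC.
by ring.
Qed.

(** Serves for covering failure: distinct candidates carry independent words, so the probability
    that all of them miss is a power. *)
Lemma sum_prodp_inj (I S K : finType) (p : S -> R) (h : K -> I) (g : S -> R) :
  \sum_s p s = 1 -> injective h ->
  \sum_(c : {ffun I -> S}) prodp p c * \prod_k g (c (h k)) =
  (\sum_s p s * g s) ^+ #|K|.
Proof.
move=> p1 hI.
pose G i s : R := if i \in codom h then g s else 1.
transitivity (\sum_(c : {ffun I -> S}) prodp p c * \prod_i G i (c i)).
  apply: eq_bigr => c _; congr (_ * _); rewrite /G -big_mkcond /=.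
  transitivity (\prod_(i in (h @: [set: K]%SET)%SET) g (c i)).
    rewrite big_imset /=; last by move=> ? ? _ _; exact: hI.
    by apply: eq_bigl => k; rewrite inE.
  apply: eq_bigl => i; apply/imsetP/codomP => [[k _ ->]|[k ->]]; exists k => //.
rewrite sum_prodp_prod /G.
rewrite (eq_bigr (fun i => if i \in codom h then \sum_s p s * g s else 1)).
  rewrite -big_mkcond /= prodr_const card_codom //.
move=> i _; case: ifP => // _; by under eq_bigr do rewrite mulr1.
Qed.

End ProductPmf.

(** * Method of types and concentration of the empirical distribution *)

Section Types.
Variable R : realType.

Lemma entropyE (U : finType) (p : {ffun U -> R}) :
  entropy p = - \sum_u p u * log2 (p u).
Proof.
rewrite /entropy; congr (- _); apply: eq_bigr => u _.
by case: eqP => // ->; rewrite mul0r.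
Qed.

Lemma marg_comp (T U V : finType) (f : T -> U) (g : U -> V) (p : {ffun T -> R}) :
  marg g (marg f p) = marg (g \o f) p.
Proof.
apply/ffunP => v; rewrite !ffunE (partition_big f (fun u => g u == v)) //=.
apply: eq_bigr => u /eqP gu; rewrite ffunE; apply: eq_bigl => t.
by case: eqP => [->|]; rewrite ?gu ?eqxx ?andbF.
Qed.

Lemma Hf_marg (T U V : finType) (f : T -> U) (g : U -> V) (p : {ffun T -> R}) :
  Hf g (marg f p) = Hf (g \o f) p.
Proof. by rewrite /Hf marg_comp. Qed.

Lemma marg_id (T : finType) (p : {ffun T -> R}) : marg id p = p.
Proof. by apply/ffunP => t; rewrite ffunE big_pred1_eq. Qed.

Lemma sum_marg (T U : finType) (f : T -> U) (p : {ffun T -> R}) (h : U -> R) :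
  \sum_u marg f p u * h u = \sum_t p t * h (f t).
Proof.
rewrite [RHS](partition_big f xpredT) //=; apply: eq_bigr => u _.
by rewrite ffunE mulr_suml; apply: eq_bigr => t /eqP ->.
Qed.

Lemma marg_pmf (T U : finType) (f : T -> U) (p : {ffun T -> R}) :
  is_pmf p -> is_pmf (marg f p).
Proof.
move=> [p0 p1]; split=> [u|]; first by rewrite ffunE; apply: sumr_ge0.
have := sum_marg f p (fun=> 1).
by under eq_bigr do rewrite mulr1; under [RHS]eq_bigr do rewrite mulr1; rewrite p1.
Qed.

Definition ty (n : nat) (T : finType) (z : {ffun 'I_n -> T}) : {ffun T -> R} :=
  [ffun a => (\sum_i (z i == a)%:R) / n%:R].

Lemma ty_ge0 n (T : finType) (z : {ffun 'I_n -> T}) a : 0 <= ty z a.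
Proof. by rewrite ffunE divr_ge0 ?ler0n // sumr_ge0. Qed.

Lemma sum_ty n (T : finType) (z : {ffun 'I_n -> T}) (g : T -> R) :
  \sum_a ty z a * g a = (\sum_i g (z i)) / n%:R.
Proof.
under eq_bigr do rewrite ffunE mulrAC mulr_suml.
rewrite -mulr_suml exchange_big /=; congr (_ / _); apply: eq_bigr => i _.
by rewrite -[RHS]sum_delta; apply: eq_bigr => a _; rewrite (eq_sym a).
Qed.

Lemma ty_pmf n (T : finType) (z : {ffun 'I_n -> T}) : (0 < n)%N -> is_pmf (ty z).
Proof.
move=> n0; split; first exact: ty_ge0.
have := sum_ty z (fun=> 1); under eq_bigr do rewrite mulr1.
by rewrite sumr_const card_ord divff // pnatr_eq0 -lt0n.
Qed.

Lemma marg_ty n (T U : finType) (f : T -> U) (z : {ffun 'I_n -> T}) :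
  marg f (ty z) = ty [ffun i => f (z i)].
Proof.
apply/ffunP => u; rewrite !ffunE.
transitivity (\sum_t ty z t * (f t == u)%:R).
  rewrite big_mkcond; apply: eq_bigr => t _; case: eqP => _; by rewrite ?mulr1 ?mulr0.
by rewrite sum_ty; under [in RHS]eq_bigr do rewrite ffunE.
Qed.

Lemma ty_gt0 n (T : finType) (z : {ffun 'I_n -> T}) i : 0 < ty z (z i).
Proof.
rewrite ffunE divr_gt0 ?ltr0n //; last exact: leq_ltn_trans (ltn_ord i).
rewrite (bigD1 i) //= eqxx ltr_pwDl // sumr_ge0 //.
Qed.

Lemma prodp_ty n (T : finType) (z : {ffun 'I_n -> T}) : (0 < n)%N ->
  prodp (ty z) z = pow2 (- n%:R * entropy (ty z)).
Proof.
move=> n0; rewrite /prodp.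
under eq_bigr => i _ do rewrite -(pow2_log2 (ty_gt0 z i)).
rewrite -pow2_sum entropyE (sum_ty z (fun a => log2 (ty z a))).
congr pow2; rewrite mulrNN mulrCA divff ?mulr1 //.
by rewrite pnatr_eq0 -lt0n.
Qed.

(* Gibbs' inequality in product form, from [r <= exp (r - 1)] applied to [r = p / ty z]. *)
Lemma prodp_le_ty n (T : finType) (p : T -> R) (z : {ffun 'I_n -> T}) :
  (0 < n)%N -> (forall t, 0 <= p t) -> \sum_t p t = 1 ->
  prodp p z <= pow2 (- n%:R * entropy (ty z)).
Proof.
move=> n0 p0 p1; rewrite -prodp_ty //.
have -> : prodp p z = prodp (ty z) z * \prod_i (p (z i) / ty z (z i)).
  rewrite /prodp -big_split; apply: eq_bigr => i _ /=.
  by rewrite mulrC divfK // lt0r_neq0 // ty_gt0.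
rewrite ger_pMr; last by rewrite prodp_ty // pow2_gt0.
apply: (@le_trans _ _ (\prod_i expR (p (z i) / ty z (z i) - 1))).
  apply: ler_prod => i _; rewrite divr_ge0 ?ty_ge0 //=.
  by have := @expR_ge1Dx R (p (z i) / ty z (z i) - 1); rewrite addrC subrK.
rewrite -expR_sum -[leRHS]expR0 ler_expR sumrB sumr_const card_ord subr_le0.
have := sum_ty z (fun a => p a / ty z a) => /eqP.
rewrite eq_sym => /eqP/(canRL (@divfK _ _ _)) ->; last by rewrite pnatr_eq0 -lt0n.
rewrite mulr_natr lerMn2r; apply/orP; right; rewrite -p1.
apply: ler_sum => a _; have [->|h] := eqVneq (ty z a) 0; first by rewrite mul0r.
by rewrite mulrC divfK.
Qed.

(** Size of a conditional type class. Each member has probability [pow2 (- n H(V))] under the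
    product law of [V], and summing that law over [x] with [zg] fixed gives at most the probability
    of [zg] under the marginal of [V]. *)
Lemma type_class_le n (S Z T : finType) (e : S -> Z -> T) (f : T -> S) (g : T -> Z)
    (V : {ffun T -> R}) (zg : {ffun 'I_n -> Z}) :
  (0 < n)%N -> (forall s z, f (e s z) = s) -> (forall s z, g (e s z) = z) ->
  \sum_(x : {ffun 'I_n -> S}) (ty [ffun i => e (x i) (zg i)] == V)%:R
     * pow2 (- n%:R * entropy V) <= pow2 (- n%:R * Hf g V).
Proof.
move=> n0 fe ge.
have [/existsP[x0 /eqP V0]|] :=
    boolP [exists x : {ffun 'I_n -> S}, ty [ffun i => e (x i) (zg i)] == V]; last first.
  move=> /existsPn h; rewrite big1 ?pow2_ge0 // => x _.
  by rewrite (negbTE (h x)) mul0r.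
have gV : marg g V = ty zg.
  rewrite -V0 marg_ty; congr ty; apply/ffunP => i; by rewrite !ffunE ge.
have Vge0 t : 0 <= V t by rewrite -V0 ty_ge0.
apply: (@le_trans _ _ (\sum_(x : {ffun 'I_n -> S}) \prod_i V (e (x i) (zg i)))).
  apply: ler_sum => x _; have [<-|_] := eqP; last by rewrite mul0r prodr_ge0.
  rewrite mul1r -prodp_ty // /prodp; apply: ler_prod => i _; rewrite ty_ge0 /=.
  by rewrite [X in ty _ X]ffunE.
rewrite -(@bigA_distr_bigA _ _ _ _ _ _ _ (fun i s => V (e s (zg i)))) /=.
rewrite /Hf gV -prodp_ty // -gV /prodp; apply: ler_prod => i _.
rewrite sumr_ge0 //= ffunE.
rewrite -(big_imset (h := fun s => e s (zg i)) V) /=; last first.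
  by move=> s s' _ _ /(congr1 f); rewrite !fe.
rewrite [leRHS](bigID (mem ((fun s => e s (zg i)) @: S)%SET)) /=.
have -> : \sum_(t in ((fun s => e s (zg i)) @: S)%SET) V t =
  \sum_(t | (g t == zg i) && (t \in ((fun s => e s (zg i)) @: S)%SET)) V t.
  apply: eq_bigl => t; apply/idP/andP => [|[]//]; move/imsetP => [s _ ->].
  by rewrite ge; split => //; apply: imset_f.
by rewrite lerDl sumr_ge0.
Qed.

(** The exponent is the mutual information of the two projections under [V]: every [x] in the class
    has type [marg f V], hence the same bound on its probability, and [type_class_le] counts these
    words. The constant [C] makes room for conditioned codeword laws. *)
Lemma type_prob_le n (S Z T : finType) (e : S -> Z -> T) (f : T -> S) (g : T -> Z)
    (V : {ffun T -> R}) (zg : {ffun 'I_n -> Z}) (p : S -> R) (C : R)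
    (w : {ffun 'I_n -> S} -> R) :
  (0 < n)%N -> (forall s z, f (e s z) = s) -> (forall s z, g (e s z) = z) ->
  (forall s, 0 <= p s) -> \sum_s p s = 1 ->
  0 <= C -> (forall x, w x <= C * prodp p x) ->
  \sum_(x : {ffun 'I_n -> S}) w x * (ty [ffun i => e (x i) (zg i)] == V)%:R
  <= C * pow2 (- n%:R * (Hf f V + Hf g V - entropy V)).
Proof.
move=> n0 fe ge p0 p1 C0 wp.
set N := \sum_(x : {ffun 'I_n -> S}) (ty [ffun i => e (x i) (zg i)] == V)%:R : R.
apply: (@le_trans _ _ (C * (pow2 (- n%:R * Hf f V) * N))).
  rewrite /N 2!mulr_sumr; apply: ler_sum => x _.
  have [V0|_] := eqP; last by rewrite !mulr0.
  rewrite !mulr1 (le_trans (wp x)) // ler_wpM2l //.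
  rewrite (le_trans (prodp_le_ty x n0 p0 p1)) // /Hf -V0 marg_ty.
  rewrite ler_pow2 (_ : [ffun _ => _] = x) //; apply/ffunP => i; by rewrite !ffunE fe.
rewrite ler_wpM2l //.
have := type_class_le V zg n0 fe ge; rewrite -mulr_suml -/N => h.
rewrite (_ : - n%:R * (Hf f V + Hf g V - entropy V) = (- n%:R * Hf f V + - n%:R * Hf g V) + n%:R * entropy V); last by ring.
rewrite !pow2D -mulrA ler_wpM2l ?pow2_ge0 //.
rewrite -(ler_pM2r (pow2_gt0 (- n%:R * entropy V))) (le_trans h) //.
by rewrite -!pow2D ler_pow2; lra.
Qed.

(* Robust typicality: a symbol of zero probability never occurs. *)
Definition typ (n : nat) (T : finType) (eta : R) (p : T -> R) (z : {ffun 'I_n -> T}) :=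
  [forall a, `|ty z a - p a| <= eta * p a].

(** Follows from [exp (- s) >= 1 - s], since [(1 - s) (1 + s + 2 s^2) = 1 + s^2 (1 - 2 s)]. *)
Lemma expR_le_quad (s : R) : `|s| <= 1 / 2 -> expR s <= 1 + s + 2 * s ^+ 2.
Proof.
rewrite ler_norml => /andP[s1 s2].
have s3 : 0 < 1 - s by lra.
have : expR s <= (1 - s)^-1.
  by rewrite -[s]opprK expRN lef_pV2 ?posrE ?expR_gt0 ?opprK // expR_ge1Dx.
move=> /le_trans; apply; rewrite -[(1 - s)^-1]mul1r ler_pdivrMr //.
have : 0 <= s ^+ 2 * (1 - 2 * s) by rewrite mulr_ge0 ?sqr_ge0 //; lra.
rewrite expr2 => h; lra.
Qed.

(* Exponential Markov inequality with parameter [s]; the sign of [s] selects the tail. *)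
Lemma chernoff_tail n (T : finType) (p : T -> R) (a : T) (s d : R) :
  (0 < n)%N -> (forall t, 0 <= p t) -> \sum_t p t = 1 ->
  0 <= d -> d <= 1 -> `|s| = d / 4 ->
  \sum_(z : {ffun 'I_n -> T}) prodp p z * (`|s| * d <= s * (ty z a - p a))%R%:R
    <= expR (- n%:R * (d ^+ 2 / 8)).
Proof.
move=> n0 p0 p1 d0 d1 sd.
have n0' : n%:R != 0 :> R by rewrite pnatr_eq0 -lt0n.
have pa1 : p a <= 1.
  by rewrite -p1 (bigD1 a) //= lerDl sumr_ge0.
apply: (@le_trans _ _ (\sum_(z : {ffun 'I_n -> T}) prodp p z *
    (expR (- n%:R * (s * p a + `|s| * d)) * \prod_i expR (s * (z i == a)%:R)))).
  apply: ler_sum => z _; rewrite ler_wpM2l ?prodp_ge0 //.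
  rewrite -expR_sum -expRD; case: (boolP (`|s| * d <= s * (ty z a - p a))%R) => h; last by rewrite /= expR_ge0.
  rewrite /= -[leLHS]expR0 ler_expR -mulr_sumr.
  have -> : \sum_i (z i == a)%:R = n%:R * ty z a :> R.
    by rewrite ffunE mulrC divfK.
  have : 0 <= n%:R * (s * (ty z a - p a) - `|s| * d).
    by rewrite mulr_ge0 ?ler0n // subr_ge0.
  by move=> ?; lra.
under eq_bigr do rewrite mulrCA.
rewrite -mulr_sumr (sum_prodp_prod p (fun _ t => expR (s * (t == a)%:R))).
rewrite prodr_const card_ord.
have h : \sum_t p t * expR (s * (t == a)%:R) <= expR (p a * (s + 2 * s ^+ 2)).
  have -> : \sum_t p t * expR (s * (t == a)%:R) = 1 + p a * (expR s - 1).
    rewrite -[X in _ = X + _]p1 [in RHS](bigD1 a) //= (bigD1 a) //= eqxx mulr1.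
    rewrite [in LHS](eq_bigr p); first by ring.
    by move=> t /negbTE ->; rewrite mulr0 expR0 mulr1.
  apply: le_trans (expR_ge1Dx _); rewrite lerD2l ler_wpM2l //.
  have := @expR_le_quad s; rewrite sd; move=> /(_ ltac:(lra)); lra.
apply: (@le_trans _ _ (expR (- n%:R * (s * p a + `|s| * d)) * expR (p a * (s + 2 * s ^+ 2)) ^+ n)).
  rewrite ler_wpM2l ?expR_ge0 //; apply: lerXn2r; rewrite ?nnegrE ?expR_ge0 //.
  by apply: sumr_ge0 => t _; rewrite mulr_ge0 ?expR_ge0.
(* The value [d / 4] of [|s|] minimizes [2 s^2 - |s| d], the exponent per letter when [p a = 1]. *)
rewrite -expRM_natl -expRD ler_expR.
have ss : s ^+ 2 = d ^+ 2 / 16.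
  by rewrite -[s ^+ 2]real_normK ?num_real // sd; field.
rewrite sd ss.
have : 0 <= n%:R * ((1 - p a) * d ^+ 2).
  by rewrite !mulr_ge0 ?ler0n ?sqr_ge0 // subr_ge0.
rewrite !expr2 => ?; lra.
Qed.

Lemma finite_lower_bound (T : finType) (p : T -> R) :
  exists2 c, 0 < c <= 1 & forall a, 0 < p a -> c <= p a.
Proof.
suff [c c0 h] : exists2 c, 0 < c <= 1 & forall a, a \in enum T -> 0 < p a -> c <= p a.
  by exists c => // a; apply: h; rewrite mem_enum.
elim: (enum T) => [|a s [c /andP[c0 c1] h]].
  by exists 1 => //; rewrite ltr01 lexx.
have [pa|pa] := ltP 0 (p a).
  exists (Num.min c (p a)); first by rewrite lt_min c0 pa /= ge_min c1.
  move=> b; rewrite inE => /predU1P[->|bs] pb; first by rewrite ge_min lexx orbT.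
  by rewrite ge_min h.
exists c; first by rewrite c0.
move=> b; rewrite inE => /predU1P[->|bs] pb; last exact: h.
by move: pb; rewrite ltNge pa.
Qed.

Lemma typ_whp (T : finType) (p : T -> R) (eta : R) :
  (forall t, 0 <= p t) -> \sum_t p t = 1 -> 0 < eta -> eta <= 1 ->
  exists2 c, 0 < c & forall n, (0 < n)%N ->
    \sum_(z : {ffun 'I_n -> T}) prodp p z * (~~ typ eta p z)%:R
      <= (2 * #|T|)%:R * expR (- n%:R * c).
Proof.
move=> p0 p1 e0 e1.
have [pm /andP[pm0 pm1] pmP] := finite_lower_bound p.
exists ((eta * pm) ^+ 2 / 8); first by rewrite divr_gt0 // exprn_gt0 // mulr_gt0.
(* A violation of typicality at a symbol of positive probability is a deviation of at least [d]. *)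
move=> n n0; set d := eta * pm.
have d0 : 0 <= d by rewrite mulr_ge0 // ltW.
have d1 : d <= 1 by rewrite /d mulr_ile1 // ltW.
set bound := expR _.
pose tail (a : T) (s : R) (z : {ffun 'I_n -> T}) : R := (`|s| * d <= s * (ty z a - p a))%R%:R.
have sn (s : R) : s = d / 4 \/ s = - (d / 4) -> `|s| = d / 4.
  by case=> ->; rewrite ?normrN ger0_norm // divr_ge0.
apply: (@le_trans _ _ (\sum_a (\sum_(z : {ffun 'I_n -> T}) prodp p z * tail a (d / 4) z
   + \sum_(z : {ffun 'I_n -> T}) prodp p z * tail a (- (d / 4)) z))); last first.
  apply: (@le_trans _ _ (\sum_(a : T) (bound + bound))).
    by apply: ler_sum => a _; apply: lerD; apply: chernoff_tail => //; apply: sn; auto.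
  rewrite sumr_const -mulr_natl natrM; lra.
under [leRHS]eq_bigr do rewrite -big_split /=.
rewrite exchange_big /=; apply: ler_sum => z _.
under eq_bigr do rewrite -mulrDr.
rewrite -mulr_sumr.
have tge a : 0 <= tail a (d / 4) z + tail a (- (d / 4)) z by rewrite addr_ge0.
case: (boolP (typ eta p z)) => [_|]; first by rewrite mulr0 mulr_ge0 ?prodp_ge0 ?sumr_ge0.
move=> /forallPn[a]; rewrite -ltNge => ha.
(* A violation at a symbol of zero probability means that the symbol occurs, and then the word
   itself has probability zero. *)
have [pa0|pa0] := eqVneq (p a) 0.
  suff -> : prodp p z = 0 by rewrite !mul0r.
  move: ha; rewrite pa0 subr0 mulr0 normr_gt0 => ha.
  have [i /eqP zi|h] := pickP (fun i => z i == a).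
    by rewrite /prodp (bigD1 i) //= zi pa0 mul0r.
  by move: ha; rewrite ffunE big1 ?mul0r ?eqxx // => i _; rewrite h.
rewrite /= mulr1 ler_peMr ?prodp_ge0 // (bigD1 a) //=.
apply: (@le_trans _ _ (tail a (d / 4) z + tail a (- (d / 4)) z)); last first.
  by rewrite lerDl; apply: sumr_ge0 => b _; exact: tge.
have dpa : d <= eta * p a.
  by rewrite ler_wpM2l ?(ltW e0) // pmP // lt_neqAle eq_sym pa0 p0.
have d4 : 0 <= d / 4 by rewrite divr_ge0.
rewrite /tail normrN ger0_norm // !mulNr.
move: ha; rewrite real_ltr_normr ?num_real // => /orP[] ha.
  rewrite (_ : d / 4 * d <= _ = true) ?lerDl //.
  by apply/idP; rewrite ler_wpM2l //; lra.
rewrite (_ : d / 4 * d <= - _ = true) ?lerDr //.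
by apply/idP; rewrite -mulrN ler_wpM2l //; lra.
Qed.

(** Types as elements of a finite type, so that one can sum over them; their number is polynomial in
    [n]. *)
Definition cnt (n : nat) (T : finType) (z : {ffun 'I_n -> T}) : {ffun T -> 'I_n.+1} :=
  [ffun a => inord (\sum_i (z i == a))].

Definition ty_of (n : nat) (T : finType) (k : {ffun T -> 'I_n.+1}) : {ffun T -> R} :=
  [ffun a => (k a)%:R / n%:R].

Lemma ty_of_cnt n (T : finType) (z : {ffun 'I_n -> T}) : ty_of (cnt z) = ty z.
Proof.
apply/ffunP => a; rewrite !ffunE inordK -?natr_sum //.
rewrite ltnS -[leqRHS]card_ord -sum1_card; apply: leq_sum => i _.
by case: (z i == a).
Qed.

End Types.

Arguments ty {R n T} z.
Arguments ty_of {R n T} k.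

Lemma leq_bool (b1 b2 : bool) : (b1 -> b2) -> (b1 <= b2)%N.
Proof. by case: b1 b2 => [] [] // h; have := h isT. Qed.

(** * One-shot error bound for a random code with candidate lists *)

Section OneShot.
Variable R : realType.
Variables S1 S2 S3 Th I A M K : finType.
Variables (p1 : S1 -> R) (p2 : S2 -> R).
Hypothesis p1_ge0 : forall s, 0 <= p1 s.
Hypothesis p2_ge0 : forall t, 0 <= p2 t.
Hypothesis p1_sum : \sum_s p1 s = 1.
Hypothesis p2_sum : \sum_t p2 t = 1.

Local Notation code := ({ffun I -> S1} * {ffun A -> S2})%type.

Definition Ec (F : code -> R) : R :=
  \sum_(c : code) prodp p1 c.1 * prodp p2 c.2 * F c.

Lemma EcE F : Ec F = \sum_(c1 : {ffun I -> S1}) prodp p1 c1 *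
  \sum_(c2 : {ffun A -> S2}) prodp p2 c2 * F (c1, c2).
Proof.
under [RHS]eq_bigr do rewrite mulr_sumr.
rewrite pair_bigA /Ec /=; apply: eq_bigr => -[c1 c2] _ /=; by rewrite mulrA.
Qed.

Lemma le_Ec F G : (forall c, F c <= G c) -> Ec F <= Ec G.
Proof. by move=> h; apply: ler_sum => c _; rewrite ler_wpM2l ?mulr_ge0 ?prodp_ge0. Qed.

Lemma EcD F G : Ec (fun c => F c + G c) = Ec F + Ec G.
Proof. by rewrite /Ec -big_split; apply: eq_bigr => c _; rewrite mulrDr. Qed.

Lemma Ec_sum (J : finType) (P : pred J) (F : J -> code -> R) :
  Ec (fun c => \sum_(j | P j) F j c) = \sum_(j | P j) Ec (F j).
Proof. by rewrite /Ec exchange_big; apply: eq_bigr => c _; rewrite mulr_sumr. Qed.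

Lemma Ec_coord i a (F : S1 -> S2 -> R) :
  Ec (fun c => F (c.1 i) (c.2 a)) = \sum_s p1 s * \sum_t p2 t * F s t.
Proof.
rewrite EcE /= -(sum_prodp_coord i _ p1_sum); apply: eq_bigr => c1 _; congr (_ * _).
exact: (sum_prodp_coord a (F (c1 i)) p2_sum).
Qed.

Section Competitors.
Variables (H : S1 -> S2 -> S3 -> R) (b : R).

Let g := \sum_s p1 s * \sum_t p2 t * \sum_y H s t y.

(** The word with index [a'] is independent of the sent pair and of the output, so its conditional
    chance of competing is at most [b] wherever the weight [H] is nonzero. The next two lemmas treat
    a fresh first word and a fresh pair. *)
Lemma Ec_sat i a a' (B : S1 -> S2 -> S3 -> S2 -> R) : a != a' ->
  (forall s t y, H s t y * \sum_t' p2 t' * B s t y t' <= H s t y * b) ->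
  Ec (fun c => \sum_y H (c.1 i) (c.2 a) y * B (c.1 i) (c.2 a) y (c.2 a')) <= b * g.
Proof.
move=> aa' hB; rewrite EcE /=.
rewrite (eq_bigr (fun c1 => prodp p1 c1 * \sum_t p2 t * \sum_t' p2 t' *
    \sum_y H (c1 i) t y * B (c1 i) t y t')); last first.
  move=> c1 _; congr (_ * _).
  by rewrite (sum_prodp_coord2 (fun t t' => \sum_y H (c1 i) t y * B (c1 i) t y t')).
rewrite (sum_prodp_coord i (fun s => \sum_t p2 t * \sum_t' p2 t' *
    \sum_y H s t y * B s t y t')) // /g mulr_sumr.
apply: ler_sum => s _; rewrite mulrCA ler_wpM2l // mulr_sumr.
apply: ler_sum => t _; rewrite mulrCA ler_wpM2l // mulr_sumr.
under eq_bigr do rewrite mulr_sumr.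
rewrite exchange_big /=; apply: ler_sum => y _; rewrite mulrC.
apply: le_trans (hB s t y); rewrite mulr_sumr; apply: ler_sum => t' _.
by rewrite mulrCA.
Qed.

Lemma Ec_cloud i i' a (B : S1 -> S2 -> S3 -> S1 -> R) : i != i' ->
  (forall s t y, H s t y * \sum_s' p1 s' * B s t y s' <= H s t y * b) ->
  Ec (fun c => \sum_y H (c.1 i) (c.2 a) y * B (c.1 i) (c.2 a) y (c.1 i')) <= b * g.
Proof.
move=> ii' hB; rewrite EcE /=.
rewrite (eq_bigr (fun c1 => prodp p1 c1 * \sum_t p2 t *
    \sum_y H (c1 i) t y * B (c1 i) t y (c1 i'))); last first.
  move=> c1 _; congr (_ * _).
  exact: (sum_prodp_coord a (fun t => \sum_y H (c1 i) t y * B (c1 i) t y (c1 i'))).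
rewrite (sum_prodp_coord2 (fun s s' => \sum_t p2 t *
    \sum_y H s t y * B s t y s')) // /g mulr_sumr.
apply: ler_sum => s _; rewrite mulrCA ler_wpM2l // mulr_sumr.
under eq_bigr do rewrite mulr_sumr.
rewrite exchange_big /=; apply: ler_sum => t _.
under eq_bigr do rewrite mulrCA.
rewrite -mulr_sumr mulrCA ler_wpM2l // mulr_sumr.
under eq_bigr do rewrite mulr_sumr.
rewrite exchange_big /=; apply: ler_sum => y _; rewrite mulrC.
apply: le_trans (hB s t y); rewrite mulr_sumr; apply: ler_sum => t' _.
by rewrite mulrCA.
Qed.

Lemma Ec_pair i i' a a' (B : S1 -> S2 -> S3 -> S1 -> S2 -> R) : i != i' -> a != a' ->
  (forall s t y,
    H s t y * \sum_s' p1 s' * \sum_t' p2 t' * B s t y s' t' <= H s t y * b) ->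
  Ec (fun c => \sum_y H (c.1 i) (c.2 a) y * B (c.1 i) (c.2 a) y (c.1 i') (c.2 a'))
    <= b * g.
Proof.
move=> ii' aa' hB; rewrite EcE /=.
rewrite (eq_bigr (fun c1 => prodp p1 c1 * \sum_t p2 t * \sum_t' p2 t' *
    \sum_y H (c1 i) t y * B (c1 i) t y (c1 i') t')); last first.
  move=> c1 _; congr (_ * _).
  by rewrite (sum_prodp_coord2 (fun t t' => \sum_y H (c1 i) t y * B (c1 i) t y (c1 i') t')).
rewrite (sum_prodp_coord2 (fun s s' => \sum_t p2 t * \sum_t' p2 t' *
    \sum_y H s t y * B s t y s' t')) // /g mulr_sumr.
apply: ler_sum => s _; rewrite mulrCA ler_wpM2l // mulr_sumr.
under eq_bigr do rewrite mulr_sumr.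
rewrite exchange_big /=; apply: ler_sum => t _.
under eq_bigr do rewrite mulrCA.
rewrite -mulr_sumr mulrCA ler_wpM2l // mulr_sumr.
under eq_bigr do under eq_bigr do rewrite mulr_sumr.
under eq_bigr do rewrite exchange_big mulr_sumr /=.
rewrite exchange_big /=; apply: ler_sum => y _; rewrite mulrC.
apply: le_trans (hB s t y); rewrite mulr_sumr; apply: ler_sum => s' _.
rewrite [leRHS]mulrCA ler_wpM2l // mulr_sumr; apply: ler_sum => t' _.
by rewrite mulrCA.
Qed.

End Competitors.

Lemma exists_le_sum (T : finType) (P F : pred T) :
  [exists x, P x && F x]%:R <= \sum_(x | P x) (F x)%:R :> R.
Proof.
have [/existsP[x /andP[Px Fx]]|_] := boolP [exists x, P x && F x]; last by rewrite sumr_ge0.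
by rewrite (bigD1 x) //= Fx lerDl sumr_ge0.
Qed.

(* [cand m k] is the [k]-th pair of codewords available to message [m]; the encoder uses one
   satisfying [T2] (jointly typical inputs).  [T3] is typicality of the triple with the output. *)
Variables (k0 : K) (Wn : S1 -> S2 -> S3 -> R) (T2 : S1 -> S2 -> bool).
Variables (T3 : S1 -> S2 -> S3 -> bool) (sc : S1 -> S2 -> S3 -> R).
Variables (e : S1 -> S2 -> S3 -> Th) (good : pred Th) (cand : M -> K -> I * A).

Hypothesis Wn_ge0 : forall s t y, 0 <= Wn s t y.
Hypothesis Wn_sum : forall s t, \sum_y Wn s t y = 1.

Definition covers (c : code) m k := T2 (c.1 (cand m k).1) (c.2 (cand m k).2).

(** The default [k0] is used only when the covering of [m] fails, an event counted as an error. *)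
Definition sel (c : code) m : K := odflt k0 [pick k | covers c m k].

Definition err (c : code) m : R :=
  \sum_y Wn (c.1 (cand m (sel c m)).1) (c.2 (cand m (sel c m)).2) y *
    (~~ [forall m', (m' != m) ==>
       (sc (c.1 (cand m' (sel c m')).1) (c.2 (cand m' (sel c m')).2) y <
        sc (c.1 (cand m (sel c m)).1) (c.2 (cand m (sel c m)).2) y)%R])%:R.

(** A tie counts against the sent pair because the decoder asks for strict inequality; [T2 s' t'] is
    available because a covered message sends only such pairs. *)
Definition beat s t y s' t' := T2 s' t' && (sc s t y <= sc s' t' y).

Definition rival m (ia : I * A) :=
  [exists m', exists k', (m' != m) && (cand m' k' == ia)].

Hypothesis own_not_rival : forall m k, ~~ rival m (cand m k).

(* Rivals of [ia] sharing its first component (A), its second component (B), or none (C). *)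
Definition rivalA m (ia : I * A) a' := (a' != ia.2) && rival m (ia.1, a').
Definition rivalB m (ia : I * A) i' := (i' != ia.1) && rival m (i', ia.2).
Definition rivalC m (ia : I * A) (ia' : I * A) :=
  [&& ia'.1 != ia.1, ia'.2 != ia.2 & rival m ia'].
Definition rivalCi m (ia : I * A) i' := (i' != ia.1) && [exists a', rivalC m ia (i', a')].
Definition rivalCa m (ia : I * A) a' := (a' != ia.2) && [exists i', rivalC m ia (i', a')].

Variables (nA nB nCi nCa nC bA bB bC f at0 g : R).
Hypothesis nAP : forall m k, #|rivalA m (cand m k)|%:R <= nA.
Hypothesis nBP : forall m k, #|rivalB m (cand m k)|%:R <= nB.
Hypothesis nCiP : forall m k, #|rivalCi m (cand m k)|%:R <= nCi.
Hypothesis nCaP : forall m k, #|rivalCa m (cand m k)|%:R <= nCa.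
Hypothesis nCP : forall m k, #|rivalC m (cand m k)|%:R <= nC.
Hypothesis bA_ge0 : 0 <= bA.
Hypothesis bB_ge0 : 0 <= bB.
Hypothesis bC_ge0 : 0 <= bC.
Hypothesis goodP : forall s t y s' t', T2 s t -> T3 s t y -> beat s t y s' t' ->
  good (e s' t' y).
Hypothesis HA : forall s t y, T2 s t -> T3 s t y ->
  \sum_t' p2 t' * (beat s t y s t')%:R <= bA.
Hypothesis HB : forall s t y, T2 s t -> T3 s t y ->
  \sum_s' p1 s' * (beat s t y s' t)%:R <= bB.
(** Which union bound is cheapest depends on the joint type: over the wrong first words, over the
    wrong second words, or over the wrong pairs. This choice produces the positive part in [R1'']
    and [R2'']. *)
Hypothesis HC : forall th, good th ->
  [\/ forall y, nCi * \sum_s' p1 s' * [exists t', e s' t' y == th]%:R <= bC,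
      forall y, nCa * \sum_t' p2 t' * [exists s', e s' t' y == th]%:R <= bC |
      forall y, nC * \sum_s' p1 s' * \sum_t' p2 t' * (e s' t' y == th)%:R <= bC].
Hypothesis failP : forall m, Ec (fun c => [forall k, ~~ covers c m k]%:R) <= f.
Hypothesis atP : \sum_s p1 s * \sum_t p2 t *
  ((T2 s t)%:R * \sum_y Wn s t y * (~~ T3 s t y)%:R) <= at0.
Hypothesis gP : \sum_s p1 s * \sum_t p2 t * (T2 s t)%:R <= g.

Let Hw s t y : R := (T2 s t && T3 s t y)%:R * Wn s t y.

(** The third class is split by type, so that [HC] can be applied to each type separately. *)
Let compC m k (c : code) y th : bool := good th &&
  [exists ia', rivalC m (cand m k) ia' && (e (c.1 ia'.1) (c.2 ia'.2) y == th)].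

(** The covering failures of all messages are summed, since the pair selected by a wrong message is
    known to be typical only if that message is covered. *)
Lemma err_le c m : err c m <= \sum_m' [forall k, ~~ covers c m' k]%:R +
  \sum_k (let s := c.1 (cand m k).1 in let t := c.2 (cand m k).2 in
    (T2 s t)%:R * (\sum_y Wn s t y * (~~ T3 s t y)%:R) +
    (\sum_(a' | rivalA m (cand m k) a') \sum_y Hw s t y * (beat s t y s (c.2 a'))%:R +
     \sum_(i' | rivalB m (cand m k) i') \sum_y Hw s t y * (beat s t y (c.1 i') t)%:R +
     \sum_th \sum_y Hw s t y * (compC m k c y th)%:R)).
Proof.
have Hw0 s t y : 0 <= Hw s t y by rewrite /Hw mulr_ge0.
have term0 k : 0 <= (let s := c.1 (cand m k).1 in let t := c.2 (cand m k).2 in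
    (T2 s t)%:R * (\sum_y Wn s t y * (~~ T3 s t y)%:R) +
    (\sum_(a' | rivalA m (cand m k) a') \sum_y Hw s t y * (beat s t y s (c.2 a'))%:R +
     \sum_(i' | rivalB m (cand m k) i') \sum_y Hw s t y * (beat s t y (c.1 i') t)%:R +
     \sum_th \sum_y Hw s t y * (compC m k c y th)%:R)).
  by rewrite /= !addr_ge0 ?mulr_ge0 ?sumr_ge0 // => ? _;
    rewrite ?mulr_ge0 ?sumr_ge0 // => ? _; rewrite mulr_ge0.
have [/existsP[m1 fm1]|/existsPn nofail] :=
    boolP [exists m', [forall k, ~~ covers c m' k]].
  rewrite (bigD1 m1) //= fm1 -addrA.
  apply: (@le_trans _ _ 1); last first.
    by rewrite lerDl addr_ge0 // sumr_ge0.
  rewrite /err -[leRHS](Wn_sum (c.1 (cand m (sel c m)).1) (c.2 (cand m (sel c m)).2)).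
  by apply: ler_sum => y _; rewrite ler_piMr // lern1 leq_b1.
have selP m' : covers c m' (sel c m').
  rewrite /sel; case: pickP => //= h; have /negP[] := nofail m'.
  by apply/forallP => k; rewrite h.
apply: ler_wpDl; first by apply: sumr_ge0.
rewrite (bigD1 (sel c m)) //=; set k := sel c m.
have T2k : T2 (c.1 (cand m k).1) (c.2 (cand m k).2) by exact: selP.
apply: ler_wpDr; first by apply: sumr_ge0 => k1 _; exact: term0.
rewrite /err -/k.
set s := c.1 (cand m k).1; set t := c.2 (cand m k).2.
rewrite -/s -/t in T2k; rewrite T2k mul1r.
rewrite [X in _ <= _ + (X + _ + _)]exchange_big [X in _ <= _ + (_ + X + _)]exchange_big.
rewrite [X in _ <= _ + (_ + _ + X)]exchange_big.
rewrite -!big_split /=; apply: ler_sum => y _.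
rewrite -!mulr_sumr -!mulrDr /Hw T2k /=.
have [T3y|_] := boolP (T3 s t y); last first.
  by rewrite /= !mul0r addr0 mulr1 ler_piMr // lern1 leq_b1.
rewrite /= mul1r mulr0 add0r ler_wpM2l //.
have [/forallPn[m']|_] := boolP (~~ _); last by rewrite /= !addr_ge0 // sumr_ge0.
rewrite negb_imply -leNgt => /andP[m'm scm'].
set k' := sel c m' in scm'.
have bt : beat s t y (c.1 (cand m' k').1) (c.2 (cand m' k').2).
  by rewrite /beat scm' andbT; exact: selP.
have rv : rival m (cand m' k').
  by apply/existsP; exists m'; apply/existsP; exists k'; rewrite m'm eqxx.
case E: (cand m' k') => [i' a'] in bt rv *; rewrite /= in bt.
have [ii|ii] := eqVneq i' (cand m k).1; have [aa|aa] := eqVneq a' (cand m k).2.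
- by have := own_not_rival m k; rewrite [cand m k]surjective_pairing -ii -aa rv.
- rewrite (bigD1 a') /=; last by rewrite /rivalA aa -ii.
  have es : c.1 i' = s by rewrite /s -ii.
  by rewrite es in bt; rewrite bt /= -!addrA lerDl !addr_ge0 // sumr_ge0.
- rewrite [X in _ + X + _](bigD1 i') /=; last by rewrite /rivalB ii -aa.
  have et : c.2 a' = t by rewrite /t -aa.
  by rewrite et in bt; rewrite bt /= -!addrA addrCA lerDl !addr_ge0 // sumr_ge0.
rewrite [X in _ + X](bigD1 (e (c.1 i') (c.2 a') y)) //=.
rewrite (_ : compC _ _ _ _ _ = true); last first.
  rewrite /compC (goodP T2k T3y bt); apply/existsP; exists (i', a').
  by rewrite /rivalC ii aa rv eqxx.
by rewrite /= addrCA lerDl !addr_ge0 // sumr_ge0.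
Qed.

(** The mass [g] of typical pairs under independent drawing multiplies every competitor term; this
    factor is what pays for the sum over the [#|K|] candidates. *)
Theorem one_shot_bound m :
  Ec (err^~ m) <= #|M|%:R * f + #|K|%:R *
    (at0 + g * (nA * bA + nB * bB + #|Th|%:R * bC)).
Proof.
have Hw0 s t y : 0 <= Hw s t y by rewrite /Hw mulr_ge0.
have Hwg : \sum_s p1 s * \sum_t p2 t * \sum_y Hw s t y <= g.
  apply: le_trans gP; apply: ler_sum => s _; rewrite ler_wpM2l //.
  apply: ler_sum => t _; rewrite ler_wpM2l //.
  have -> : (T2 s t)%:R = (T2 s t)%:R * \sum_y Wn s t y :> R by rewrite Wn_sum mulr1.
  rewrite mulr_sumr.
  by apply: ler_sum => y _; rewrite /Hw ler_wpM2r // ler_nat; case: (T2 s t) => //=; exact: leq_b1.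
have g0 : 0 <= g.
  apply: le_trans Hwg; apply: sumr_ge0 => s _; rewrite mulr_ge0 //.
  by apply: sumr_ge0 => t _; rewrite mulr_ge0 // sumr_ge0.
apply: (le_trans (le_Ec (fun c => err_le c m))).
rewrite EcD !Ec_sum; apply: lerD.
  apply: (@le_trans _ _ (\sum_(m' : M) f)).
    by apply: ler_sum => m1 _; exact: failP.
  by rewrite sumr_const [leRHS]mulr_natl.
apply: (@le_trans _ _ (\sum_(k : K) (at0 + g * (nA * bA + nB * bB + #|Th|%:R * bC))));
  last by rewrite sumr_const [leRHS]mulr_natl.
apply: ler_sum => k _; rewrite /= EcD; apply: lerD.
  by rewrite (Ec_coord _ _ (fun s t => (T2 s t)%:R * \sum_y Wn s t y * (~~ T3 s t y)%:R)).
rewrite 2!EcD !Ec_sum 2!mulrDr.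
have sum_le (J : finType) (P : pred J) (F : J -> R) (n b : R) :
    #|P|%:R <= n -> 0 <= b -> (forall j, P j -> F j <= b * g) ->
    \sum_(j | P j) F j <= g * (n * b).
  move=> Pn b0 h; apply: (@le_trans _ _ (\sum_(j | P j) b * g)); first exact: ler_sum.
  rewrite sumr_const -mulr_natl (mulrC g) -mulrA.
  by rewrite ler_wpM2r // mulr_ge0.
have bg (b : R) : 0 <= b -> b * (\sum_s p1 s * \sum_t p2 t * \sum_y Hw s t y) <= b * g.
  by move=> b0; rewrite ler_wpM2l.
apply: lerD; first apply: lerD.
- apply: (sum_le _ _ _ _ _) => // a' /andP[aa' _]; apply: le_trans (bg _ bA_ge0).
  apply: (@Ec_sat Hw bA _ _ _ (fun s t y t' => (beat s t y s t')%:R)).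
    by rewrite eq_sym.
  move=> s t y; rewrite /Hw; have [/andP[T2s T3s]|_] := boolP (_ && _); last by rewrite !mul0r.
  by rewrite mul1r ler_wpM2l // HA.
- apply: (sum_le _ _ _ _ _) => // i' /andP[ii' _]; apply: le_trans (bg _ bB_ge0).
  apply: (@Ec_cloud Hw bB _ _ _ (fun s t y s' => (beat s t y s' t)%:R)).
    by rewrite eq_sym.
  move=> s t y; rewrite /Hw; have [/andP[T2s T3s]|_] := boolP (_ && _); last by rewrite !mul0r.
  by rewrite mul1r ler_wpM2l // HB.
apply: (sum_le _ _ _ _ _) => // th _.
have [gth|gth] := boolP (good th); last first.
  rewrite [leLHS](_ : _ = 0) ?mulr_ge0 // /Ec big1 // => c _.
  by rewrite big1 ?mulr0 // => y _; rewrite /compC (negbTE gth) mulr0.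
have [h|h|h] := HC gth.
- apply: (@le_trans _ _ (\sum_(i' | rivalCi m (cand m k) i')
     Ec (fun c => \sum_y Hw (c.1 (cand m k).1) (c.2 (cand m k).2) y *
       [exists t', e (c.1 i') t' y == th]%:R))).
    rewrite -Ec_sum; apply: le_Ec => c; rewrite exchange_big /=.
    apply: ler_sum => y _; rewrite -mulr_sumr ler_wpM2l //.
    apply: le_trans (exists_le_sum _ _); rewrite ler_nat /compC gth /=.
    apply: leq_bool => /existsP[[i' a'] /andP[rc /eqP ee]].
    apply/existsP; exists i'; apply/andP; split.
      by rewrite /rivalCi; case/and3P: (rc) => -> _ _ /=; apply/existsP; exists a'.
    by apply/existsP; exists (c.2 a'); apply/eqP.
  (* [Ec_cloud] needs one number valid for all [y]. Taking the maximum, rather than [bC / nCi],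
     avoids dividing by a count that may be zero. *)
  pose b := \big[Num.max/0]_y (\sum_s' p1 s' * [exists t', e s' t' y == th]%:R).
  have b0 : 0 <= b by apply: bigmax_ge_id.
  have nb : #|rivalCi m (cand m k)|%:R * b <= bC.
    apply: le_trans (_ : nCi * b <= _); first by rewrite ler_wpM2r.
    rewrite /b; elim/big_rec: _ => [|y x _ hx]; first by rewrite mulr0.
    by rewrite /Num.max; case: ifP.
  apply: (@le_trans _ _ (g * (#|rivalCi m (cand m k)|%:R * b))); last first.
    by rewrite mulrC ler_wpM2r.
  apply: (sum_le _ _ _ _ _) => // i' /andP[ii' _]; apply: le_trans (bg _ b0).
  apply: (@Ec_cloud Hw b _ _ _ (fun s t y s' => [exists t', e s' t' y == th]%:R)).
    by rewrite eq_sym.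
  by move=> s t y; rewrite ler_wpM2l //; exact: le_bigmax_cond.
- apply: (@le_trans _ _ (\sum_(a' | rivalCa m (cand m k) a')
     Ec (fun c => \sum_y Hw (c.1 (cand m k).1) (c.2 (cand m k).2) y *
       [exists s', e s' (c.2 a') y == th]%:R))).
    rewrite -Ec_sum; apply: le_Ec => c; rewrite exchange_big /=.
    apply: ler_sum => y _; rewrite -mulr_sumr ler_wpM2l //.
    apply: le_trans (exists_le_sum _ _); rewrite ler_nat /compC gth /=.
    apply: leq_bool => /existsP[[i' a'] /andP[rc /eqP ee]].
    apply/existsP; exists a'; apply/andP; split.
      by rewrite /rivalCa; case/and3P: (rc) => _ -> _ /=; apply/existsP; exists i'.
    by apply/existsP; exists (c.1 i'); apply/eqP.
  pose b := \big[Num.max/0]_y (\sum_t' p2 t' * [exists s', e s' t' y == th]%:R).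
  have b0 : 0 <= b by apply: bigmax_ge_id.
  have nb : #|rivalCa m (cand m k)|%:R * b <= bC.
    apply: le_trans (_ : nCa * b <= _); first by rewrite ler_wpM2r.
    rewrite /b; elim/big_rec: _ => [|y x _ hx]; first by rewrite mulr0.
    by rewrite /Num.max; case: ifP.
  apply: (@le_trans _ _ (g * (#|rivalCa m (cand m k)|%:R * b))); last first.
    by rewrite mulrC ler_wpM2r.
  apply: (sum_le _ _ _ _ _) => // a' /andP[aa' _]; apply: le_trans (bg _ b0).
  apply: (@Ec_sat Hw b _ _ _ (fun s t y t' => [exists s', e s' t' y == th]%:R)).
    by rewrite eq_sym.
  by move=> s t y; rewrite ler_wpM2l //; exact: le_bigmax_cond.
apply: (@le_trans _ _ (\sum_(ia' | rivalC m (cand m k) ia')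
   Ec (fun c => \sum_y Hw (c.1 (cand m k).1) (c.2 (cand m k).2) y *
     (e (c.1 ia'.1) (c.2 ia'.2) y == th)%:R))).
  rewrite -Ec_sum; apply: le_Ec => c; rewrite exchange_big /=.
  apply: ler_sum => y _; rewrite -mulr_sumr ler_wpM2l //.
  by apply: le_trans (exists_le_sum _ _); rewrite ler_nat /compC gth.
pose b := \big[Num.max/0]_y (\sum_s' p1 s' * \sum_t' p2 t' * (e s' t' y == th)%:R).
have b0 : 0 <= b by apply: bigmax_ge_id.
have nb : #|rivalC m (cand m k)|%:R * b <= bC.
  apply: le_trans (_ : nC * b <= _); first by rewrite ler_wpM2r.
  rewrite /b; elim/big_rec: _ => [|y x _ hx]; first by rewrite mulr0.
  by rewrite /Num.max; case: ifP.
apply: (@le_trans _ _ (g * (#|rivalC m (cand m k)|%:R * b))); last first.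
  by rewrite mulrC ler_wpM2r.
apply: (sum_le _ _ _ _ _) => // -[i' a'] /and3P[ii' aa' _]; apply: le_trans (bg _ b0).
apply: (@Ec_pair Hw b _ _ _ _ (fun s t y s' t' => (e s' t' y == th)%:R)) => /=.
- by rewrite eq_sym.
- by rewrite eq_sym.
by move=> s t y; rewrite ler_wpM2l //; exact: le_bigmax_cond.
Qed.

End OneShot.

(** * Continuity of entropies and compactness *)

Section Continuity.
Variables (R : realType) (T : finType).

(** Row vectors carry the topology and the compactness of boxes; continuity on distributions is read
    off through this identification. *)
Definition ffun_of (v : 'rV[R]_#|T|) : {ffun T -> R} :=
  [ffun t => v 0 (enum_rank t)].

Definition ccont (F : {ffun T -> R} -> R) := continuous (fun v => F (ffun_of v)).

Lemma ccont_coord t : ccont (fun V => V t).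
Proof.
rewrite /ccont (_ : (fun v => _) = (fun v : 'rV[R]_#|T| => v 0 (enum_rank t))).
  exact: coord_continuous.
by apply/funext => v; rewrite ffunE.
Qed.

Lemma ccont_cst c : ccont (fun=> c).
Proof. exact: (@cst_continuous _ _ c). Qed.

Lemma ccontD F G : ccont F -> ccont G -> ccont (fun V => F V + G V).
Proof. by move=> hF hG v; apply: (continuousD (hF v) (hG v)). Qed.

Lemma ccontM F G : ccont F -> ccont G -> ccont (fun V => F V * G V).
Proof. by move=> hF hG v; apply: (continuousM (hF v) (hG v)). Qed.

Lemma ccontN F : ccont F -> ccont (fun V => - F V).
Proof. by move=> hF v; apply: (continuousN (hF v)). Qed.

Lemma ccontB F G : ccont F -> ccont G -> ccont (fun V => F V - G V).
Proof. by move=> hF hG; apply: ccontD => //; exact: ccontN. Qed.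

Lemma ccont_comp F (h : R -> R) : continuous h -> ccont F -> ccont (fun V => h (F V)).
Proof. by move=> hh hF v; apply: (continuous_comp (hF v) (hh _)). Qed.

Lemma ccont_norm F : ccont F -> ccont (fun V => `|F V|).
Proof. apply: ccont_comp; exact: (@norm_continuous _ R^o). Qed.

Lemma ccont_max F G : ccont F -> ccont G -> ccont (fun V => Num.max (F V) (G V)).
Proof.
move=> hF hG; rewrite (_ : (fun V => _) =
  (fun V => (F V + G V + `|F V - G V|) * 2^-1)); last by apply/funext => V; rewrite maxr_absE.
apply: ccontM; last exact: ccont_cst.
by apply: ccontD; [exact: ccontD|apply: ccont_norm; exact: ccontB].
Qed.

Lemma ccont_sum (J : Type) (r : seq J) (P : pred J) (F : J -> {ffun T -> R} -> R) :
  (forall j, ccont (F j)) -> ccont (fun V => \sum_(j <- r | P j) F j V).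
Proof.
move=> hF; elim: r => [|j r IH].
  rewrite (_ : (fun V => _) = fun=> 0); first exact: ccont_cst.
  by apply/funext => V; rewrite big_nil.
rewrite (_ : (fun V => _) = fun V => (if P j then F j V else 0) +
    \sum_(j <- r | P j) F j V).
  apply: ccontD => //; case: (P j); [exact: hF|exact: ccont_cst].
by apply/funext => V; rewrite big_cons; case: ifP => // _; rewrite add0r.
Qed.

Lemma continuous_xlnx : continuous (fun x : R => x * ln x).
Proof.
move=> x; have [x0|x0|->] := ltgtP x 0.
- rewrite /continuous_at ln0 ?mulr0 ?ltW //; apply: cvg_near_cst.
  near=> y; rewrite ln0 ?mulr0 //.
  by apply/ltW; near: y; exact: lt_nbhsl.
- have h : {for x, continuous ((fun y : R => y) \* @ln R)}.
    exact: (continuousM (s := fun y => y) (fun A hA => hA) (continuous_ln x0)).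
  exact: h.
rewrite /continuous_at mul0r; apply/cvgrPdist_lt => e e0.
have d0 : 0 < Num.min 1 ((e / 2) ^+ 2) by rewrite lt_min ltr01 exprn_gt0 // divr_gt0.
near=> y; rewrite sub0r normrN.
have [y0|y0] := leP y 0; first by rewrite ln0 // mulr0 normr0.
have : y < Num.min 1 ((e / 2) ^+ 2) by near: y; exact: lt_nbhsl.
rewrite lt_min => /andP[y1 ye].
(* With [y = u^2] and [ln (1 / u) <= 1 / u], the product [y ln y] is at most [2 u] in absolute
   value. *)
set u := Num.sqrt y; have u0 : 0 < u by rewrite sqrtr_gt0.
have yu : y = u ^+ 2 by rewrite sqr_sqrtr // ltW.
have u1 : u < 1 by move: y1; rewrite yu expr_lt1 // ltW.
have ue : u < e / 2 by move: ye; rewrite yu ltr_pXn2r // nnegrE ltW // divr_gt0.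
have := ln_sublinear (x := u^-1); rewrite invr_gt0 => /(_ u0).
rewrite lnV ?posrE // => h.
have lu : ln u < 0 by rewrite -ln1 ltr_ln ?posrE.
rewrite yu lnXn // ltr0_norm; last by rewrite pmulr_rlt0 ?exprn_gt0 // pmulrn_llt0.
have : u ^+ 2 * - ln u <= u ^+ 2 * u^-1 by rewrite ler_wpM2l ?sqr_ge0 // ltW.
rewrite expr2 -(mulrA u u u^-1) divff ?lt0r_neq0 // mulr1 mulr2n => ?; lra.
Unshelve. all: end_near. Qed.

Lemma ccont_entropy_marg (U : finType) (f : T -> U) : ccont (Hf f).
Proof.
rewrite /Hf (_ : (fun p => _) = fun p : {ffun T -> R} =>
  - \sum_u (let x := \sum_(t | f t == u) p t in x * ln x * (ln 2)^-1)).
  apply: ccontN; apply: ccont_sum => u; apply: ccontM; last exact: ccont_cst.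
  apply: (ccont_comp continuous_xlnx); apply: ccont_sum => t; exact: ccont_coord.
apply/funext => p; rewrite entropyE; congr (- _); apply: eq_bigr => u _.
by rewrite /log2 !ffunE mulrA.
Qed.

(* [max F G] is positive on the cube, hence bounded away from [0] there. *)
Lemma compact_margin (F G : {ffun T -> R} -> R) : ccont F -> ccont G ->
  (forall V : {ffun T -> R}, (forall t, 0 <= V t <= 1) -> F V <= 0 -> 0 < G V) ->
  exists2 eta, 0 < eta &
    forall V : {ffun T -> R}, (forall t, 0 <= V t <= 1) -> F V <= eta -> eta <= G V.
Proof.
move=> cF cG FG.
pose A := [set v : 'rV[R]_#|T| | forall i, `[0, 1]%classic (v ord0 i)].
have cA : compact A.
  by apply: (@rV_compact R _ (fun=> `[0 : R, 1]%classic)) => i; exact: segment_compact.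
have A0 : A !=set0.
  by exists (const_mx 0) => i /=; rewrite mxE in_itv /= lexx ler01.
have cM : continuous (fun v => Num.max (F (ffun_of v)) (G (ffun_of v))) := ccont_max cF cG.
have [v vA vmin] := compact_EVT_min A0 cA (continuous_subspaceT cM).
have boxP w : A w -> forall t, 0 <= ffun_of w t <= 1.
  by move=> Aw t; rewrite ffunE; have := Aw (enum_rank t); rewrite /= in_itv.
rewrite inE in vA; pose m := Num.max (F (ffun_of v)) (G (ffun_of v)).
have m0 : 0 < m.
  rewrite /m lt_max; have [//|h] := ltP 0 (F (ffun_of v)); exact: FG (boxP _ vA) h.
exists (m / 2); first by rewrite divr_gt0.
move=> V hV FV; pose w : 'rV[R]_#|T| := \row_i V (enum_val i).
have wV : ffun_of w = V by apply/ffunP => t; rewrite ffunE mxE enum_rankK.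
have Aw : w \in A by rewrite inE => i /=; rewrite mxE in_itv /= hV.
have := vmin _ Aw; rewrite -/m wV le_max => /orP[mF|mG]; lra.
Qed.

End Continuity.

Definition zip2 (n : nat) (A B : finType) (s : {ffun 'I_n -> A}) (t : {ffun 'I_n -> B}) :
  {ffun 'I_n -> A * B} := [ffun i => (s i, t i)].

Lemma sum_zip2 (R : realType) n (A B : finType) (F : {ffun 'I_n -> A * B} -> R) :
  \sum_s \sum_t F (zip2 s t) = \sum_z F z.
Proof.
rewrite pair_bigA /= (reindex (fun z : {ffun 'I_n -> A * B} =>
  ([ffun i => (z i).1], [ffun i => (z i).2]))) /=.
  apply: eq_bigr => z _; congr F; apply/ffunP => i; rewrite !ffunE.
  by rewrite -surjective_pairing.
exists (fun st => zip2 st.1 st.2) => [z _|[s t] _] /=.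
  by apply/ffunP => i; rewrite !ffunE -surjective_pairing.
by congr pair; apply/ffunP => i; rewrite !ffunE.
Qed.

(** * Product of the marginals against the joint law on typical pairs *)

Section ChangeOfMeasure.
Variables (R : realType) (X1 X2 : finType) (Q : {ffun X1 * X2 -> R}).
Hypothesis Qpmf : is_pmf Q.

Definition Q1 : X1 -> R := marg fst Q.
Definition Q2 : X2 -> R := marg snd Q.
Definition I12 : R := Hf fst Q + Hf snd Q - entropy Q.
Definition info_density a : R := log2 (Q a) - log2 (Q1 a.1) - log2 (Q2 a.2).
Definition info_density_l1 : R := \sum_a Q a * `|info_density a|.

Let Q_ge0 a : 0 <= Q a. Proof. by case: Qpmf. Qed.

Lemma Q1_pmf : is_pmf (marg fst Q). Proof. exact: marg_pmf. Qed.
Lemma Q2_pmf : is_pmf (marg snd Q). Proof. exact: marg_pmf. Qed.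

Lemma sum_info_density : \sum_a Q a * info_density a = I12.
Proof.
under eq_bigr do rewrite /info_density !mulrBr; rewrite !sumrB /I12 /Hf !entropyE.
rewrite (sum_marg fst Q (fun u => log2 (Q1 u))) (sum_marg snd Q (fun u => log2 (Q2 u))).
by ring.
Qed.

Lemma info_density_l1_ge0 : 0 <= info_density_l1.
Proof. by apply: sumr_ge0 => a _; rewrite mulr_ge0. Qed.

Lemma typ_gt0 n (T : finType) (eta : R) (p : T -> R) (z : {ffun 'I_n -> T}) i :
  (forall a, 0 <= p a) -> typ eta p z -> 0 < p (z i).
Proof.
move=> p0 /forallP/(_ (z i)); rewrite lt_neqAle p0 andbT eq_sym => h.
apply/eqP => pz; move: h; rewrite pz mulr0 subr0 normr_le0.
by rewrite gt_eqF // ty_gt0.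
Qed.

(** Robust typicality makes [Q] positive at every letter pair that occurs, so the information
    density is genuine there and the identity is exact. *)
Lemma change_of_measure n eta (s : {ffun 'I_n -> X1}) (t : {ffun 'I_n -> X2}) :
  (0 < n)%N -> typ eta Q (zip2 s t) ->
  prodp Q1 s * prodp Q2 t =
  prodp Q (zip2 s t) * pow2 (- n%:R * \sum_a ty (zip2 s t) a * info_density a).
Proof.
move=> n0 ht; rewrite sum_ty mulNr mulrCA divff ?pnatr_eq0 -?lt0n // mulr1.
rewrite -sumrN pow2_sum /prodp -!big_split /=; apply: eq_bigr => i _.
have := typ_gt0 i Q_ge0 ht; rewrite ffunE => Qi.
have Q1i : 0 < Q1 (s i).
  apply: (lt_le_trans Qi); rewrite /Q1 ffunE (bigD1 (s i, t i)) //= lerDl.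
  exact: sumr_ge0.
have Q2i : 0 < Q2 (t i).
  apply: (lt_le_trans Qi); rewrite /Q2 ffunE (bigD1 (s i, t i)) //= lerDl.
  exact: sumr_ge0.
rewrite /info_density /= -{1}(pow2_log2 Q1i) -{1}(pow2_log2 Q2i) -{1}(pow2_log2 Qi) -!pow2D.
by congr pow2; ring.
Qed.

Lemma typ_info_density n eta (z : {ffun 'I_n -> X1 * X2}) : typ eta Q z ->
  `|\sum_a ty z a * info_density a - I12| <= eta * info_density_l1.
Proof.
move=> /forallP ht; rewrite -sum_info_density -sumrB.
apply: le_trans (ler_norm_sum _ _ _) _; rewrite /info_density_l1 mulr_sumr.
by apply: ler_sum => a _; rewrite -mulrBl normrM mulrA ler_wpM2r.
Qed.

Lemma change_le n eta (s : {ffun 'I_n -> X1}) (t : {ffun 'I_n -> X2}) :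
  (0 < n)%N -> typ eta Q (zip2 s t) ->
  prodp Q1 s * prodp Q2 t <= pow2 (- n%:R * (I12 - eta * info_density_l1)) * prodp Q (zip2 s t).
Proof.
move=> n0 ht; rewrite (change_of_measure n0 ht) mulrC ler_wpM2r ?prodp_ge0 //.
rewrite ler_pow2 !mulNr lerN2 ler_wpM2l //.
by have := typ_info_density ht; rewrite ler_norml => /andP[? _]; lra.
Qed.

Lemma change_ge n eta (s : {ffun 'I_n -> X1}) (t : {ffun 'I_n -> X2}) :
  (0 < n)%N -> typ eta Q (zip2 s t) ->
  pow2 (- n%:R * (I12 + eta * info_density_l1)) * prodp Q (zip2 s t) <= prodp Q1 s * prodp Q2 t.
Proof.
move=> n0 ht; rewrite (change_of_measure n0 ht) mulrC ler_wpM2l ?prodp_ge0 //.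
rewrite ler_pow2 !mulNr lerN2 ler_wpM2l //.
by have := typ_info_density ht; rewrite ler_norml => /andP[_ ?]; lra.
Qed.

Lemma sum_prodp_zip1 n (s : {ffun 'I_n -> X1}) :
  \sum_t prodp Q (zip2 s t) = prodp Q1 s.
Proof.
transitivity (\sum_(t : {ffun 'I_n -> X2}) \prod_i Q (s i, t i)).
  by apply: eq_bigr => t _; apply: eq_bigr => i _; rewrite ffunE.
rewrite -(bigA_distr_bigA (fun i b => Q (s i, b))) /=; apply: eq_bigr => i _.
rewrite /Q1 ffunE (reindex_onto (fun b => (s i, b)) snd) /=; last first.
  by case=> a b /= /eqP ->.
by apply: eq_bigl => b; rewrite !eqxx.
Qed.

Lemma sum_prodp_zip2 n (t : {ffun 'I_n -> X2}) :
  \sum_s prodp Q (zip2 s t) = prodp Q2 t.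
Proof.
transitivity (\sum_(s : {ffun 'I_n -> X1}) \prod_i Q (s i, t i)).
  by apply: eq_bigr => s _; apply: eq_bigr => i _; rewrite ffunE.
rewrite -(bigA_distr_bigA (fun i b => Q (b, t i))) /=; apply: eq_bigr => i _.
rewrite /Q2 ffunE (reindex_onto (fun b => (b, t i)) fst) /=; last first.
  by case=> a b /= /eqP ->.
by apply: eq_bigl => b; rewrite !eqxx.
Qed.

End ChangeOfMeasure.

(** * Covering by independent words *)

Section Covering.
Variables (R : realType) (S T : finType) (J : S -> T -> R) (G : S -> T -> bool).
Hypothesis J_ge0 : forall s t, 0 <= J s t.
Hypothesis J_sum : \sum_s \sum_t J s t = 1.
Hypothesis G_likely : \sum_s \sum_t J s t * (~~ G s t)%:R <= 1 / 4.

Let p s := \sum_t J s t.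

(* Dropping the first words which have few typical partners at most doubles their probabilities
   and makes the covering failure doubly exponentially small, so that a union bound over
   exponentially many messages is possible. *)
Lemma cond_pmf : exists p' : S -> R, [/\ forall s, 0 <= p' s, \sum_s p' s = 1,
  forall s, p' s <= 2 * p s &
  forall s, p' s != 0 -> 0 < p s /\ p s / 2 <= \sum_t J s t * (G s t)%:R].
Proof.
have p0 s : 0 <= p s by apply: sumr_ge0.
pose ok s := p s / 2 <= \sum_t J s t * (G s t)%:R.
pose Z := \sum_(s | ok s) p s.
(* A discarded word has more than half of its mass on untypical pairs, whose total is at most
   [1 / 4]; so at most half of the mass is discarded. *)
have Z2 : 1 / 2 <= Z.
  have : \sum_(s | ~~ ok s) p s <= 2 * (1 / 4).
    apply: (@le_trans _ _ (2 * \sum_s \sum_t J s t * (~~ G s t)%:R)); last by rewrite ler_wpM2l.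
    rewrite [X in _ * X](bigID ok) /= mulrDr; apply: ler_wpDl.
      by rewrite mulr_ge0 // sumr_ge0 // => s _; apply: sumr_ge0 => t _; rewrite mulr_ge0.
    rewrite mulr_sumr; apply: ler_sum => s; rewrite -ltNge => h.
    have : p s = \sum_t J s t * (G s t)%:R + \sum_t J s t * (~~ G s t)%:R.
      rewrite -big_split; apply: eq_bigr => t _ /=.
      by case: (G s t); rewrite ?mulr0 ?mulr1 ?addr0 ?add0r.
    by move=> e; lra.
  have : Z + \sum_(s | ~~ ok s) p s = 1 by rewrite /Z -J_sum [RHS](bigID ok).
  by move=> *; lra.
have Z0 : 0 < Z by lra.
exists (fun s => if ok s then p s / Z else 0); split.
- by move=> s; case: ifP => // _; rewrite divr_ge0 // ltW.
- by rewrite -big_mkcond -mulr_suml divff // lt0r_neq0.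
- move=> s; case: ifP => _; last by rewrite mulr_ge0.
  by rewrite ler_pdivrMr // mulrAC ler_peMl //; lra.
move=> s; case: ifP => [oks|]; last by rewrite eqxx.
move=> h; split=> //; rewrite lt_neqAle p0 andbT eq_sym.
by apply: contra_neq h => ->; rewrite mul0r.
Qed.

(** For a retained [s] the typical partners have [p2]-mass at least [al / 2], because
    [al * J s t / p s <= p2 t] on them and their conditional mass is at least [1 / 2]. *)
Lemma miss_prob (K : finType) (p2 : T -> R) (al : R) s : (forall t, 0 <= p2 t) ->
  \sum_t p2 t = 1 -> 0 <= al -> 0 < p s -> p s / 2 <= \sum_t J s t * (G s t)%:R ->
  (forall t, G s t -> al * J s t <= p s * p2 t) ->
  (\sum_t p2 t * (~~ G s t)%:R) ^+ #|K| <= expR (- (#|K|%:R * (al / 2))).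
Proof.
move=> p20 p21 al0 ps hs hal.
have h : \sum_t p2 t * (~~ G s t)%:R <= expR (- (al / 2)).
  apply: le_trans (expR_ge1Dx _).
  have : 1 = \sum_t p2 t * (G s t)%:R + \sum_t p2 t * (~~ G s t)%:R.
    rewrite -[LHS]p21 -big_split; apply: eq_bigr => t _ /=.
    by case: (G s t); rewrite ?mulr0 ?mulr1 ?addr0 ?add0r.
  suff : al / 2 <= \sum_t p2 t * (G s t)%:R by move=> *; lra.
  rewrite -(ler_pM2l ps); apply: (@le_trans _ _ (al * (p s / 2))); first by lra.
  apply: (@le_trans _ _ (al * \sum_t J s t * (G s t)%:R)); first by rewrite ler_wpM2l.
  rewrite 2!mulr_sumr; apply: ler_sum => t _; have [Gt|_] := boolP (G s t).
    by rewrite !mulr1 hal.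
  by rewrite !mulr0.
rewrite -mulrN expRM_natl; apply: lerXn2r => //; rewrite nnegrE ?expR_ge0 //.
by apply: sumr_ge0 => t _; rewrite mulr_ge0.
Qed.

End Covering.

(** * Joint types close to the constraint classes *)

Section Margins.
Variables (R : realType) (X1 X2 Y : finType).
Variables (q : X1 -> X2 -> Y -> R).
Local Notation Tr := ((X1 * X2) * Y)%type.
Implicit Types (P V : {ffun Tr -> R}).

Definition I_X2_YX1 V := Hf (@pX2 X1 X2 Y) V + Hf (@pX1Y X1 X2 Y) V - Hf (@pAll X1 X2 Y) V.
(** Multi-information of the three coordinates: the exponent of the event that independent [x1] and
    [x2] reach a given joint type with a fixed [y]. *)
Definition I_X1_X2_Y V := Hf (@pX1 X1 X2 Y) V + Hf (@pX2 X1 X2 Y) V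
  + Hf (@pY X1 X2 Y) V - Hf (@pAll X1 X2 Y) V.

(* Total violation of the constraints defining [L1], [L2], [L0] for [D] the projection to
   [(X2, Y)], [(X1, Y)], [Y] respectively. *)
Definition viol (U : finType) (D : Tr -> U) P V : R :=
  \sum_a `|marg (@pX1X2 X1 X2 Y) V a - marg (@pX1X2 X1 X2 Y) P a| +
  \sum_b `|marg D V b - marg D P b| + Num.max 0 (Eq q P - Eq q V).

Lemma ccont_marg (T U : finType) (D : T -> U) b : ccont (fun V : {ffun T -> R} => marg D V b).
Proof.
rewrite (_ : (fun p => _) = fun V : {ffun T -> R} => \sum_(t | D t == b) V t).
  by apply: ccont_sum => t; exact: ccont_coord.
by apply/funext => V; rewrite ffunE.
Qed.

Lemma ccont_viol (U : finType) (D : Tr -> U) P : ccont (viol D P).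
Proof.
apply: ccontD; first apply: ccontD.
- apply: ccont_sum => a; apply: ccont_norm; apply: ccontB; last exact: ccont_cst.
  exact: ccont_marg.
- apply: ccont_sum => a; apply: ccont_norm; apply: ccontB; last exact: ccont_cst.
  exact: ccont_marg.
apply: ccont_max; first exact: ccont_cst.
apply: ccontB; first exact: ccont_cst.
by apply: ccont_sum => t; apply: ccontM; [exact: ccont_coord|exact: ccont_cst].
Qed.

Lemma pmf_le1 (T : finType) (p : {ffun T -> R}) : is_pmf p -> forall t, 0 <= p t <= 1.
Proof.
by move=> [p0 p1] t; rewrite p0 /= -p1 (bigD1 t) //= lerDl sumr_ge0.
Qed.

Lemma viol_le0 (U : finType) (D : Tr -> U) P V : is_pmf P -> (forall t, 0 <= V t <= 1) ->
  viol D P V <= 0 -> Gq q P V /\ marg D V = marg D P.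
Proof.
move=> [P0 P1] hV h.
have s1 : 0 <= \sum_a `|marg (@pX1X2 X1 X2 Y) V a - marg (@pX1X2 X1 X2 Y) P a|.
  exact: sumr_ge0.
have s2 : 0 <= \sum_b `|marg D V b - marg D P b| by exact: sumr_ge0.
have s3 : 0 <= Num.max 0 (Eq q P - Eq q V) by rewrite le_max lexx.
rewrite /viol in h.
have eqm (W : finType) (f g : W -> R) : \sum_a `|f a - g a| = 0 -> f =1 g.
  move=> fg a; apply/eqP; rewrite -subr_eq0 -normr_eq0.
  by apply/eqP; apply: (psumr_eq0P (P := xpredT)) fg a isT.
have e1 : marg (@pX1X2 X1 X2 Y) V = marg (@pX1X2 X1 X2 Y) P by apply/ffunP/eqm; lra.
have e2 : marg D V = marg D P by apply/ffunP/eqm; lra.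
split=> //; split; last split=> //.
  split=> [t|]; first by have /andP[] := hV t.
  have m1 (p : {ffun Tr -> R}) : \sum_a marg (@pX1X2 X1 X2 Y) p a = \sum_t p t.
    by rewrite [RHS](partition_big (@pX1X2 X1 X2 Y) xpredT) //=; apply: eq_bigr => a _; rewrite ffunE.
  by rewrite -m1 e1 m1.
have : Num.max 0 (Eq q P - Eq q V) <= 0 by lra.
by rewrite ge_max => /andP[_]; rewrite subr_le0.
Qed.

Lemma margin_class (U : finType) (D : Tr -> U) P (Phi : {ffun Tr -> R} -> R) :
  is_pmf P -> ccont Phi ->
  (forall V, Gq q P V -> marg D V = marg D P -> 0 < Phi V) ->
  exists2 eta, 0 < eta & forall V, is_pmf V -> viol D P V <= eta -> eta <= Phi V.
Proof.
move=> hP cPhi h.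
have [eta e0 he] := @compact_margin R _ (viol D P) Phi (@ccont_viol _ D P) cPhi
  (fun V hV v0 => h V (viol_le0 hP hV v0).1 (viol_le0 hP hV v0).2).
by exists eta => // V /pmf_le1; exact: he.
Qed.

Lemma marg_l1 (T U : finType) (D : T -> U) (p r : {ffun T -> R}) :
  \sum_b `|marg D p b - marg D r b| <= \sum_t `|p t - r t|.
Proof.
rewrite [leRHS](partition_big D xpredT) //=; apply: ler_sum => b _.
by rewrite !ffunE -sumrB; apply: ler_norm_sum.
Qed.

Lemma typ_l1 n (T : finType) eta (p : {ffun T -> R}) (z : {ffun 'I_n -> T}) (g : T -> R) :
  is_pmf p -> typ eta p z -> \sum_t `|ty z t - p t| * `|g t| <= eta * \sum_t p t * `|g t|.
Proof.
move=> [p0 p1] /forallP h; rewrite mulr_sumr; apply: ler_sum => t _.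
by rewrite mulrA ler_wpM2r.
Qed.

Definition qabs P : R := \sum_t P t * `|q t.1.1 t.1.2 t.2|.

(** Here [z] is the sent triple and [z'] a winning rival which agrees with it on [D]. The budget is
    [eta1] for the input marginal of [z'], [eta2] for the [D] marginal inherited from [z], and
    [eta2 * qabs P] for the metric. *)
Lemma typ_viol n (U : finType) (D : Tr -> U) P eta1 eta2
    (z z' : {ffun 'I_n -> Tr}) : is_pmf P ->
  typ eta1 (marg (@pX1X2 X1 X2 Y) P) [ffun i => (z' i).1] -> typ eta2 P z ->
  (forall i, D (z' i) = D (z i)) ->
  \sum_i q (z i).1.1 (z i).1.2 (z i).2 <= \sum_i q (z' i).1.1 (z' i).1.2 (z' i).2 ->
  viol D P (ty z') <= eta1 + eta2 * (1 + qabs P).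
Proof.
move=> hP t1 t2 hD hs.
have h1 : \sum_a `|marg (@pX1X2 X1 X2 Y) (ty z') a - marg (@pX1X2 X1 X2 Y) P a| <= eta1.
  rewrite marg_ty; have [_ m1] := marg_pmf (@pX1X2 X1 X2 Y) hP.
  have := typ_l1 (fun=> 1) (marg_pmf (@pX1X2 X1 X2 Y) hP) t1.
  under eq_bigr do rewrite normr1 mulr1.
  by under [X in _ <= _ * X]eq_bigr do rewrite normr1 mulr1; rewrite m1 mulr1.
have h2 : \sum_b `|marg D (ty z') b - marg D P b| <= eta2.
  have -> : marg D (ty z') = marg D (ty z) :> {ffun U -> R}.
    by rewrite !marg_ty; congr ty; apply/ffunP => i; rewrite !ffunE.
  apply: (le_trans (marg_l1 _ _ _)).
  have := typ_l1 (fun=> 1) hP t2; have [_ P1] := hP.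
  under eq_bigr do rewrite normr1 mulr1.
  by under [X in _ <= _ * X]eq_bigr do rewrite normr1 mulr1; rewrite P1 mulr1.
have h3 : Eq q P - Eq q (ty z') <= eta2 * qabs P.
  have e1 : Eq q (ty z) <= Eq q (ty z').
    by rewrite /Eq !(sum_ty _ (fun t => q t.1.1 t.1.2 t.2)) ler_wpM2r // invr_ge0.
  have e2 : `|Eq q (ty z) - Eq q P| <= eta2 * qabs P.
    apply: le_trans (typ_l1 (fun t => q t.1.1 t.1.2 t.2) hP t2).
    rewrite /Eq -sumrB; apply: (le_trans (ler_norm_sum _ _ _)); apply: ler_sum => t _.
    by rewrite -mulrBl normrM.
  move: e2; rewrite ler_norml => /andP[? _]; lra.
have e20 : 0 <= eta2 * qabs P.
  apply: le_trans (typ_l1 (fun t => q t.1.1 t.1.2 t.2) hP t2).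
  by apply: sumr_ge0 => t _; rewrite mulr_ge0.
have h4 : Num.max 0 (Eq q P - Eq q (ty z')) <= eta2 * qabs P by rewrite ge_max e20.
by rewrite /viol; lra.
Qed.

End Margins.

(** * Chance that independent words reach a given joint type *)

Section TypeBounds.
Variables (R : realType) (X1 X2 Y : finType) (n : nat).
Hypothesis n_gt0 : (0 < n)%N.
Local Notation Tr := ((X1 * X2) * Y)%type.
Variables (Q : {ffun X1 * X2 -> R}).
Hypothesis Qpmf : is_pmf Q.
Variables (p1 : {ffun 'I_n -> X1} -> R) (p2 : {ffun 'I_n -> X2} -> R).
Hypothesis p1_ge0 : forall s, 0 <= p1 s.
Hypothesis p2_ge0 : forall t, 0 <= p2 t.
Hypothesis p1_le : forall s, p1 s <= 2 * prodp (Q1 Q) s.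
Hypothesis p2_le : forall t, p2 t <= 2 * prodp (Q2 Q) t.

Definition zip3 (s : {ffun 'I_n -> X1}) (t : {ffun 'I_n -> X2}) (y : {ffun 'I_n -> Y}) :
  {ffun 'I_n -> Tr} := zip2 (zip2 s t) y.

Lemma cnt_ty (z : {ffun 'I_n -> Tr}) th : cnt z == th -> ty z = ty_of th :> {ffun Tr -> R}.
Proof. by move=> /eqP <-; rewrite ty_of_cnt. Qed.

Lemma natr_bool_le (b1 b2 : bool) : (b1 -> b2) -> b1%:R <= b2%:R :> R.
Proof. by move=> h; rewrite ler_nat leq_bool. Qed.

Lemma sat_type_prob s y (th : {ffun Tr -> 'I_n.+1}) :
  \sum_t p2 t * (cnt (zip3 s t y) == th)%:R <=
  2 * pow2 (- n%:R * I_X2_YX1 (ty_of th : {ffun Tr -> R})).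
Proof.
have [Q20 Q21] := Q2_pmf Qpmf.
pose e (b : X2) (ay : X1 * Y) : Tr := ((ay.1, b), ay.2).
have fe b ay : pX2 (e b ay) = b by [].
have ge b ay : pX1Y (e b ay) = ay by case: ay.
have := type_prob_le (ty_of th : {ffun Tr -> R}) (zip2 s y) n_gt0 fe ge Q20 Q21
  (ler0n _ 2) p2_le.
rewrite /I_X2_YX1 [Hf (@pAll _ _ _) _]/Hf marg_id; apply: le_trans; apply: ler_sum => t _.
rewrite ler_wpM2l // natr_bool_le // => /cnt_ty <-; apply/eqP; congr ty.
by apply/ffunP => i; rewrite !ffunE.
Qed.

Lemma cloud_type_prob t y (th : {ffun Tr -> 'I_n.+1}) :
  \sum_s p1 s * (cnt (zip3 s t y) == th)%:R <=
  2 * pow2 (- n%:R * I_X1_YX2 (ty_of th : {ffun Tr -> R})).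
Proof.
have [Q10 Q11] := Q1_pmf Qpmf.
pose e (a : X1) (by_ : X2 * Y) : Tr := ((a, by_.1), by_.2).
have fe a by_ : pX1 (e a by_) = a by [].
have ge a by_ : pX2Y (e a by_) = by_ by case: by_.
have := type_prob_le (ty_of th : {ffun Tr -> R}) (zip2 t y) n_gt0 fe ge Q10 Q11
  (ler0n _ 2) p1_le.
rewrite /I_X1_YX2 [Hf (@pAll _ _ _) _]/Hf marg_id; apply: le_trans; apply: ler_sum => s _.
rewrite ler_wpM2l // natr_bool_le // => /cnt_ty <-; apply/eqP; congr ty.
by apply/ffunP => i; rewrite !ffunE.
Qed.

(** Only the type of [(x1, y)] is constrained, so the bound holds whatever second words accompany
    [x1] and needs no union over them. *)
Lemma first_type_prob y (th : {ffun Tr -> 'I_n.+1}) :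
  \sum_s p1 s * [exists t, cnt (zip3 s t y) == th]%:R <=
  2 * pow2 (- n%:R * I_X1_Y (ty_of th : {ffun Tr -> R})).
Proof.
have [Q10 Q11] := Q1_pmf Qpmf.
have fe (a : X1) (b : Y) : (a, b).1 = a by [].
have ge (a : X1) (b : Y) : (a, b).2 = b by [].
have := type_prob_le (marg (@pX1Y X1 X2 Y) (ty_of th : {ffun Tr -> R})) y n_gt0 fe ge
  Q10 Q11 (ler0n _ 2) p1_le.
rewrite !Hf_marg /I_X1_Y; apply: le_trans; apply: ler_sum => s _.
rewrite ler_wpM2l // natr_bool_le // => /existsP[t /cnt_ty <-]; apply/eqP.
by rewrite marg_ty; congr ty; apply/ffunP => i; rewrite !ffunE.
Qed.

Lemma second_type_prob y (th : {ffun Tr -> 'I_n.+1}) :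
  \sum_t p2 t * [exists s, cnt (zip3 s t y) == th]%:R <=
  2 * pow2 (- n%:R * I_X2_Y (ty_of th : {ffun Tr -> R})).
Proof.
have [Q20 Q21] := Q2_pmf Qpmf.
have fe (a : X2) (b : Y) : (a, b).1 = a by [].
have ge (a : X2) (b : Y) : (a, b).2 = b by [].
have := type_prob_le (marg (@pX2Y X1 X2 Y) (ty_of th : {ffun Tr -> R})) y n_gt0 fe ge
  Q20 Q21 (ler0n _ 2) p2_le.
rewrite !Hf_marg /I_X2_Y; apply: le_trans; apply: ler_sum => t _.
rewrite ler_wpM2l // natr_bool_le // => /existsP[s /cnt_ty <-]; apply/eqP.
by rewrite marg_ty; congr ty; apply/ffunP => i; rewrite !ffunE.
Qed.

(** Chain rule: [(x2, y)] must have the right type, at cost [I_X2_Y], and then [x1] must complete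
    it, at cost [I_X1_YX2]. *)
Lemma pair_type_prob y (th : {ffun Tr -> 'I_n.+1}) :
  \sum_s p1 s * \sum_t p2 t * (cnt (zip3 s t y) == th)%:R <=
  4 * pow2 (- n%:R * I_X1_X2_Y (ty_of th : {ffun Tr -> R})).
Proof.
set V := (ty_of th : {ffun Tr -> R}).
under eq_bigr do rewrite mulr_sumr.
rewrite exchange_big /=.
apply: (@le_trans _ _ (\sum_t p2 t * [exists s, cnt (zip3 s t y) == th]%:R *
    (2 * pow2 (- n%:R * I_X1_YX2 V)))).
  apply: ler_sum => t _; under eq_bigr do rewrite mulrCA.
  rewrite -mulr_sumr -mulrA ler_wpM2l //.
  have [_|/existsPn h] := boolP [exists s, cnt (zip3 s t y) == th].
    by rewrite mul1r; exact: cloud_type_prob.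
  by rewrite mul0r big1 // => s _; rewrite (negbTE (h s)) mulr0.
rewrite -mulr_suml.
apply: (@le_trans _ _ (2 * pow2 (- n%:R * I_X2_Y V) * (2 * pow2 (- n%:R * I_X1_YX2 V)))).
  by rewrite ler_wpM2r ?mulr_ge0 ?pow2_ge0 // second_type_prob.
have -> : I_X1_X2_Y V = I_X2_Y V + I_X1_YX2 V by rewrite /I_X1_X2_Y /I_X2_Y /I_X1_YX2; ring.
by rewrite (mulrDr (- n%:R) (I_X2_Y V)) (pow2D (_ * I_X2_Y V)); lra.
Qed.

End TypeBounds.

(** * Limits as the block length grows *)

Section Asymptotics.
Variable R : realType.

Lemma poly_exp_small (d : nat) (c C eps : R) : 0 < c -> 0 <= C -> 0 < eps ->
  exists N, forall n, (N <= n)%N -> (n.+1 ^ d)%:R * C * expR (- n%:R * c) <= eps.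
Proof.
move=> c0 C0 e0.
pose k := eps * (c ^+ d.+1 / d.+1`!%:R).
have k0 : 0 < k by rewrite !mulr_gt0 ?exprn_gt0 // invr_gt0 ltr0n fact_gt0.
exists (Num.bound (2 ^+ d * C / k)).+1 => n hn.
have n0 : (0 < n)%N by apply: leq_trans hn.
have hn' : 2 ^+ d * C <= n%:R * k.
  rewrite -ler_pdivrMr //; apply/ltW/(lt_le_trans (archi_boundP _)).
    by rewrite divr_ge0 ?(ltW k0) // mulr_ge0 // exprn_ge0.
  by rewrite ler_nat ltnW.
rewrite mulNr expRN ler_pdivrMr ?expR_gt0 //.
apply: (@le_trans _ _ (n%:R ^+ d * (2 ^+ d * C))).
  rewrite mulrA ler_wpM2r // -exprMn natrX; apply: lerXn2r; rewrite ?nnegrE ?mulr_ge0 //.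
  by rewrite -natrM ler_nat muln2 -addnn -addn1 leq_add2l.
apply: (@le_trans _ _ (n%:R ^+ d * (n%:R * k))); first by rewrite ler_wpM2l // exprn_ge0.
have := @expR_ge1Dxn R (n%:R * c) d; rewrite mulr_ge0 ?(ltW c0) // => /(_ isT) h.
apply: (@le_trans _ _ (eps * ((n%:R * c) ^+ d.+1 / d.+1`!%:R))).
  by rewrite /k exprMn (exprS n%:R d); lra.
rewrite ler_wpM2l ?(ltW e0) //; lra.
Qed.

Lemma exp_small (c C eps : R) : 0 < c -> 0 <= C -> 0 < eps ->
  exists N, forall n, (N <= n)%N -> C * expR (- n%:R * c) <= eps.
Proof.
move=> c0 C0 e0; have [N h] := poly_exp_small 0 c0 C0 e0.
by exists N => n /h; rewrite expn0 mul1r.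
Qed.

(** Compares the number of messages with the covering failure of one message; the quadratic bound
    [exp x >= 1 + x^2 / 2] already suffices. *)
Lemma double_exp_small (r e C eps : R) : 0 < e -> 0 <= C -> 0 < eps ->
  exists N, forall n, (N <= n)%N ->
    C * pow2 (n%:R * r) * expR (- (pow2 (n%:R * e) / 2)) <= eps.
Proof.
move=> e0 C0 eps0; have [N1 h1] := exp_small ltr01 C0 eps0.
pose k := (e * ln 2) ^+ 2 / 4; have l0 := @ln2_gt0 R.
have k0 : 0 < k by rewrite divr_gt0 // exprn_gt0 // mulr_gt0.
exists (maxn N1 (Num.bound ((`|r| * ln 2 + 1) / k))) => n; rewrite geq_max => /andP[/h1 hn hk].
apply: le_trans hn; rewrite -mulrA ler_wpM2l // /pow2 -expRD ler_expR.
have hx : 1 + (n%:R * e * ln 2) ^+ 2 / 2 <= expR (n%:R * e * ln 2).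
  by apply: (@expR_ge1Dxn R _ 1); rewrite !mulr_ge0 // ltW.
have hk' : `|r| * ln 2 + 1 <= n%:R * k.
  rewrite -ler_pdivrMr //; apply/ltW/(lt_le_trans (archi_boundP _)); last by rewrite ler_nat.
  by rewrite divr_ge0 ?(ltW k0) // addr_ge0 // mulr_ge0 // ltW.
have hr : n%:R * r * ln 2 <= n%:R * (`|r| * ln 2).
  by rewrite -mulrA ler_wpM2l // ler_wpM2r ?ler_norm // ltW.
have : n%:R * (`|r| * ln 2 + 1) <= n%:R * (n%:R * k) by rewrite ler_wpM2l.
rewrite /k; move: hx; rewrite !expr2 => hx hh; lra.
Qed.

End Asymptotics.

(** * Error bound at a fixed block length *)

Section CodingStep.
Variables (R : realType) (X1 X2 Y : finType) (W : X1 -> X2 -> {ffun Y -> R}).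
Variables (q : X1 -> X2 -> Y -> R) (Q : {ffun X1 * X2 -> R}).
Hypothesis hW : forall x1 x2, is_pmf (W x1 x2).
Hypothesis Qpmf : is_pmf Q.
Local Notation Tr := ((X1 * X2) * Y)%type.
Local Notation P := (joint W Q).

Lemma joint_marg : marg (@pX1X2 X1 X2 Y) P = Q.
Proof.
apply/ffunP => a; rewrite ffunE (reindex_onto (fun y => (a, y)) snd) /=; last first.
  by case=> b y /= /eqP <-.
rewrite (eq_bigl xpredT); last by move=> y; rewrite !eqxx.
under eq_bigr do rewrite ffunE /=.
by rewrite -mulr_sumr; have [_ ->] := hW a.1 a.2; rewrite mulr1.
Qed.

Lemma joint_pmf : is_pmf P.
Proof.
split=> [t|]; first by rewrite ffunE mulr_ge0 //; [case: Qpmf|case: (hW t.1.1 t.1.2)].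
rewrite (partition_big (@pX1X2 X1 X2 Y) xpredT) //=.
rewrite (eq_bigr Q); first by case: Qpmf.
by move=> a _; rewrite -{2}joint_marg ffunE.
Qed.

Definition Wn (n : nat) (s : {ffun 'I_n -> X1}) (t : {ffun 'I_n -> X2})
  (y : {ffun 'I_n -> Y}) : R := \prod_i W (s i) (t i) (y i).

Definition scn (n : nat) (s : {ffun 'I_n -> X1}) (t : {ffun 'I_n -> X2})
  (y : {ffun 'I_n -> Y}) : R := \sum_i q (s i) (t i) (y i).

Lemma Wn_ge0 n s t y : 0 <= @Wn n s t y.
Proof. by apply: prodr_ge0 => i _; case: (hW (s i) (t i)). Qed.

Lemma Wn_sum n s t : \sum_y @Wn n s t y = 1.
Proof.
rewrite /Wn -(bigA_distr_bigA (fun i y => W (s i) (t i) y)) big1 // => i _.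
by case: (hW (s i) (t i)).
Qed.

Lemma prodp_joint n s t y : prodp P (@zip3 X1 X2 Y n s t y) = prodp Q (zip2 s t) * Wn s t y.
Proof.
by rewrite /prodp /Wn -big_split; apply: eq_bigr => i _; rewrite !ffunE.
Qed.

Section FixedLength.
Variable n : nat.
Hypothesis n_gt0 : (0 < n)%N.
Variables (eta1 eta2 mu e a b ci ca cc f t3 : R) (hA hB hC : bool).
Hypothesis eta_mu : eta1 + eta2 * (1 + qabs q P) <= mu.
Hypothesis marginA : hA -> forall V, is_pmf V -> viol q (@pX1Y X1 X2 Y) P V <= mu ->
  a + mu <= I_X2_YX1 V.
Hypothesis marginB : hB -> forall V, is_pmf V -> viol q (@pX2Y X1 X2 Y) P V <= mu ->
  b + mu <= I_X1_YX2 V.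
Hypothesis marginC : hC -> forall V, is_pmf V -> viol q (@pY X1 X2 Y) P V <= mu ->
  [\/ ci + mu <= I_X1_Y V, ca + mu <= I_X2_Y V | cc + mu <= I_X1_X2_Y V].
Variables (I A M K : finType) (k0 : K) (cand : M -> K -> I * A).
Variables (p1 : {ffun 'I_n -> X1} -> R) (p2 : {ffun 'I_n -> X2} -> R).
Hypothesis p1_ge0 : forall s, 0 <= p1 s.
Hypothesis p2_ge0 : forall t, 0 <= p2 t.
Hypothesis p1_sum : \sum_s p1 s = 1.
Hypothesis p2_sum : \sum_t p2 t = 1.
Hypothesis p1_le : forall s, p1 s <= 2 * prodp (Q1 Q) s.
Hypothesis p2_le : forall t, p2 t <= 2 * prodp (Q2 Q) t.
Hypothesis own : forall m k, ~~ rival cand m (cand m k).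

Definition T2 (s : {ffun 'I_n -> X1}) (t : {ffun 'I_n -> X2}) := typ eta1 Q (zip2 s t).
Definition T3 (s : {ffun 'I_n -> X1}) (t : {ffun 'I_n -> X2}) (y : {ffun 'I_n -> Y}) :=
  typ eta2 P (zip3 s t y).
Definition tyn (s : {ffun 'I_n -> X1}) (t : {ffun 'I_n -> X2}) (y : {ffun 'I_n -> Y}) :=
  cnt (zip3 s t y).

(** A product of at most four rounded-up code sizes, each losing a factor 2, accounts for [16]; a
    false flag forces the count to be zero. *)
Let num (h : bool) (x : R) : R := h%:R * (16 * pow2 (n%:R * (x + e))).

Hypothesis nA : forall m k, #|rivalA cand m (cand m k)|%:R <= num hA a.
Hypothesis nB : forall m k, #|rivalB cand m (cand m k)|%:R <= num hB b.
Hypothesis nCi : forall m k, #|rivalCi cand m (cand m k)|%:R <= num hC ci.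
Hypothesis nCa : forall m k, #|rivalCa cand m (cand m k)|%:R <= num hC ca.
Hypothesis nC : forall m k, #|rivalC cand m (cand m k)|%:R <= num hC cc.
Hypothesis failP : forall m,
  Ec p1 p2 (fun c => [forall k, ~~ covers T2 cand c m k]%:R) <= f.
Hypothesis t3P : \sum_(z : {ffun 'I_n -> Tr}) prodp P z * (~~ typ eta2 P z)%:R <= t3.

Lemma beat_viol (U : finType) (D : Tr -> U) s t y s' t' :
  T3 s t y -> beat T2 (@scn n) s t y s' t' ->
  (forall i, D (zip3 s' t' y i) = D (zip3 s t y i)) ->
  viol q D P (ty (zip3 s' t' y)) <= mu.
Proof.
move=> T3y /andP[T2' sc] hD; apply: le_trans eta_mu.
apply: (typ_viol joint_pmf _ T3y hD).
  rewrite joint_marg; move: T2'; rewrite /T2; congr typ; apply/ffunP => i; by rewrite !ffunE.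
move: sc; rewrite /scn; congr (_ <= _); apply: eq_bigr => i _; by rewrite !ffunE.
Qed.

Let NT : R := #|{ffun Tr -> 'I_n.+1}|%:R.
Let bnd : R := pow2 (n%:R * (e - mu)).

Lemma num_pow (h : bool) (x C v : R) : 0 <= C -> (h -> x + mu <= v) ->
  num h x * (C * pow2 (- n%:R * v)) <= 16 * C * bnd.
Proof.
move=> C0; rewrite /num; case: h => [/(_ isT) xv|_]; last first.
  by rewrite mul0r mul0r !mulr_ge0 // pow2_ge0.
rewrite mul1r mulrACA ler_wpM2l ?mulr_ge0 // -pow2D ler_pow2.
rewrite mulNr -mulrBr ler_wpM2l //; lra.
Qed.

(** A type reached by a winning [t'] has violation at most [mu], so the margin bounds its exponent
    from below; the other types contribute nothing. *)
Lemma sat_beat s t y : T3 s t y -> hA ->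
  \sum_t' p2 t' * (beat T2 (@scn n) s t y s t')%:R <= NT * (2 * pow2 (- n%:R * (a + mu))).
Proof.
move=> T3y ha.
apply: (@le_trans _ _ (\sum_(th : {ffun Tr -> 'I_n.+1}) 2 * pow2 (- n%:R * (a + mu)))); last first.
  by rewrite sumr_const [leRHS]mulr_natl.
apply: (@le_trans _ _ (\sum_(th : {ffun Tr -> 'I_n.+1}) \sum_t' p2 t' *
   (beat T2 (@scn n) s t y s t' && (tyn s t' y == th))%:R)).
  rewrite exchange_big /=; apply: ler_sum => t' _; rewrite -mulr_sumr ler_wpM2l //.
  by rewrite (bigD1 (tyn s t' y)) //= eqxx andbT lerDl sumr_ge0.
apply: ler_sum => th _.
have [/existsP[t' /andP[bt /cnt_ty tyt]]|/existsPn h] :=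
    boolP [exists t', beat T2 (@scn n) s t y s t' && (tyn s t' y == th)]; last first.
  by rewrite big1 ?mulr_ge0 ?pow2_ge0 // => t' _; rewrite (negbTE (h t')) mulr0.
have hv : a + mu <= I_X2_YX1 (ty_of th : {ffun Tr -> R}).
  rewrite -(tyt R); apply: marginA => //; first exact: ty_pmf.
  by apply: (beat_viol T3y bt) => i; rewrite !ffunE.
apply: (@le_trans _ _ (2 * pow2 (- n%:R * I_X2_YX1 (ty_of th : {ffun Tr -> R})))); last first.
  by rewrite ler_wpM2l // ler_pow2 !mulNr lerN2 ler_wpM2l.
apply: le_trans (sat_type_prob n_gt0 Qpmf p2_ge0 p2_le s y th).
by apply: ler_sum => t1 _; rewrite ler_wpM2l // natr_bool_le // => /andP[].
Qed.

Lemma cloud_beat s t y : T3 s t y -> hB ->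
  \sum_s' p1 s' * (beat T2 (@scn n) s t y s' t)%:R <= NT * (2 * pow2 (- n%:R * (b + mu))).
Proof.
move=> T3y hb.
apply: (@le_trans _ _ (\sum_(th : {ffun Tr -> 'I_n.+1}) 2 * pow2 (- n%:R * (b + mu)))); last first.
  by rewrite sumr_const [leRHS]mulr_natl.
apply: (@le_trans _ _ (\sum_(th : {ffun Tr -> 'I_n.+1}) \sum_s' p1 s' *
   (beat T2 (@scn n) s t y s' t && (tyn s' t y == th))%:R)).
  rewrite exchange_big /=; apply: ler_sum => s' _; rewrite -mulr_sumr ler_wpM2l //.
  by rewrite (bigD1 (tyn s' t y)) //= eqxx andbT lerDl sumr_ge0.
apply: ler_sum => th _.
have [/existsP[s' /andP[bt /cnt_ty tyt]]|/existsPn h] :=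
    boolP [exists s', beat T2 (@scn n) s t y s' t && (tyn s' t y == th)]; last first.
  by rewrite big1 ?mulr_ge0 ?pow2_ge0 // => s' _; rewrite (negbTE (h s')) mulr0.
have hv : b + mu <= I_X1_YX2 (ty_of th : {ffun Tr -> R}).
  rewrite -(tyt R); apply: marginB => //; first exact: ty_pmf.
  by apply: (beat_viol T3y bt) => i; rewrite !ffunE.
apply: (@le_trans _ _ (2 * pow2 (- n%:R * I_X1_YX2 (ty_of th : {ffun Tr -> R})))); last first.
  by rewrite ler_wpM2l // ler_pow2 !mulNr lerN2 ler_wpM2l.
apply: le_trans (cloud_type_prob n_gt0 Qpmf p1_ge0 p1_le t y th).
by apply: ler_sum => s1 _; rewrite ler_wpM2l // natr_bool_le // => /andP[].
Qed.

(** On typical pairs the product law is exponentially smaller than [Q], with exponent about [I12 Q];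
    the [4] comes from the two factors 2 in [p1_le] and [p2_le]. *)
Lemma T2_mass (F : {ffun 'I_n -> X1} -> {ffun 'I_n -> X2} -> R) :
  (forall s t, 0 <= F s t) ->
  \sum_s p1 s * \sum_t p2 t * ((T2 s t)%:R * F s t) <=
  4 * pow2 (- n%:R * (I12 Q - eta1 * info_density_l1 Q)) *
    \sum_s \sum_t prodp Q (zip2 s t) * F s t.
Proof.
move=> F0; rewrite mulr_sumr; apply: ler_sum => s _; rewrite 2!mulr_sumr.
have [Q0 _] := Qpmf; have [Q10 _] := Q1_pmf Qpmf; have [Q20 _] := Q2_pmf Qpmf.
apply: ler_sum => t _; have [T2st|_] := boolP (T2 s t); last first.
  by rewrite mul0r !mulr0 !mulr_ge0 ?pow2_ge0 // prodp_ge0.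
rewrite mul1r !mulrA ler_wpM2r // -mulrA.
apply: (@le_trans _ _ (4 * (prodp (Q1 Q) s * prodp (Q2 Q) t))).
  have := ler_pM (p1_ge0 s) (p2_ge0 t) (p1_le s) (p2_le t) => h; lra.
by rewrite ler_wpM2l // (change_le Qpmf n_gt0 T2st).
Qed.

Lemma fixed_length_bound m :
  Ec p1 p2 (fun c => err k0 (@Wn n) T2 (@scn n) cand c m) <= #|M|%:R * f + #|K|%:R *
   (4 * pow2 (- n%:R * (I12 Q - eta1 * info_density_l1 Q)) * (t3 + 128 * NT * bnd)).
Proof.
pose g : R := 4 * pow2 (- n%:R * (I12 Q - eta1 * info_density_l1 Q)).
(* With a false flag the class has no rivals, so the trivial bound 1 on the probability is
   enough. *)
pose bA : R := if hA then NT * (2 * pow2 (- n%:R * (a + mu))) else 1.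
pose bB : R := if hB then NT * (2 * pow2 (- n%:R * (b + mu))) else 1.
pose bC : R := 64 * bnd.
pose good th := `[< exists s t y s' t', [/\ T2 s t, T3 s t y,
  beat T2 (@scn n) s t y s' t' & th = tyn s' t' y] >].
have NT0 : 0 <= NT by rewrite /NT.
have g0 : 0 <= g by rewrite /g mulr_ge0 // pow2_ge0.
have bnd0 : 0 <= bnd by exact: pow2_ge0.
have bA0 : 0 <= bA by rewrite /bA; case: ifP; rewrite // !mulr_ge0 ?pow2_ge0.
have bB0 : 0 <= bB by rewrite /bB; case: ifP; rewrite // !mulr_ge0 ?pow2_ge0.
have [Q0 Qs] := Qpmf.
have goodP s t y s' t' : T2 s t -> T3 s t y -> beat T2 (@scn n) s t y s' t' ->
    good (tyn s' t' y).
  by move=> *; apply/asboolP; exists s, t, y, s', t'.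
have HA s t y : T2 s t -> T3 s t y ->
    \sum_t' p2 t' * (beat T2 (@scn n) s t y s t')%:R <= bA.
  move=> _ T3y; rewrite /bA; case: ifP => [|_]; first exact: sat_beat.
  rewrite -[leRHS]p2_sum; apply: ler_sum => t' _; rewrite ler_piMr //.
  by rewrite lern1 leq_b1.
have HB s t y : T2 s t -> T3 s t y ->
    \sum_s' p1 s' * (beat T2 (@scn n) s t y s' t)%:R <= bB.
  move=> _ T3y; rewrite /bB; case: ifP => [|_]; first exact: cloud_beat.
  rewrite -[leRHS]p1_sum; apply: ler_sum => t' _; rewrite ler_piMr //.
  by rewrite lern1 leq_b1.
have HC th : good th ->
  [\/ forall y, num hC ci * \sum_s' p1 s' * [exists t', tyn s' t' y == th]%:R <= bC,
      forall y, num hC ca * \sum_t' p2 t' * [exists s', tyn s' t' y == th]%:R <= bC |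
      forall y, num hC cc * \sum_s' p1 s' * \sum_t' p2 t' * (tyn s' t' y == th)%:R <= bC].
  move=> /asboolP[s [t [y [s' [t' [T2s T3y bt thE]]]]]].
  have num0 h x : 0 <= num h x by rewrite /num !mulr_ge0 ?pow2_ge0.
  have [hc|hc] := boolP hC; last first.
    constructor 1 => y1; by rewrite /num !mul0r /bC mulr_ge0.
  have vP : viol q (@pY X1 X2 Y) P (ty (zip3 s' t' y)) <= mu.
    by apply: (beat_viol T3y bt) => i; rewrite !ffunE.
  have tyt : ty (zip3 s' t' y) = ty_of th :> {ffun Tr -> R} by apply: cnt_ty; rewrite thE.
  have := marginC hc (ty_pmf R (zip3 s' t' y) n_gt0) vP; rewrite tyt /bC => -[h|h|h].
  - constructor 1 => y1.
    apply: le_trans (ler_wpM2l (num0 true ci)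
      (first_type_prob n_gt0 Qpmf p1_ge0 p1_le y1 th)) _.
    by apply: (le_trans (num_pow (ler0n _ 2) (fun=> h))); rewrite ler_wpM2r; lra.
  - constructor 2 => y1.
    apply: le_trans (ler_wpM2l (num0 true ca)
      (second_type_prob n_gt0 Qpmf p2_ge0 p2_le y1 th)) _.
    by apply: (le_trans (num_pow (ler0n _ 2) (fun=> h))); rewrite ler_wpM2r; lra.
  - constructor 3 => y1.
    apply: le_trans (ler_wpM2l (num0 true cc)
      (pair_type_prob n_gt0 Qpmf p1_ge0 p2_ge0 p1_le p2_le y1 th)) _.
    by apply: (le_trans (num_pow (ler0n _ 4) (fun=> h))); rewrite ler_wpM2r; lra.
have atP : \sum_s p1 s * \sum_t p2 t *
    ((T2 s t)%:R * \sum_y Wn s t y * (~~ T3 s t y)%:R) <= g * t3.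
  apply: le_trans (T2_mass (fun s t => _)) _.
    by move=> s t; apply: sumr_ge0 => y _; rewrite mulr_ge0 // Wn_ge0.
  rewrite ler_wpM2l //; apply: le_trans t3P.
  rewrite -sum_zip2 -(sum_zip2 (fun z => \sum_y prodp P (zip2 z y) * (~~ typ eta2 P (zip2 z y))%:R)).
  apply: ler_sum => s _; apply: ler_sum => t _; rewrite mulr_sumr; apply: ler_sum => y _.
  by rewrite mulrA -prodp_joint.
have gP : \sum_s p1 s * \sum_t p2 t * (T2 s t)%:R <= g.
  apply: le_trans (le_trans (T2_mass (F := fun _ _ => 1) (fun _ _ => ler01)) _).
    apply: ler_sum => s _; rewrite ler_wpM2l //; apply: ler_sum => t _; by rewrite mulr1.
  have -> : \sum_(s : {ffun 'I_n -> X1}) \sum_(t : {ffun 'I_n -> X2}) prodp Q (zip2 s t) * 1 = 1 :> R.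
    transitivity (\sum_(s : {ffun 'I_n -> X1}) \sum_(t : {ffun 'I_n -> X2}) prodp Q (zip2 s t) : R).
      by apply: eq_bigr => s _; apply: eq_bigr => t _; rewrite mulr1.
    by rewrite sum_zip2; exact: sum_prodp.
  by rewrite mulr1.
have bC0 : 0 <= bC by rewrite mulr_ge0.
apply: le_trans (one_shot_bound p1_ge0 p2_ge0 p1_sum p2_sum k0 (@Wn_ge0 n) (@Wn_sum n) own
  nA nB nCi nCa nC bA0 bB0 bC0 goodP HA HB HC failP atP gP m) _.
rewrite lerD2l ler_wpM2l // -/g [leRHS]mulrDr lerD2l ler_wpM2l //.
(* The constant [128] is [32 + 32 + 64], one term for each class of rivals. *)
have nbA : num hA a * bA <= 32 * NT * bnd.
  rewrite /bA; case: ifP => h; last by rewrite /num !mul0r !mulr_ge0.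
  have := num_pow (h := true) (v := a + mu) (ler0n R 2) (fun=> lexx _) => /(ler_wpM2l NT0); lra.
have nbB : num hB b * bB <= 32 * NT * bnd.
  rewrite /bB; case: ifP => h; last by rewrite /num !mul0r !mulr_ge0.
  have := num_pow (h := true) (v := b + mu) (ler0n R 2) (fun=> lexx _) => /(ler_wpM2l NT0); lra.
rewrite -/NT /bC; lra.
Qed.

End FixedLength.
End CodingStep.

(** * Probability that no candidate is typical *)

Lemma forall_prod (R : realType) (K : finType) (b : pred K) :
  [forall k, b k]%:R = \prod_k (b k)%:R :> R.
Proof.
have [/forallP h|/forallPn[k bk]] := boolP [forall k, b k].
  by rewrite big1 // => k _; rewrite h.
by rewrite (bigD1 k) //= (negbTE bk) mul0r.
Qed.

Section FailureProbability.
Variables (R : realType) (S1 S2 I A K M : finType) (k0 : K) (cand : M -> K -> I * A).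
Variables (p1 : S1 -> R) (p2 : S2 -> R) (T2 : S1 -> S2 -> bool) (f : R).
Hypothesis p1_ge0 : forall s, 0 <= p1 s.
Hypothesis p2_ge0 : forall t, 0 <= p2 t.
Hypothesis p1_sum : \sum_s p1 s = 1.
Hypothesis p2_sum : \sum_t p2 t = 1.

(** All candidates share the first word; conditioned on it, the misses of the second words are
    independent. Only words of nonzero probability matter, which is where the conditioned law helps.
    [fail2] exchanges the roles. *)
Lemma fail1 m : (forall k k', (cand m k).1 = (cand m k').1) ->
  injective (fun k => (cand m k).2) ->
  (forall s, p1 s != 0 -> (\sum_t p2 t * (~~ T2 s t)%:R) ^+ #|K| <= f) ->
  Ec p1 p2 (fun c => [forall k, ~~ covers T2 cand c m k]%:R) <= f.
Proof.
move=> cst inj hf; rewrite EcE.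
rewrite (eq_bigr (fun c1 => prodp p1 c1 *
    (\sum_t p2 t * (~~ T2 (c1 (cand m k0).1) t)%:R) ^+ #|K|)); last first.
  move=> c1 _; congr (_ * _); rewrite -(sum_prodp_inj _ p2_sum inj).
  apply: eq_bigr => c2 _; rewrite forall_prod; congr (_ * _); apply: eq_bigr => k _.
  by rewrite /covers /= (cst k k0).
rewrite (sum_prodp_coord (cand m k0).1
  (fun s => (\sum_t p2 t * (~~ T2 s t)%:R) ^+ #|K|) p1_sum).
rewrite -[leRHS]mul1r -[X in _ <= X * _]p1_sum mulr_suml; apply: ler_sum => s _.
have [->|ps] := eqVneq (p1 s) 0; first by rewrite !mul0r.
by rewrite ler_wpM2l // hf.
Qed.

Lemma fail2 m : (forall k k', (cand m k).2 = (cand m k').2) ->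
  injective (fun k => (cand m k).1) ->
  (forall t, p2 t != 0 -> (\sum_s p1 s * (~~ T2 s t)%:R) ^+ #|K| <= f) ->
  Ec p1 p2 (fun c => [forall k, ~~ covers T2 cand c m k]%:R) <= f.
Proof.
move=> cst inj hf; rewrite EcE.
under eq_bigr do rewrite mulr_sumr.
rewrite exchange_big /=; under eq_bigr do under eq_bigr do rewrite mulrCA.
under eq_bigr do rewrite -mulr_sumr.
rewrite (eq_bigr (fun c2 => prodp p2 c2 *
    (\sum_s p1 s * (~~ T2 s (c2 (cand m k0).2))%:R) ^+ #|K|)); last first.
  move=> c2 _; congr (_ * _).
  rewrite -(sum_prodp_inj (fun s => (~~ T2 s (c2 (cand m k0).2))%:R) p1_sum inj).
  apply: eq_bigr => c1 _; rewrite forall_prod; congr (_ * _); apply: eq_bigr => k _.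
  by rewrite /covers /= (cst k k0).
rewrite (sum_prodp_coord (cand m k0).2
  (fun t => (\sum_s p1 s * (~~ T2 s t)%:R) ^+ #|K|) p2_sum).
rewrite -[leRHS]mul1r -[X in _ <= X * _]p2_sum mulr_suml; apply: ler_sum => t _.
have [->|pt] := eqVneq (p2 t) 0; first by rewrite !mul0r.
by rewrite ler_wpM2l // hf.
Qed.

End FailureProbability.

(** * Choice of the slacks and existence of good random codes *)

Section RandomCoding.
Variables (R : realType) (X1 X2 Y : finType) (W : X1 -> X2 -> {ffun Y -> R}).
Variables (q : X1 -> X2 -> Y -> R) (Q : {ffun X1 * X2 -> R}).
Hypothesis hW : forall x1 x2, is_pmf (W x1 x2).
Hypothesis Qpmf : is_pmf Q.
Local Notation Tr := ((X1 * X2) * Y)%type.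
Local Notation P := (joint W Q).

Lemma ccont_IA : ccont (@I_X2_YX1 R X1 X2 Y).
Proof. by apply: ccontB; [apply: ccontD|]; exact: ccont_entropy_marg. Qed.
Lemma ccont_IB : ccont (@I_X1_YX2 R X1 X2 Y).
Proof. by apply: ccontB; [apply: ccontD|]; exact: ccont_entropy_marg. Qed.
Lemma ccont_I1 : ccont (@I_X1_Y R X1 X2 Y).
Proof. by apply: ccontB; [apply: ccontD|]; exact: ccont_entropy_marg. Qed.
Lemma ccont_I2 : ccont (@I_X2_Y R X1 X2 Y).
Proof. by apply: ccontB; [apply: ccontD|]; exact: ccont_entropy_marg. Qed.
Lemma ccont_IC : ccont (@I_X1_X2_Y R X1 X2 Y).
Proof. by apply: ccontB; [apply: ccontD; [apply: ccontD|]|]; exact: ccont_entropy_marg. Qed.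

(** Stated for every [mu] below the margin, so that the minimum of three margins serves all classes
    at once. *)
Lemma margin_opt (h : bool) (U : finType) (D : Tr -> U) (Phi : {ffun Tr -> R} -> R) :
  ccont Phi -> (h -> forall V, Gq q P V -> marg D V = marg D P -> 0 < Phi V) ->
  exists2 eta, 0 < eta & h -> forall V mu, mu <= eta -> is_pmf V -> viol q D P V <= mu ->
    mu <= Phi V.
Proof.
move=> cPhi; case: h => [/(_ isT) hV|_]; last by exists 1.
have [eta e0 he] := margin_class (joint_pmf hW Qpmf) cPhi hV.
by exists eta => // _ V mu me pV vV; apply: (le_trans me); apply: he => //; exact: le_trans me.
Qed.

Variables (a b ci ca cc rM : R) (hA hB hC : bool).
Hypothesis marginA : hA -> forall V, L2 q P V -> a < I_X2_YX1 V.
Hypothesis marginB : hB -> forall V, L1 q P V -> b < I_X1_YX2 V.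
Hypothesis marginC : hC -> forall V, L0 q P V ->
  [\/ ci < I_X1_Y V, ca < I_X2_Y V | cc < I_X1_X2_Y V].

Lemma uniform_margins : exists2 mu, 0 < mu &
  [/\ hA -> forall V, is_pmf V -> viol q (@pX1Y X1 X2 Y) P V <= mu -> a + mu <= I_X2_YX1 V,
      hB -> forall V, is_pmf V -> viol q (@pX2Y X1 X2 Y) P V <= mu -> b + mu <= I_X1_YX2 V &
      hC -> forall V, is_pmf V -> viol q (@pY X1 X2 Y) P V <= mu ->
        [\/ ci + mu <= I_X1_Y V, ca + mu <= I_X2_Y V | cc + mu <= I_X1_X2_Y V]].
Proof.
have [eA eA0 HA] := @margin_opt hA _ (@pX1Y X1 X2 Y) (fun V => I_X2_YX1 V - a)
  (ccontB ccont_IA (@ccont_cst R _ a))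
  (fun h V g m => ltac:(by rewrite subr_gt0; apply: (marginA h); split)).
have [eB eB0 HB] := @margin_opt hB _ (@pX2Y X1 X2 Y) (fun V => I_X1_YX2 V - b)
  (ccontB ccont_IB (@ccont_cst R _ b))
  (fun h V g m => ltac:(by rewrite subr_gt0; apply: (marginB h); split)).
pose PhiC (V : {ffun Tr -> R}) : R := Num.max (I_X1_Y V - ci) (Num.max (I_X2_Y V - ca) (I_X1_X2_Y V - cc)).
have cC : ccont PhiC.
  apply: (@ccont_max _ _ (fun V => I_X1_Y V - ci)).
    exact: (ccontB ccont_I1 (@ccont_cst R _ ci)).
  apply: (@ccont_max _ _ (fun V => I_X2_Y V - ca)).
    exact: (ccontB ccont_I2 (@ccont_cst R _ ca)).
  exact: (ccontB ccont_IC (@ccont_cst R _ cc)).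
have [|eC eC0 HC] := @margin_opt hC _ (@pY X1 X2 Y) PhiC cC.
  move=> h V g m; rewrite /PhiC !lt_max !subr_gt0.
  by have [->|->|->] := marginC h (conj g m); rewrite ?orbT.
have [mu [mu0 muA muB muC]] : exists mu, [/\ 0 < mu, mu <= eA, mu <= eB & mu <= eC].
  by exists (Num.min eA (Num.min eB eC)); rewrite !lt_min !ge_min !lexx !orbT eA0 eB0 eC0.
exists mu => //; split=> h V pV vV.
- by have := HA h V _ muA pV vV; lra.
- by have := HB h V _ muB pV vV; lra.
have := HC h V _ muC pV vV.
rewrite /PhiC !le_max => /or3P[] ?; [constructor 1|constructor 2|constructor 3]; lra.
Qed.

(* [a], [b], [cc] bound the exponents of the numbers of rivals sharing [x1], sharing [x2],
   sharing nothing; [ci] and [ca] those of the words [x1] and [x2] occurring in the last class.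
   The flags are false when the class is empty.  [dir] tells which codebook varies with [k]. *)
Theorem random_coding : exists2 e, 0 < e & forall eps, 0 < eps -> exists N : nat,
  forall n, (N <= n)%N -> forall (I A M K : finType) (k0 : K) (cand : M -> K -> I * A)
    (dir : bool) (num := fun (h : bool) (x : R) => h%:R * (16 * pow2 (n%:R * (x + e)))),
  pow2 (n%:R * (I12 Q + e)) <= #|K|%:R -> #|K|%:R <= 2 * pow2 (n%:R * (I12 Q + e)) ->
  #|M|%:R <= 8 * pow2 (n%:R * rM) ->
  (forall m k, ~~ rival cand m (cand m k)) ->
  (if dir then (forall m k k', (cand m k).1 = (cand m k').1) /\
               forall m, injective (fun k => (cand m k).2)
   else (forall m k k', (cand m k).2 = (cand m k').2) /\
               forall m, injective (fun k => (cand m k).1)) ->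
  (forall m k, #|rivalA cand m (cand m k)|%:R <= num hA a) ->
  (forall m k, #|rivalB cand m (cand m k)|%:R <= num hB b) ->
  (forall m k, #|rivalCi cand m (cand m k)|%:R <= num hC ci) ->
  (forall m k, #|rivalCa cand m (cand m k)|%:R <= num hC ca) ->
  (forall m k, #|rivalC cand m (cand m k)|%:R <= num hC cc) ->
  exists (p1 : {ffun 'I_n -> X1} -> R) (p2 : {ffun 'I_n -> X2} -> R)
    (T : {ffun 'I_n -> X1} -> {ffun 'I_n -> X2} -> bool),
  [/\ (forall s, 0 <= p1 s) /\ \sum_s p1 s = 1, (forall t, 0 <= p2 t) /\ \sum_t p2 t = 1 &
    forall m, Ec p1 p2 (fun c => err k0 (@Wn _ _ _ _ W n) T (@scn _ _ _ _ q n) cand c m) <= eps].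
Proof.
have [mu mu0 [mA mB mC]] := uniform_margins.
have Ppmf := joint_pmf hW Qpmf.
have [Q0 Qs] := Qpmf; have [P0 Ps] := Ppmf.
have [Q10 Q1s] := Q1_pmf Qpmf; have [Q20 Q2s] := Q2_pmf Qpmf.
have l2 := @ln2_gt0 R.
have qa0 : 0 <= qabs q P by apply: sumr_ge0 => t _; rewrite mulr_ge0.
have C10 := info_density_l1_ge0 Qpmf.
(* The violation budget [mu] is shared equally between output typicality ([eta2]) and input
   typicality ([eta1]). *)
pose eta2 := Num.min 1 (mu / (2 * (1 + qabs q P))).
have eta20 : 0 < eta2 by rewrite lt_min ltr01 divr_gt0 // mulr_gt0 //; lra.
have eta21 : eta2 <= 1 by rewrite ge_min lexx.
have eta2mu : eta2 * (1 + qabs q P) <= mu / 2.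
  have h1 : 0 < 1 + qabs q P by lra.
  have : eta2 <= mu / (2 * (1 + qabs q P)) by rewrite ge_min lexx orbT.
  move=> /(ler_wpM2r (ltW h1)) /le_trans; apply.
  by rewrite le_eqVlt; apply/orP; left; apply/eqP; field; apply: lt0r_neq0.
have [c c0 hc] := typ_whp P0 Ps eta20 eta21.
(* The candidates cost a factor with exponent [3 e / 2]. Then [5 e / 2 - mu <= - mu / 2] controls
   the rivals, and [3 e ln 2 / 2 <= c / 2] controls the untypical outputs. *)
pose e := Num.min (mu / 8) (c / (3 * ln 2)).
have e0 : 0 < e by rewrite lt_min !divr_gt0 // mulr_gt0.
have e_mu : e <= mu / 8 by rewrite ge_min lexx.
have e_c : e * ln 2 <= c / 3.
  have : e <= c / (3 * ln 2) by rewrite ge_min lexx orbT.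
  move=> /(ler_wpM2r (ltW l2)) /le_trans; apply.
  by rewrite le_eqVlt; apply/orP; left; apply/eqP; field; apply: lt0r_neq0.
(* Typicality of the inputs is so tight that the information density stays within [e / 2] of
   [I12 Q], half of the excess rate of candidates. *)
pose eta1 := Num.min 1 (Num.min (mu / 2) (e / (2 * (1 + info_density_l1 Q)))).
have h1C : 0 < 1 + info_density_l1 Q by lra.
have eta10 : 0 < eta1 by rewrite !lt_min ltr01 !divr_gt0 // mulr_gt0.
have eta11 : eta1 <= 1 by rewrite ge_min lexx.
have eta1mu : eta1 <= mu / 2 by rewrite !ge_min lexx orbT.
have eta1C : eta1 * info_density_l1 Q <= e / 2.
  have : eta1 <= e / (2 * (1 + info_density_l1 Q)) by rewrite !ge_min lexx !orbT.
  move=> /(ler_wpM2r (ltW h1C)) h; apply: (@le_trans _ _ (eta1 * (1 + info_density_l1 Q))).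
    by rewrite ler_wpM2l ?(ltW eta10) //; lra.
  apply: (le_trans h).
  by rewrite le_eqVlt; apply/orP; left; apply/eqP; field; apply: lt0r_neq0.
have [c1 c10 hc1] := typ_whp Q0 Qs eta10 eta11.
exists e => // eps eps0.
have e3 : 0 < eps / 3 by rewrite divr_gt0.
have [N1 HN1] := exp_small (C := (2 * #|{: X1 * X2}|)%:R) c10 (ler0n _ _)
  (ltac:(lra) : 0 < 1 / 4 :> R).
have [N2 HN2] := double_exp_small (C := 8) rM (ltac:(lra) : 0 < e / 2) (ler0n _ 8) e3.
have [N3 HN3] := exp_small (C := 8 * (2 * #|{: Tr}|)%:R) (ltac:(lra) : 0 < c / 2)
  (ltac:(by rewrite mulr_ge0)) e3.
have mul2 : 0 < mu / 2 * ln 2 by rewrite mulr_gt0 // divr_gt0.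
have [N4 HN4] := poly_exp_small #|{: Tr}| (C := 8 * 128) mul2 (mulr_ge0 (ler0n _ _) (ler0n _ _)) e3.
exists (maxn N1 (maxn N2 (maxn N3 N4))).+1 => n.
move=> /[dup] /(leq_ltn_trans (leq0n _)) n0 /ltnW; rewrite !geq_max.
move=> /and4P[/HN1 H1 /HN2 H2 /HN3 H3 /HN4 H4] I A M K k0 cand dir num.
move=> K1 K2 hM own hdir nA nB nCi nCa nC.
pose T s t := T2 Q eta1 (n := n) s t.
pose J (s : {ffun 'I_n -> X1}) (t : {ffun 'I_n -> X2}) := prodp Q (zip2 s t).
pose f := expR (- (pow2 (n%:R * (e / 2)) / 2)).
pose al := pow2 (- n%:R * (I12 Q + eta1 * info_density_l1 Q)).
(* The expected number of typical candidates still grows like [pow2 (n e / 2)], which makes the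
   failure doubly exponential. *)
have Kal : pow2 (n%:R * (e / 2)) / 2 <= #|K|%:R * (al / 2).
  apply: (@le_trans _ _ (pow2 (n%:R * (I12 Q + e)) * (al / 2))); last first.
    by rewrite ler_wpM2r // divr_ge0 // pow2_ge0.
  rewrite [leRHS]mulrA ler_wpM2r // -pow2D ler_pow2 mulNr -mulrBr ler_wpM2l //; lra.
have J0 s t : 0 <= J s t by exact: prodp_ge0.
have J1 : \sum_s \sum_t J s t = 1 by rewrite sum_zip2; exact: sum_prodp.
have Jbad : \sum_s \sum_t J s t * (~~ T s t)%:R <= 1 / 4.
  rewrite (sum_zip2 (fun z => prodp Q z * (~~ typ eta1 Q z)%:R)).
  exact: le_trans (hc1 n n0) H1.
have prodQ1 (s : {ffun 'I_n -> X1}) : 0 <= prodp (Q1 Q) s :> R by exact: prodp_ge0.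
have prodQ2 (s : {ffun 'I_n -> X2}) : 0 <= prodp (Q2 Q) s :> R by exact: prodp_ge0.
have [p1 [p2 [[p10 p1s p1le] [p20 p2s p2le] failP]]] : exists (p1 : {ffun 'I_n -> X1} -> R)
    (p2 : {ffun 'I_n -> X2} -> R),
  [/\ [/\ forall s, 0 <= p1 s, \sum_s p1 s = 1 & forall s, p1 s <= 2 * prodp (Q1 Q) s],
      [/\ forall s, 0 <= p2 s, \sum_s p2 s = 1 & forall s, p2 s <= 2 * prodp (Q2 Q) s] &
      forall m, Ec p1 p2 (fun c => [forall k, ~~ covers T cand c m k]%:R) <= f].
  case: dir hdir => -[cst inj].
    have [p1 [p10 p1s p1le p1ok]] := cond_pmf J0 J1 Jbad.
    exists p1, (fun t => prodp (Q2 Q) t); split.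
    - by split=> // s; rewrite -(sum_prodp_zip1 Q).
    - by split=> //; [exact: sum_prodp|move=> s; rewrite ler_peMl // ler1n].
    move=> m; apply: (fail1 k0) => //; first exact: sum_prodp.
    move=> s /p1ok[ps hs].
    apply: (@le_trans _ _ (expR (- (#|K|%:R * (al / 2))))); last by rewrite ler_expR lerN2.
    apply: (@miss_prob R _ _ J T K _ al s prodQ2 (sum_prodp _ Q2s) (pow2_ge0 _) ps hs).
    move=> t Tst.
    by rewrite (sum_prodp_zip1 Q); exact: change_ge.
  have [|||p2 [p20 p2s p2le p2ok]] := @cond_pmf R _ _ (fun t s => J s t) (fun t s => T s t).
    by move=> *; exact: J0.
    by rewrite exchange_big.
    by rewrite exchange_big.
  exists (fun t => prodp (Q1 Q) t), p2; split.
  - by split=> //; [exact: sum_prodp|move=> s; rewrite ler_peMl // ler1n].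
  - by split=> // s; rewrite -(sum_prodp_zip2 Q).
  move=> m; apply: (fail2 k0) => //; first exact: sum_prodp.
  move=> t /p2ok[pt ht].
  apply: (@le_trans _ _ (expR (- (#|K|%:R * (al / 2))))); last by rewrite ler_expR lerN2.
  apply: (@miss_prob R _ _ (fun t s => J s t) (fun t s => T s t) K _ al t prodQ1
    (sum_prodp _ Q1s) (pow2_ge0 _) pt ht) => s Tst.
  by rewrite (sum_prodp_zip2 Q) [leRHS]mulrC; exact: change_ge.
exists p1, p2, T; split=> // m.
have emu : eta1 + eta2 * (1 + qabs q P) <= mu by lra.
apply: (le_trans (fixed_length_bound hW Qpmf n0 emu mA mB mC k0 p10 p20 p1s p2s p1le p2le own
  nA nB nCi nCa nC failP (hc n n0) m)).
have part1 : #|M|%:R * f <= eps / 3.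
  by apply: le_trans H2; rewrite ler_wpM2r // expR_ge0.
set g := 4 * _; set NT := (#|{ffun Tr -> 'I_n.+1}|%:R : R).
(* The exponents [I12 Q] cancel, leaving [e + e / 2]. *)
have Kg : #|K|%:R * g <= 8 * pow2 (n%:R * (3 / 2 * e)).
  rewrite /g; apply: (@le_trans _ _ (2 * pow2 (n%:R * (I12 Q + e)) *
     (4 * pow2 (- n%:R * (I12 Q - eta1 * info_density_l1 Q))))).
    by rewrite ler_wpM2r // mulr_ge0 // pow2_ge0.
  rewrite mulrACA -pow2D -natrM ler_wpM2l // ler_pow2 mulNr -mulrBr ler_wpM2l //; lra.
have g0 : 0 <= g by rewrite mulr_ge0 // pow2_ge0.
rewrite mulrA mulrDr.
have part2 : #|K|%:R * g * ((2 * #|{: Tr}|)%:R * expR (- n%:R * c)) <= eps / 3.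
  apply: le_trans H3.
  apply: (@le_trans _ _ (8 * pow2 (n%:R * (3 / 2 * e)) * ((2 * #|{: Tr}|)%:R * expR (- n%:R * c)))).
    by rewrite ler_wpM2r // mulr_ge0 // expR_ge0.
  rewrite mulrACA ler_wpM2l ?mulr_ge0 // /pow2 -expRD ler_expR.
  have : n%:R * (e * ln 2) <= n%:R * (c / 3) by rewrite ler_wpM2l.
  by move=> ?; lra.
have part3 : #|K|%:R * g * (128 * NT * pow2 (n%:R * (e - mu))) <= eps / 3.
  apply: le_trans H4.
  apply: (@le_trans _ _ (8 * pow2 (n%:R * (3 / 2 * e)) * (128 * NT * pow2 (n%:R * (e - mu))))).
    by rewrite ler_wpM2r // !mulr_ge0 // pow2_ge0.
  rewrite mulrACA (_ : 8 * (128 * NT) = NT * (8 * 128)); last by rewrite mulrA mulrC.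
  rewrite /NT card_ffun card_ord ler_wpM2l ?mulr_ge0 // -pow2D /pow2 ler_expR.
  have : n%:R * ln 2 * (5 / 2 * e - mu) <= n%:R * ln 2 * (- (mu / 2)).
    by rewrite ler_wpM2l ?mulr_ge0 ?(ltW l2) //; lra.
  by move=> ?; lra.
lra.
Qed.

End RandomCoding.

(** * Code sizes and randomized codes *)

Section CodeSize.
Variable R : realType.
Implicit Types r : R.

(* [ceil (2 ^ (n r))]; it equals [1] as soon as [r <= 0], so a zero rate creates no rival. *)
Definition csz (n : nat) r : nat := `|Num.ceil (pow2 (n%:R * r))|%N.

Lemma csz_natr n r : (csz n r)%:R = (Num.ceil (pow2 (n%:R * r)))%:~R :> R.
Proof.
rewrite /csz natr_absz ger0_norm // -(ler_int R); apply: le_trans (ceil_ge _).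
exact: pow2_ge0.
Qed.

Lemma csz_ge n r : pow2 (n%:R * r) <= (csz n r)%:R.
Proof. by rewrite csz_natr ceil_ge. Qed.

Lemma csz_le n r k : pow2 (n%:R * r) <= k%:R -> (csz n r <= k)%N.
Proof.
move=> h; rewrite -(ler_nat R) csz_natr; move: h.
by rewrite -[k%:R]/(k%:Z%:~R) -ceil_le_int ler_int.
Qed.

Lemma csz_le2 n r : 0 <= r -> (csz n r)%:R <= 2 * pow2 (n%:R * r).
Proof.
move=> r0; have := ceilB1_lt (pow2 (n%:R * r)); rewrite intrB -csz_natr.
have : 1 <= pow2 (n%:R * r) by rewrite pow2_ge1 // mulr_ge0.
by move=> *; lra.
Qed.

Lemma csz_eq1 n r : r <= 0 -> csz n r = 1%N.
Proof.
move=> r0; apply/eqP; rewrite eqn_leq csz_le /=.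
  by rewrite -(ltr_nat R) (lt_le_trans (pow2_gt0 _) (csz_ge n r)).
by rewrite -[leRHS](pow2_0 R) ler_pow2 mulr_ge0_le0.
Qed.

Lemma csz_gt0 n r : (0 < csz n r)%N.
Proof. by rewrite -(ltr_nat R) (lt_le_trans (pow2_gt0 _) (csz_ge n r)). Qed.

End CodeSize.

Section RandomCodes.
Variables (R : realType) (X1 X2 Y : finType) (W : X1 -> X2 -> {ffun Y -> R}).
Variables (q : X1 -> X2 -> Y -> R).

Definition pair_err (n : nat) (M : finType) (g1 : M -> {ffun 'I_n -> X1})
    (g2 : M -> {ffun 'I_n -> X2}) (m : M) : R :=
  \sum_y Wn W (g1 m) (g2 m) y *
    (~~ [forall m', (m' != m) ==>
      (scn q (g1 m') (g2 m') y < scn q (g1 m) (g2 m) y)%R])%:R.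

(* A randomized code whose expected error is small for each message pair separately: unlike a
   bound on the average over the messages, this passes to subsets of messages. *)
Definition rcode (n : nat) (M1 M2 : finType) (eps : R) : Prop :=
  exists (Om : finType) (w : Om -> R) (f1 : Om -> M1 -> {ffun 'I_n -> X1})
    (f2 : Om -> M1 -> M2 -> {ffun 'I_n -> X2}),
  [/\ forall o, 0 <= w o, \sum_o w o = 1 &
    forall m : M1 * M2,
      \sum_o w o * pair_err (fun m => f1 o m.1) (fun m => f2 o m.1 m.2) m <= eps].

Hypothesis hW : forall x1 x2, is_pmf (W x1 x2).

Lemma pair_err_sub n (M M' : finType) (h : M' -> M) g1 g2 m : injective h ->
  @pair_err n M' (g1 \o h) (g2 \o h) m <= pair_err g1 g2 (h m).
Proof.
move=> hI; apply: ler_sum => y _; rewrite ler_wpM2l ?Wn_ge0 // ler_nat leq_bool //.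
apply: contraNN => /forallP H; apply/forallP => m'; apply/implyP => m'm.
by have := H (h m'); rewrite (inj_eq hI) m'm.
Qed.

Lemma card_inj (T U : finType) : (#|T| <= #|U|)%N -> {h : T -> U | injective h}.
Proof.
move=> TU; exists (fun t => enum_val (widen_ord TU (enum_rank t))) => t t'.
by move=> /enum_val_inj /(congr1 val) /= /ord_inj /enum_rank_inj.
Qed.

Lemma rcode_sub n (M1 M2 M1' M2' : finType) eps : (#|M1'| <= #|M1|)%N -> (#|M2'| <= #|M2|)%N ->
  rcode n M1 M2 eps -> rcode n M1' M2' eps.
Proof.
move=> /card_inj[h1 h1I] /card_inj[h2 h2I] [Om [w [f1 [f2 [w0 w1 H]]]]].
exists Om, w, (fun o m => f1 o (h1 m)), (fun o m1 m2 => f2 o (h1 m1) (h2 m2)); split=> // m.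
apply: le_trans (H (h1 m.1, h2 m.2)); apply: ler_sum => o _; rewrite ler_wpM2l //.
apply: (pair_err_sub (h := fun m => (h1 m.1, h2 m.2)) (fun m => f1 o m.1) (fun m => f2 o m.1 m.2)).
by move=> [a b] [a' b'] [/h1I -> /h2I ->].
Qed.

(** The premise on [F] is the cognitive constraint: the first word must be a function of the first
    message alone, although the selected candidate may depend on both messages. *)
Lemma rcode_of n (M1 M2 I A K : finType) (k0 : K) (cand : M1 * M2 -> K -> I * A)
    (p1 : {ffun 'I_n -> X1} -> R) (p2 : {ffun 'I_n -> X2} -> R) T eps
    (F : {ffun I -> {ffun 'I_n -> X1}} * {ffun A -> {ffun 'I_n -> X2}} -> M1 -> {ffun 'I_n -> X1}) :
  (forall s, 0 <= p1 s) /\ \sum_s p1 s = 1 -> (forall t, 0 <= p2 t) /\ \sum_t p2 t = 1 ->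
  (forall c m, F c m.1 = c.1 (cand m (sel k0 T cand c m)).1) ->
  (forall m, Ec p1 p2 (fun c => err k0 (@Wn _ _ _ _ W n) T (@scn _ _ _ _ q n) cand c m) <= eps) ->
  rcode n M1 M2 eps.
Proof.
move=> [p10 p11] [p20 p21] HF H.
exists ({ffun I -> {ffun 'I_n -> X1}} * {ffun A -> {ffun 'I_n -> X2}} : finType)%type,
  (fun c => prodp p1 c.1 * prodp p2 c.2), F,
  (fun (c : {ffun I -> {ffun 'I_n -> X1}} * {ffun A -> {ffun 'I_n -> X2}}) m1 m2 =>
     c.2 (cand (m1, m2) (sel k0 T cand c (m1, m2))).2); split.
- by move=> c; rewrite mulr_ge0 // prodp_ge0.
- rewrite -(pair_bigA _ (fun c1 c2 => prodp p1 c1 * prodp p2 c2)) /=.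
  under eq_bigr do rewrite -mulr_sumr sum_prodp // mulr1.
  exact: sum_prodp.
move=> m; apply: le_trans (H m); apply: ler_sum => c _; rewrite ler_wpM2l //.
  by rewrite mulr_ge0 // prodp_ge0.
rewrite /pair_err /err; under [leRHS]eq_bigr do rewrite -HF.
rewrite le_eqVlt; apply/orP; left; apply/eqP; apply: eq_bigr => y _.
congr (_ * _%:R); first by case: m.
congr (nat_of_bool (~~ _)); apply: eq_forallb => m'; congr (_ ==> _).
by rewrite -!HF; case: m => ? ?; case: m' => ? ?.
Qed.

End RandomCodes.

(** * Auxiliary facts on information, infima and cardinals *)

Section MutualInformation.
Variables (R : realType) (X1 X2 : finType) (Q : {ffun X1 * X2 -> R}).
Hypothesis Qpmf : is_pmf Q.

(** From [ln x <= x - 1]. It makes the rate of the candidate list nonnegative, as the bounds on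
    rounded sizes require. *)
Lemma I12_ge0 : 0 <= I12 Q.
Proof.
have [Q0 Qs] := Qpmf; have [Q10 Q1s] := Q1_pmf Qpmf; have [Q20 Q2s] := Q2_pmf Qpmf.
have l2 := @ln2_gt0 R.
rewrite -sum_info_density // -(pmulr_lge0 _ l2) mulr_suml.
suff : \sum_a (Q a - Q1 Q a.1 * Q2 Q a.2) <= \sum_a Q a * info_density Q a * ln 2.
  apply: le_trans; rewrite sumrB Qs.
  have -> : \sum_a Q1 Q a.1 * Q2 Q a.2 = 1.
    rewrite -(pair_bigA _ (fun a b => Q1 Q a * Q2 Q b)) /=.
    by under eq_bigr do rewrite -mulr_sumr Q2s mulr1; exact: Q1s.
  by rewrite subrr.
apply: ler_sum => -[a b] _ /=.
have [->|Qab] := eqVneq (Q (a, b)) 0; first by rewrite !mul0r sub0r oppr_le0 mulr_ge0 // ?Q10 ?Q20.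
have {Qab} Qab : 0 < Q (a, b) by rewrite lt_neqAle eq_sym Qab Q0.
have Q1a : 0 < Q1 Q a.
  by apply: (lt_le_trans Qab); rewrite /Q1 ffunE (bigD1 (a, b)) //= lerDl; exact: sumr_ge0.
have Q2b : 0 < Q2 Q b.
  by apply: (lt_le_trans Qab); rewrite /Q2 ffunE (bigD1 (a, b)) //= lerDl; exact: sumr_ge0.
have -> : Q (a, b) * info_density Q (a, b) * ln 2 =
    - (Q (a, b) * ln (Q1 Q a * Q2 Q b / Q (a, b))).
  rewrite /info_density /log2 /= ln_div ?posrE ?mulr_gt0 // lnM ?posrE //; field.
  exact: lt0r_neq0.
have x0 : 0 < Q1 Q a * Q2 Q b / Q (a, b) by rewrite divr_gt0 // mulr_gt0.
have := @le_ln1Dx R (Q1 Q a * Q2 Q b / Q (a, b) - 1).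
rewrite addrCA subrr addr0 => /(_ ltac:(lra)) /(ler_wpM2l (ltW Qab)).
rewrite mulrBr mulrCA divff ?lt0r_neq0 // mulr1; lra.
Qed.

End MutualInformation.

Section LowerBound.
Variables (R : realType) (T : finType).

(** An [inf] lies below the members of its set only when the set is bounded below; this supplies the
    bound. *)
Lemma ccont_lbound (F : {ffun T -> R} -> R) : ccont F ->
  exists m, forall V, is_pmf V -> m <= F V.
Proof.
move=> cF.
pose A := [set v : 'rV[R]_#|T| | forall i, `[0, 1]%classic (v ord0 i)].
have cA : compact A.
  by apply: (@rV_compact R _ (fun=> `[0 : R, 1]%classic)) => i; exact: segment_compact.
have A0 : A !=set0.
  by exists (const_mx 0) => i /=; rewrite mxE in_itv /= lexx ler01.
have [v vA vmin] := compact_EVT_min A0 cA (continuous_subspaceT cF).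
exists (F (ffun_of v)) => V /pmf_le1 hV.
pose w : 'rV[R]_#|T| := \row_i V (enum_val i).
have wV : ffun_of w = V by apply/ffunP => t; rewrite ffunE mxE enum_rankK.
by rewrite -wV; apply: vmin; rewrite inE => i /=; rewrite mxE in_itv /= hV.
Qed.

Lemma inf_image_le (S : set {ffun T -> R}) (F : {ffun T -> R} -> R) V :
  ccont F -> (forall V, S V -> is_pmf V) -> S V -> inf [set F f | f in S] <= F V.
Proof.
move=> /ccont_lbound[m hm] hS SV; apply: ge_inf; last by exists V.
by exists m => _ [f Sf <-]; apply: hm; exact: hS.
Qed.

End LowerBound.

Lemma card_image_le (T U : finType) (P : pred U) (f : T -> U) :
  (forall u, P u -> exists t, f t = u) -> (#|P| <= #|T|)%N.
Proof.
move=> h; apply: (@leq_trans #|codom f|); last exact: leq_image_card.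
by apply: subset_leq_card; apply/fintype.subsetP => u /h[t <-]; exact: codom_f.
Qed.

Lemma num_le (R : realType) (h : bool) (k : nat) (x : R) :
  (h -> k%:R <= x) -> (~~ h -> k = 0%N) -> k%:R <= h%:R * x.
Proof.
by case: h => [/(_ isT) hk _|_ /(_ isT) ->]; rewrite ?mul1r // mul0r.
Qed.

Section SizeProducts.
Variables (R : realType) (n : nat).
Implicit Types r : R.

Lemma csz_mul2 r1 r2 : 0 <= r1 -> 0 <= r2 ->
  (csz n r1 * csz n r2)%:R <= 4 * pow2 (n%:R * (r1 + r2)).
Proof.
move=> /(csz_le2 n) h1 /(csz_le2 n) h2; rewrite natrM mulrDr pow2D.
by have := ler_pM (ler0n _ _) (ler0n _ _) h1 h2; lra.
Qed.

Lemma csz_mul3 r1 r2 r3 : 0 <= r1 -> 0 <= r2 -> 0 <= r3 ->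
  (csz n r1 * csz n r2 * csz n r3)%:R <= 8 * pow2 (n%:R * (r1 + r2 + r3)).
Proof.
move=> h1 h2 /(csz_le2 n) h3; have h12 := csz_mul2 h1 h2.
rewrite natrM (mulrDr _ (r1 + r2)) pow2D.
by have := ler_pM (ler0n _ _) (ler0n _ _) h12 h3; lra.
Qed.

Lemma csz_mul4 r1 r2 r3 r4 : 0 <= r1 -> 0 <= r2 -> 0 <= r3 -> 0 <= r4 ->
  (csz n r1 * csz n r2 * csz n r3 * csz n r4)%:R
    <= 16 * pow2 (n%:R * (r1 + r2 + r3 + r4)).
Proof.
move=> h1 h2 h3 /(csz_le2 n) h4; have h123 := csz_mul3 h1 h2 h3.
rewrite natrM (mulrDr _ (r1 + r2 + r3)) pow2D.
by have := ler_pM (ler0n _ _) (ler0n _ _) h123 h4; lra.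
Qed.

End SizeProducts.

(** * The three coding schemes *)

Section Schemes.
Variables (R : realType) (X1 X2 Y : finType) (W : X1 -> X2 -> {ffun Y -> R}).
Variables (q : X1 -> X2 -> Y -> R) (Q : {ffun X1 * X2 -> R}).
Hypothesis hW : forall x1 x2, is_pmf (W x1 x2).
Hypothesis Qpmf : is_pmf Q.
Local Notation P := (joint W Q).
Local Notation J := (I12 Q).

Lemma ord1_eq n (r : R) (i j : 'I_(csz n r)) : r <= 0 -> i = j.
Proof.
move=> /(csz_eq1 n) r1; apply/val_inj => /=.
by case: i j => [[|i] hi] [[|j] hj] //=; move: hi hj; rewrite r1.
Qed.

(** The second index contains the whole message, so no wrong message shares [x2] and nothing is
    asked on [L1]. For the third class one counts either the wrong [x1] words or the pairs. *)
Lemma superposition (ra rb r2 : R) : 0 <= ra -> 0 <= rb -> 0 <= r2 ->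
  (0 < rb + r2 -> forall V, L2 q P V -> rb + r2 + J < I_X2_YX1 V) ->
  (0 < ra -> forall V, L0 q P V ->
     ra < I_X1_Y V \/ ra + rb + r2 + J < I_X1_X2_Y V) ->
  forall eps, 0 < eps -> exists N : nat, forall n, (N <= n)%N ->
    rcode W q n ('I_(csz n ra) * 'I_(csz n rb))%type 'I_(csz n r2) eps.
Proof.
move=> ra0 rb0 r20 HA HC eps eps0; have J0 := I12_ge0 Qpmf.
have [e e0 /(_ eps eps0)[N HN]] := @random_coding R X1 X2 Y W q Q hW Qpmf
  (rb + r2 + J) 0 ra (ra + rb + r2 + J) (ra + rb + r2 + J) (ra + rb + r2)
  (0 < rb + r2) false (0 < ra) HA (fun h => False_ind _ (notF h))
  (fun h V hV => ltac:(by case: (HC h V hV) => ?; [constructor 1|constructor 3])).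
exists N => n /HN {}HN.
pose I := 'I_(csz n ra); pose Jb := 'I_(csz n rb); pose M2 := 'I_(csz n r2).
pose K := 'I_(csz n (J + e)).
have Je : 0 <= J + e by lra.
pose k0 : K := Ordinal (csz_gt0 n (J + e)).
pose cand (m : (I * Jb) * M2) (k : K) : I * (((I * Jb) * M2) * K) := (m.1.1, (m, k)).
have cardM : #|{: (I * Jb) * M2}| = (csz n ra * csz n rb * csz n r2)%N.
  by rewrite !card_prod !card_ord.
have cardC m k : (#|rivalC cand m (cand m k)| <= csz n ra * csz n rb * csz n r2 * csz n (J + e))%N.
  rewrite -[X in (_ <= _ * X)%N]card_ord -cardM -card_prod.
  apply: (@card_image_le _ _ _ (fun mk => cand mk.1 mk.2)) => u /and3P[_ _].
  by move=> /existsP[m' /existsP[k' /andP[_ /eqP <-]]]; exists (m', k').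
have noCi m k : ~~ (0 < ra) -> forall i', ~~ (i' != (cand m k).1).
  rewrite -leNgt => h i'; rewrite negbK; apply/eqP; exact: ord1_eq.
have [|||||||||| p1 [p2 [T [hp1 hp2 herr]]]] := HN _ _ _ _ k0 cand true.
- by rewrite card_ord csz_ge.
- by rewrite card_ord csz_le2.
- by rewrite cardM csz_mul3.
- move=> m k; apply/existsP => -[m' /existsP[k' /andP[m'm /eqP[_ mm _]]]].
  by rewrite mm eqxx in m'm.
- by split=> // m k k' [].
- move=> m k; apply: num_le => h.
    apply: (@le_trans _ _ (csz n rb * csz n r2 * csz n (J + e))%:R).
      rewrite ler_nat -[X in (_ <= X * _ * _)%N]card_ord -[X in (_ <= _ * X * _)%N]card_ord.
      rewrite -[X in (_ <= _ * X)%N]card_ord -!card_prod.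
      apply: (@card_image_le _ _ _ (fun x => (((m.1.1, x.1.1), x.1.2), x.2))).
      move=> [[[i b] c] k1] /andP[_ /existsP[m' /existsP[k' /andP[_ /eqP[im <- <-]]]]].
      by exists ((m'.1.2, m'.2), k'); rewrite -im /=; case: m' {im} => -[].
    apply: (le_trans (csz_mul3 _ rb0 r20 Je)).
    by apply: ler_pM; rewrite ?pow2_ge0 // ?ler_nat // ler_pow2 addrA.
  apply: eq_card0 => -[[[i b] c] k1]; apply/negP => /andP[_].
  move=> /existsP[[[i' b'] c'] /existsP[k' /andP[/eqP m'm /eqP[im _ _ _ _]]]].
  apply: m'm; case: m im => -[i0 b0] c0 /= ->; rewrite -leNgt in h.
  by rewrite (@ord1_eq _ _ b' b0) ?(@ord1_eq _ _ c' c0) //; lra.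
- move=> m k; apply: num_le => // _.
  apply: eq_card0 => i; apply/negP => /andP[_].
  move=> /existsP[m' /existsP[k' /andP[/eqP m'm /eqP[_ mm _]]]]; exact: m'm.
- move=> m k; apply: num_le => h.
    apply: (@le_trans _ _ (csz n ra)%:R); first by rewrite ler_nat -[leqRHS]card_ord max_card.
    apply: (le_trans (csz_le2 n ra0)).
    by apply: ler_pM; rewrite ?pow2_ge0 // ?ler_nat // ler_pow2 ler_wpM2l //; lra.
  by apply: eq_card0 => i; apply/negP => /andP[ii _]; have := noCi m k h i; rewrite ii.
- move=> m k; apply: num_le => h.
    apply: (@le_trans _ _ (csz n ra * csz n rb * csz n r2 * csz n (J + e))%:R).
      rewrite ler_nat -cardM -[X in (_ <= _ * X)%N]card_ord -card_prod; exact: max_card.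
    by apply: (le_trans (csz_mul4 _ ra0 rb0 r20 Je)); rewrite ler_wpM2l // ler_pow2 !addrA.
  apply: eq_card0 => a; apply/negP => /andP[_ /existsP[i /and3P[ii _ _]]].
  by have := noCi m k h i; rewrite ii.
- move=> m k; apply: num_le => h.
    apply: (@le_trans _ _ (csz n ra * csz n rb * csz n r2 * csz n (J + e))%:R).
      by rewrite ler_nat.
    by apply: (le_trans (csz_mul4 _ ra0 rb0 r20 Je)); rewrite ler_wpM2l // ler_pow2 !addrA.
  apply: eq_card0 => -[i a]; apply/negP => /and3P[ii _ _].
  by have := noCi m k h i; rewrite ii.
by apply: (@rcode_of _ _ _ _ _ _ _ _ _ _ _ _ k0 cand p1 p2 T eps (fun c m1 => c.1 m1.1)).
Qed.

(** The second index omits the first part of the message, so a wrong [x1] can come with the sent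
    [x2]; this costs the condition on [L1]. In exchange only [rb + r2 + J] is the rate of the [x2]
    words. *)
Lemma binning (ra rb r2 : R) : 0 <= ra -> 0 <= rb -> 0 <= r2 ->
  (0 < rb + r2 -> forall V, L2 q P V -> rb + r2 + J < I_X2_YX1 V) ->
  (0 < ra -> forall V, L1 q P V -> ra < I_X1_YX2 V) ->
  (0 < ra -> forall V, L0 q P V ->
     rb + r2 + J < I_X2_Y V \/ ra + rb + r2 + J < I_X1_X2_Y V) ->
  forall eps, 0 < eps -> exists N : nat, forall n, (N <= n)%N ->
    rcode W q n ('I_(csz n ra) * 'I_(csz n rb))%type 'I_(csz n r2) eps.
Proof.
move=> ra0 rb0 r20 HA HB HC eps eps0; have J0 := I12_ge0 Qpmf.
have [e e0 /(_ eps eps0)[N HN]] := @random_coding R X1 X2 Y W q Q hW Qpmf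
  (rb + r2 + J) ra ra (rb + r2 + J) (ra + rb + r2 + J) (ra + rb + r2)
  (0 < rb + r2) (0 < ra) (0 < ra) HA HB
  (fun h V hV => ltac:(by case: (HC h V hV) => ?; [constructor 2|constructor 3])).
exists N => n /HN {}HN.
pose I := 'I_(csz n ra); pose Jb := 'I_(csz n rb); pose M2 := 'I_(csz n r2).
pose K := 'I_(csz n (J + e)).
have Je : 0 <= J + e by lra.
pose k0 : K := Ordinal (csz_gt0 n (J + e)).
pose cand (m : (I * Jb) * M2) (k : K) : I * ((Jb * M2) * K) := (m.1.1, ((m.1.2, m.2), k)).
have cardM : #|{: (I * Jb) * M2}| = (csz n ra * csz n rb * csz n r2)%N.
  by rewrite !card_prod !card_ord.
have cardA : #|{: (Jb * M2) * K}| = (csz n rb * csz n r2 * csz n (J + e))%N.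
  by rewrite !card_prod !card_ord.
have cardC m k : (#|rivalC cand m (cand m k)| <= csz n ra * csz n rb * csz n r2 * csz n (J + e))%N.
  rewrite -[X in (_ <= _ * X)%N]card_ord -cardM -card_prod.
  apply: (@card_image_le _ _ _ (fun mk => cand mk.1 mk.2)) => u /and3P[_ _].
  by move=> /existsP[m' /existsP[k' /andP[_ /eqP <-]]]; exists (m', k').
have noCi m k : ~~ (0 < ra) -> forall i', ~~ (i' != (cand m k).1).
  rewrite -leNgt => h i'; rewrite negbK; apply/eqP; exact: ord1_eq.
have [|||||||||| p1 [p2 [T [hp1 hp2 herr]]]] := HN _ _ _ _ k0 cand true.
- by rewrite card_ord csz_ge.
- by rewrite card_ord csz_le2.
- by rewrite cardM csz_mul3.
- move=> m k; apply/existsP => -[m' /existsP[k' /andP[/eqP m'm /eqP[im bm cm _]]]].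
  by apply: m'm; case: m im bm cm => -[? ?] ? /= <- <- <-; case: m' => -[].
- by split=> // m k k' [].
- move=> m k; apply: num_le => h.
    apply: (@le_trans _ _ (csz n rb * csz n r2 * csz n (J + e))%:R).
      by rewrite ler_nat -cardA max_card.
    apply: (le_trans (csz_mul3 _ rb0 r20 Je)).
    by apply: ler_pM; rewrite ?pow2_ge0 // ?ler_nat // ler_pow2 addrA.
  apply: eq_card0 => -[[b c] k1]; apply/negP => /andP[_].
  move=> /existsP[[[i' b'] c'] /existsP[k' /andP[/eqP m'm /eqP[im _ _ _]]]].
  apply: m'm; case: m im => -[i0 b0] c0 /= ->; rewrite -leNgt in h.
  by rewrite (@ord1_eq _ _ b' b0) ?(@ord1_eq _ _ c' c0) //; lra.
- move=> m k; apply: num_le => h.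
    apply: (@le_trans _ _ (csz n ra)%:R); first by rewrite ler_nat -[leqRHS]card_ord max_card.
    apply: (le_trans (csz_le2 n ra0)).
    by apply: ler_pM; rewrite ?pow2_ge0 // ?ler_nat // ler_pow2 ler_wpM2l //; lra.
  by apply: eq_card0 => i; apply/negP => /andP[ii _]; have := noCi m k h i; rewrite ii.
- move=> m k; apply: num_le => h.
    apply: (@le_trans _ _ (csz n ra)%:R); first by rewrite ler_nat -[leqRHS]card_ord max_card.
    apply: (le_trans (csz_le2 n ra0)).
    by apply: ler_pM; rewrite ?pow2_ge0 // ?ler_nat // ler_pow2 ler_wpM2l //; lra.
  by apply: eq_card0 => i; apply/negP => /andP[ii _]; have := noCi m k h i; rewrite ii.
- move=> m k; apply: num_le => h.
    apply: (@le_trans _ _ (csz n rb * csz n r2 * csz n (J + e))%:R).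
      by rewrite ler_nat -cardA max_card.
    apply: (le_trans (csz_mul3 _ rb0 r20 Je)).
    by apply: ler_pM; rewrite ?pow2_ge0 // ?ler_nat // ler_pow2 addrA.
  apply: eq_card0 => a; apply/negP => /andP[_ /existsP[i /and3P[ii _ _]]].
  by have := noCi m k h i; rewrite ii.
- move=> m k; apply: num_le => h.
    apply: (@le_trans _ _ (csz n ra * csz n rb * csz n r2 * csz n (J + e))%:R).
      by rewrite ler_nat.
    by apply: (le_trans (csz_mul4 _ ra0 rb0 r20 Je)); rewrite ler_wpM2l // ler_pow2 !addrA.
  apply: eq_card0 => -[i a]; apply/negP => /and3P[ii _ _].
  by have := noCi m k h i; rewrite ii.
by apply: (@rcode_of _ _ _ _ _ _ _ _ _ _ _ _ k0 cand p1 p2 T eps (fun c m1 => c.1 m1.1)).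
Qed.

(** The first word carries the whole message and the candidate index. The selection may move [x1]
    because user 2 has no message, so user 1 knows everything. The cloud [x2] has rate [g], and [l]
    is the remaining rate. *)
Lemma reversed_superposition (g l : R) : 0 <= g -> 0 <= l ->
  (0 < l -> forall V, L1 q P V -> l + J < I_X1_YX2 V) ->
  (0 < g -> forall V, L0 q P V ->
     g < I_X2_Y V \/ g + l + J < I_X1_X2_Y V) ->
  forall eps, 0 < eps -> exists N : nat, forall n, (N <= n)%N ->
    rcode W q n ('I_(csz n g) * 'I_(csz n l))%type unit eps.
Proof.
move=> g0 l0 HB HC eps eps0; have J0 := I12_ge0 Qpmf.
have [e e0 /(_ eps eps0)[N HN]] := @random_coding R X1 X2 Y W q Q hW Qpmf
  0 (l + J) (g + l + J) g (g + l + J) (g + l)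
  false (0 < l) (0 < g) (fun h => False_ind _ (notF h)) HB
  (fun h V hV => ltac:(by case: (HC h V hV) => ?; [constructor 2|constructor 3])).
exists N => n /HN {}HN.
pose A := 'I_(csz n g); pose L := 'I_(csz n l).
pose K := 'I_(csz n (J + e)).
have Je : 0 <= J + e by lra.
pose k0 : K := Ordinal (csz_gt0 n (J + e)).
pose cand (m : (A * L) * unit) (k : K) : ((A * L) * K) * A := ((m.1, k), m.1.1).
have cardM : #|{: (A * L) * unit}| = (csz n g * csz n l)%N.
  by rewrite !card_prod !card_ord card_unit muln1.
have cardI : #|{: (A * L) * K}| = (csz n g * csz n l * csz n (J + e))%N.
  by rewrite !card_prod !card_ord.
have cardC m k : (#|rivalC cand m (cand m k)| <= csz n g * csz n l * csz n (J + e))%N.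
  rewrite -[X in (_ <= _ * X)%N]card_ord -cardM -card_prod.
  apply: (@card_image_le _ _ _ (fun mk => cand mk.1 mk.2)) => u /and3P[_ _].
  by move=> /existsP[m' /existsP[k' /andP[_ /eqP <-]]]; exists (m', k').
have noCa m k : ~~ (0 < g) -> forall a', ~~ (a' != (cand m k).2).
  rewrite -leNgt => h i'; rewrite negbK; apply/eqP; exact: ord1_eq.
have big_le x : csz n g * csz n l * csz n (J + e) = x ->
    x%:R <= 16 * pow2 (n%:R * (g + l + J + e)) :> R.
  move=> <-; apply: (le_trans (csz_mul3 _ g0 l0 Je)).
  by apply: ler_pM; rewrite ?pow2_ge0 // ?ler_nat // ler_pow2 addrA.
have [|||||||||| p1 [p2 [T [hp1 hp2 herr]]]] := HN _ _ _ _ k0 cand false.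
- by rewrite card_ord csz_ge.
- by rewrite card_ord csz_le2.
- rewrite cardM; apply: (le_trans (csz_mul2 _ g0 l0)).
  by rewrite ler_wpM2r ?pow2_ge0 // ler_nat.
- move=> m k; apply/existsP => -[m' /existsP[k' /andP[/eqP m'm /eqP[mm _ _]]]].
  by apply: m'm; case: m mm => ? [] /= <-; case: m' => ? [].
- by split=> // m k k' [].
- move=> m k; apply: num_le => // _.
  apply: eq_card0 => a; apply/negP => /andP[_].
  move=> /existsP[m' /existsP[k' /andP[/eqP m'm /eqP[mm _ _]]]].
  by apply: m'm; case: m mm => ? [] /= <-; case: m' => ? [].
- move=> m k; apply: num_le => h.
    apply: (@le_trans _ _ (csz n l * csz n (J + e))%:R).
      rewrite ler_nat -[X in (_ <= X * _)%N]card_ord -[X in (_ <= _ * X)%N]card_ord -card_prod.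
      apply: (@card_image_le _ _ _ (fun x => ((m.1.1, x.1), x.2))).
      move=> [[a b] k1] /andP[_ /existsP[m' /existsP[k' /andP[_ /eqP[<- <- am]]]]].
      by exists (m'.1.2, k'); rewrite -am /=; case: m' {am} => -[].
    apply: (le_trans (csz_mul2 _ l0 Je)).
    by apply: ler_pM; rewrite ?pow2_ge0 // ?ler_nat // ler_pow2 addrA.
  apply: eq_card0 => -[[a b] k1]; apply/negP => /andP[_].
  move=> /existsP[[[a' b'] []] /existsP[k' /andP[/eqP m'm /eqP[_ _ _ am]]]].
  apply: m'm; case: m am => -[a0 b0] [] /= ->; rewrite -leNgt in h.
  by rewrite (@ord1_eq _ _ b' b0).
- move=> m k; apply: num_le => h.
    by apply: (@le_trans _ _ #|{: (A * L) * K}|%:R); [rewrite ler_nat max_card|exact: big_le].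
  apply: eq_card0 => i; apply/negP => /andP[_ /existsP[a /and3P[_ aa _]]].
  by have := noCa m k h a; rewrite aa.
- move=> m k; apply: num_le => h.
    apply: (@le_trans _ _ (csz n g)%:R); first by rewrite ler_nat -[leqRHS]card_ord max_card.
    apply: (le_trans (csz_le2 n g0)).
    by apply: ler_pM; rewrite ?pow2_ge0 // ?ler_nat // ler_pow2 ler_wpM2l //; lra.
  by apply: eq_card0 => a; apply/negP => /andP[aa _]; have := noCa m k h a; rewrite aa.
- move=> m k; apply: num_le => h.
    by apply: (@le_trans _ _ (csz n g * csz n l * csz n (J + e))%:R); [rewrite ler_nat|exact: big_le].
  apply: eq_card0 => -[i a]; apply/negP => /and3P[_ aa _].
  by have := noCa m k h a; rewrite aa.
apply: (@rcode_of _ _ _ _ _ _ _ _ _ _ _ _ k0 cand p1 p2 T eps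
  (fun c m1 => c.1 (cand (m1, tt) (sel k0 T cand c (m1, tt))).1)) => //.
Qed.

End Schemes.

(** * Every pair of the region for a fixed input law is reached *)

Section RateRegion.
Variables (R : realType) (X1 X2 Y : finType) (W : X1 -> X2 -> {ffun Y -> R}).
Variables (q : X1 -> X2 -> Y -> R) (Q : {ffun X1 * X2 -> R}).
Hypothesis hW : forall x1 x2, is_pmf (W x1 x2).
Hypothesis Qpmf : is_pmf Q.
Local Notation P := (joint W Q).
Local Notation J := (I12 Q).

(** All competing distributions have input marginal [Q], so [I(X1;X2)] is the constant [J];
    conditional informations then become unconditional ones minus [J]. *)
Lemma Gq_I12 V : Gq q P V ->
  Hf (@pX1 X1 X2 Y) V + Hf (@pX2 X1 X2 Y) V - Hf (@pX1X2 X1 X2 Y) V = J.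
Proof.
move=> [_ [m12 _]]; rewrite /I12 -(joint_marg Q hW) -m12 !Hf_marg.
by rewrite [entropy _](_ : _ = Hf (@pX1X2 X1 X2 Y) V).
Qed.

Lemma ccont_pos (T : finType) (F : {ffun T -> R} -> R) : ccont F -> ccont (fun V => pos (F V)).
Proof. by move=> cF; apply: ccont_max => //; exact: (@ccont_cst R T 0). Qed.

Lemma ccont_IA1 : ccont (@I_X2_Y_given_X1 R X1 X2 Y).
Proof.
by apply: ccontB; [apply: ccontB; [apply: ccontD|]|]; exact: ccont_entropy_marg.
Qed.

Lemma ccont_I21 : ccont (@I_X2_X1 R X1 X2 Y).
Proof. by apply: ccontB; [apply: ccontD|]; exact: ccont_entropy_marg. Qed.

Lemma R1'_le V : L1 q P V -> R1' q P <= I_X1_YX2 V.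
Proof. by apply: inf_image_le; [exact: ccont_IB|move=> ? [[]]]. Qed.

Lemma R2'_le V : L2 q P V -> R2' q P <= I_X2_YX1 V - J.
Proof.
move=> hV; rewrite -(Gq_I12 hV.1).
have -> : I_X2_YX1 V - (Hf (@pX1 X1 X2 Y) V + Hf (@pX2 X1 X2 Y) V - Hf (@pX1X2 X1 X2 Y) V) =
    I_X2_Y_given_X1 V by rewrite /I_X2_YX1 /I_X2_Y_given_X1; ring.
by apply: inf_image_le hV; [exact: ccont_IA1|move=> ? [[]]].
Qed.

Lemma R1''_le V r : L0 q P V ->
  R1'' q P r <= I_X1_Y V + pos (I_X1_X2_Y V - I_X1_Y V - J - r).
Proof.
move=> hV; rewrite -(Gq_I12 hV.1).
have -> : I_X1_X2_Y V - I_X1_Y V - (Hf (@pX1 X1 X2 Y) V + Hf (@pX2 X1 X2 Y) V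
    - Hf (@pX1X2 X1 X2 Y) V) = I_X2_Y_given_X1 V.
  by rewrite /I_X1_X2_Y /I_X1_Y /I_X2_Y_given_X1; ring.
apply: (inf_image_le (F := fun f => I_X1_Y f + pos (I_X2_Y_given_X1 f - r)) _ _ hV).
  apply: ccontD; first exact: ccont_I1.
  by apply: ccont_pos; apply: ccontB; [exact: ccont_IA1|exact: ccont_cst].
by move=> ? [[]].
Qed.

Lemma R2''_le V r : L0 q P V ->
  R2'' q P r <= I_X2_Y V - J + pos (I_X1_X2_Y V - I_X2_Y V - r).
Proof.
move=> hV; rewrite -(Gq_I12 hV.1).
have -> : I_X1_X2_Y V - I_X2_Y V = I_X1_YX2 V.
  by rewrite /I_X1_X2_Y /I_X2_Y /I_X1_YX2; ring.
rewrite [X in _ <= _ - X + _](_ : _ = I_X2_X1 V); last by rewrite /I_X2_X1; ring.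
apply: (inf_image_le (F := fun f => I_X2_Y f - I_X2_X1 f + pos (I_X1_YX2 f - r)) _ _ hV).
  apply: ccontD; first by apply: ccontB; [exact: ccont_I2|exact: ccont_I21].
  apply: ccont_pos.
  by apply: ccontB; [exact: ccont_IB|exact: ccont_cst].
by move=> ? [[]].
Qed.

(** A rate that stays positive has been lowered by exactly [d], which gives strict inequalities
    precisely where a class of rivals is nonempty. *)
Lemma reduce_rate (x d : R) : 0 <= x -> 0 < d ->
  exists y, [/\ 0 <= y, y <= x, x - d <= y & 0 < y -> y = x - d].
Proof.
move=> x0 d0; have [h|h] := leP (x - d) 0.
  by exists 0; split=> //; rewrite ltxx.
by exists (x - d); split=> //; lra.
Qed.

Lemma pos_cases (t : R) : pos t = 0 \/ pos t = t /\ 0 <= t.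
Proof. by rewrite /pos; have [h|h] := leP 0 t; [right|left]. Qed.

Definition rate_ok (r : R * R) : Prop := forall del eps : R, 0 < del -> 0 < eps ->
  exists N : nat, forall n, (N <= n)%N ->
    rcode W q n 'I_(csz n (r.1 - del)) 'I_(csz n (r.2 - del)) eps.

Lemma rcode_csz n (M1 M2 : finType) (r1 r2 : R) eps :
  pow2 (n%:R * r1) <= #|M1|%:R -> pow2 (n%:R * r2) <= #|M2|%:R ->
  rcode W q n M1 M2 eps -> rcode W q n 'I_(csz n r1) 'I_(csz n r2) eps.
Proof. by move=> h1 h2; apply: rcode_sub => //; rewrite card_ord csz_le. Qed.

Lemma csz_prod_ge n (a b r : R) : r <= a + b ->
  pow2 (n%:R * r) <= #|{: 'I_(csz n a) * 'I_(csz n b)}|%:R.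
Proof.
move=> h; rewrite card_prod !card_ord natrM.
apply: (@le_trans _ _ (pow2 (n%:R * a) * pow2 (n%:R * b))).
  by rewrite -pow2D ler_pow2 -mulrDr ler_wpM2l.
by rewrite ler_pM ?pow2_ge0 ?csz_ge.
Qed.

Lemma Rbin_star_rate_ok r : Rbin_star q P r -> rate_ok r.
Proof.
move=> [ra [rb [ra0 [rb0 [r20 [r1E [h1 [h2 halt]]]]]]]] del eps del0 eps0.
have J0 := I12_ge0 Qpmf.
have F1 V : L1 q P V -> ra <= I_X1_YX2 V by move=> /R1'_le; exact: le_trans.
have F2 V : L2 q P V -> rb + r.2 + J <= I_X2_YX1 V by move=> /R2'_le; lra.
have finish n a b c : r.1 - del <= a + b -> r.2 - del <= c ->
    rcode W q n ('I_(csz n a) * 'I_(csz n b))%type 'I_(csz n c) eps ->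
    rcode W q n 'I_(csz n (r.1 - del)) 'I_(csz n (r.2 - del)) eps.
  move=> h h'; apply: rcode_csz; first exact: csz_prod_ge.
  by rewrite card_ord; apply: le_trans (csz_ge _ _); rewrite ler_pow2 ler_wpM2l.
case: halt => halt.
  have d0 : 0 < del / 4 by lra.
  have [a [a0 aa a' as_]] := reduce_rate ra0 d0.
  have [b [b0 bb b' bs]] := reduce_rate rb0 d0.
  have [c [c0 cc c' cs]] := reduce_rate r20 d0.
  have bc : 0 < b + c -> b + c < rb + r.2.
    move=> h; have [b1|b1] := ltP 0 b; first by have := bs b1; lra.
    by have /cs : 0 < c; lra.
  have [||N HN] := @superposition R X1 X2 Y W q Q hW Qpmf a b c a0 b0 c0 _ _ eps eps0.
  - by move=> /bc h V /F2; lra.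
  - move=> /as_ aE V /R1''_le => /(_ (rb + r.2)) h.
    (* If the positive part vanishes, counting the wrong [x1] words suffices; otherwise [I_X1_Y V]
       cancels and the pairs are counted. *)
    by case: (pos_cases (I_X1_X2_Y V - I_X1_Y V - J - (rb + r.2))) h => [->|[-> p0]] h;
      [left|right]; lra.
  by exists N => n /HN; apply: finish; lra.
have F3 V : L0 q P V -> rb + r.2 <= I_X2_Y V - J + pos (I_X1_X2_Y V - I_X2_Y V - ra).
  by move=> hV; apply: le_trans halt (R2''_le ra hV).
have [t0|t0] := ltP 0 (rb + r.2).
  (* The bound [(rb + r.2) / 4] keeps one of the reduced rates [b], [c] positive, so their sum has
     strictly decreased. *)
  have [d [d0 d_del d_t]] : exists d, [/\ 0 < d, d <= del / 4 & d <= (rb + r.2) / 4].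
    exists (Num.min (del / 4) ((rb + r.2) / 4)).
    by rewrite lt_min !ge_min !lexx orbT !divr_gt0.
  have [a [a0 aa a' as_]] := reduce_rate ra0 d0.
  have [b [b0 bb b' bs]] := reduce_rate rb0 d0.
  have [c [c0 cc c' cs]] := reduce_rate r20 d0.
  have bc : b + c < rb + r.2.
    have [b1|b1] := ltP 0 b; first by have := bs b1; lra.
    by have /cs : 0 < c; lra.
  have [|||N HN] := @binning R X1 X2 Y W q Q hW Qpmf a b c a0 b0 c0 _ _ _ eps eps0.
  - by move=> _ V /F2; lra.
  - by move=> /as_ aE V /F1; lra.
  - move=> /as_ aE V /F3.
    by case: (pos_cases (I_X1_X2_Y V - I_X2_Y V - ra)) => [->|[-> p0]] h; [left|right]; lra.
  by exists N => n /HN; apply: finish; lra.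
have rb_0 : rb = 0 by lra.
have r2_0 : r.2 = 0 by lra.
have d0 : 0 < del / 2 by lra.
have [a [a0 aa a' as_]] := reduce_rate ra0 d0.
(* The cloud rate is [min a (max 0 (J - del / 4))]. Being below [J] when positive, it satisfies
   [g < I_X2_Y V] in the case [J <= I_X2_Y V]; if [g < a], then [a - g + J <= a + del / 4 < ra], as
   the condition on [L1] requires. *)
have [g [g0 ga gJ gs]] : exists g, [/\ 0 <= g, g <= a, 0 < g -> g <= J - del / 4 &
    g < a -> J - del / 4 <= g].
  have [h|h] := leP (J - del / 4) 0.
    by exists 0; split=> //; rewrite ltxx.
  have [h'|h'] := leP a (J - del / 4).
    by exists a; split=> //; rewrite ltxx.
  by exists (J - del / 4); split=> //; lra.
have l0 : 0 <= a - g by lra.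
have [||N HN] := @reversed_superposition R X1 X2 Y W q Q hW Qpmf g (a - g) g0 l0 _ _ eps eps0.
- move=> lp V /F1 hV; have ga' : g < a by lra.
  have ap : 0 < a by lra.
  have gE := gs ga'; have aE := as_ ap; lra.
- move=> gp V /F3; have gE := gJ gp; have ap : 0 < a by lra.
  have aE := as_ ap.
  by case: (pos_cases (I_X1_X2_Y V - I_X2_Y V - ra)) => [->|[-> p0]] *; [left|right]; lra.
exists N => n /HN; apply: rcode_csz; first by apply: csz_prod_ge; lra.
rewrite card_unit -[leRHS](pow2_0 R) ler_pow2 mulr_ge0_le0 //; lra.
Qed.

End RateRegion.

(** * Concatenation of codes and convex combinations *)

Definition ffcat (n1 n2 : nat) (T : finType) (s : {ffun 'I_n1 -> T}) (t : {ffun 'I_n2 -> T}) :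
    {ffun 'I_(n1 + n2) -> T} :=
  [ffun i : 'I_(n1 + n2) => match fintype.split i with inl j => s j | inr j => t j end].

Lemma ffcatl n1 n2 (T : finType) (s : {ffun 'I_n1 -> T}) (t : {ffun 'I_n2 -> T}) (i : 'I_n1) :
  ffcat s t (lshift n2 i) = s i.
Proof. by rewrite ffunE -[lshift n2 i]/(fintype.unsplit (inl i)) fintype.unsplitK. Qed.

Lemma ffcatr n1 n2 (T : finType) (s : {ffun 'I_n1 -> T}) (t : {ffun 'I_n2 -> T}) (i : 'I_n2) :
  ffcat s t (rshift n1 i) = t i.
Proof. by rewrite ffunE -[rshift n1 i]/(fintype.unsplit (inr i)) fintype.unsplitK. Qed.

Lemma sum_ffcat (R : realType) n1 n2 (T : finType) (F : {ffun 'I_(n1 + n2) -> T} -> R) :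
  \sum_z F z = \sum_(s : {ffun 'I_n1 -> T}) \sum_(t : {ffun 'I_n2 -> T}) F (ffcat s t).
Proof.
rewrite pair_bigA /= (reindex (fun st : {ffun 'I_n1 -> T} * {ffun 'I_n2 -> T} =>
  ffcat st.1 st.2)) //=.
exists (fun z => ([ffun i => z (lshift n2 i)], [ffun i => z (rshift n1 i)])) => [[s t] _|z _] /=.
  by congr pair; apply/ffunP => i; rewrite ffunE ?ffcatl ?ffcatr.
apply/ffunP => i; rewrite -(fintype.splitK i) /fintype.unsplit.
by case: (fintype.split i) => j; rewrite ?ffcatl ?ffcatr ffunE.
Qed.

Section Concatenation.
Variables (R : realType) (X1 X2 Y : finType) (W : X1 -> X2 -> {ffun Y -> R}).
Variables (q : X1 -> X2 -> Y -> R).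
Hypothesis hW : forall x1 x2, is_pmf (W x1 x2).

Lemma Wn_cat n1 n2 s s' t t' y y' :
  Wn W (@ffcat n1 n2 _ s s') (ffcat t t') (ffcat y y') = Wn W s t y * Wn W s' t' y'.
Proof.
rewrite /Wn big_split_ord /=; congr (_ * _); apply: eq_bigr => i _.
  by rewrite !ffcatl.
by rewrite !ffcatr.
Qed.

Lemma scn_cat n1 n2 s s' t t' y y' :
  scn q (@ffcat n1 n2 _ s s') (ffcat t t') (ffcat y y') = scn q s t y + scn q s' t' y'.
Proof.
rewrite /scn big_split_ord /=; congr (_ + _); apply: eq_bigr => i _.
  by rewrite !ffcatl.
by rewrite !ffcatr.
Qed.

Let ok n (M : finType) (g1 : M -> {ffun 'I_n -> X1}) g2 m (y : {ffun 'I_n -> Y}) :=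
  [forall m', (m' != m) ==> (scn q (g1 m') (g2 m') y < scn q (g1 m) (g2 m) y)%R].

(** Scores add up, so a message pair that wins strictly in both blocks wins strictly overall; a
    wrong message may agree with the sent one in one block, where it ties. *)
Lemma pair_err_cat n1 n2 (M M' : finType) (g1 : M -> {ffun 'I_n1 -> X1}) g2
    (h1 : M' -> {ffun 'I_n2 -> X1}) h2 (mm : M * M') :
  pair_err W q (fun x => ffcat (g1 x.1) (h1 x.2)) (fun x => ffcat (g2 x.1) (h2 x.2)) mm
  <= pair_err W q g1 g2 mm.1 + pair_err W q h1 h2 mm.2.
Proof.
case: mm => m m'; rewrite [leLHS]/pair_err sum_ffcat /=.
apply: (@le_trans _ _ (\sum_y \sum_y' Wn W (g1 m) (g2 m) y * Wn W (h1 m') (h2 m') y' *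
   ((~~ ok g1 g2 m y)%:R + (~~ ok h1 h2 m' y')%:R))).
  apply: ler_sum => y _; apply: ler_sum => y' _; rewrite Wn_cat.
  rewrite ler_wpM2l ?mulr_ge0 ?Wn_ge0 // -natrD ler_nat.
  have [oky|] := boolP (ok g1 g2 m y); last by move=> _; apply: leq_trans (leq_b1 _) (leq_addr _ _).
  have [oky'|] := boolP (ok h1 h2 m' y'); last first.
    by move=> _; apply: leq_trans (leq_b1 _) (leq_addl _ _).
  rewrite leqn0 eqb0 negbK; apply/forallP => -[a b]; apply/implyP => ab /=.
  rewrite !scn_cat.
  have [am|am] := eqVneq a m.
    have bm : b != m' by apply: contra ab => /eqP ->; rewrite am.
    by rewrite am ltrD2l; have /implyP := forallP oky' b; apply.
  apply: ltr_leD; first by have /implyP := forallP oky a; apply.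
  have [->//|bm] := eqVneq b m'.
  by apply: ltW; have /implyP := forallP oky' b; apply.
under eq_bigr do under eq_bigr do rewrite mulrDr.
under eq_bigr do rewrite big_split /=.
rewrite big_split /=; apply: lerD; rewrite le_eqVlt; apply/orP; left; apply/eqP.
  apply: eq_bigr => y _; under eq_bigr do rewrite mulrAC.
  by rewrite -mulr_sumr Wn_sum // mulr1.
rewrite exchange_big /=; apply: eq_bigr => y' _; under eq_bigr do rewrite -mulrA.
by rewrite -mulr_suml Wn_sum // mul1r.
Qed.

Lemma rcode_cat n1 n2 (M1 M2 N1 N2 : finType) e1 e2 :
  rcode W q n1 M1 M2 e1 -> rcode W q n2 N1 N2 e2 ->
  rcode W q (n1 + n2) (M1 * N1)%type (M2 * N2)%type (e1 + e2).
Proof.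
move=> [Om [w [f1 [f2 [w0 w1 H]]]]] [Om' [w' [f1' [f2' [w0' w1' H']]]]].
exists (Om * Om' : finType)%type, (fun u => w u.1 * w' u.2),
  (fun u m => ffcat (f1 u.1 m.1) (f1' u.2 m.2)),
  (fun u m1 m2 => ffcat (f2 u.1 m1.1 m2.1) (f2' u.2 m1.2 m2.2)); split.
- by move=> u; rewrite mulr_ge0.
- rewrite -(pair_bigA _ (fun u v => w u * w' v)) /=.
  by under eq_bigr do rewrite -mulr_sumr w1' mulr1.
move=> [[a a'] [b b']] /=.
pose E u := pair_err W q (fun m => f1 u m.1) (fun m => f2 u m.1 m.2) (a, b).
pose E' u := pair_err W q (fun m => f1' u m.1) (fun m => f2' u m.1 m.2) (a', b').
apply: (@le_trans _ _ (\sum_u \sum_v w u * w' v * (E u + E' v))).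
  rewrite pair_bigA /=; apply: ler_sum => -[u v] _ /=; rewrite ler_wpM2l ?mulr_ge0 //.
  (* Regroups the messages by block instead of by user. *)
  pose h (x : (M1 * N1) * (M2 * N2)) : (M1 * M2) * (N1 * N2) :=
    ((x.1.1, x.2.1), (x.1.2, x.2.2)).
  have hI : injective h by move=> [[? ?] [? ?]] [[? ?] [? ?]] [-> -> -> ->].
  apply: le_trans (pair_err_cat (fun m => f1 u m.1) (fun m => f2 u m.1 m.2)
    (fun m => f1' v m.1) (fun m => f2' v m.1 m.2) ((a, b), (a', b'))).
  exact: (pair_err_sub (h := h) q hW (fun x : (M1 * M2) * (N1 * N2) =>
      ffcat (f1 u x.1.1) (f1' v x.2.1))
    (fun x => ffcat (f2 u x.1.1 x.1.2) (f2' v x.2.1 x.2.2)) ((a, a'), (b, b')) hI).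
under eq_bigr do under eq_bigr do rewrite mulrDr.
under eq_bigr do rewrite big_split /=.
rewrite big_split /=; apply: lerD.
  apply: le_trans (H (a, b)); rewrite le_eqVlt; apply/orP; left; apply/eqP.
  apply: eq_bigr => u _; under eq_bigr do rewrite mulrAC.
  by rewrite -mulr_sumr w1' mulr1.
apply: le_trans (H' (a', b')); rewrite le_eqVlt; apply/orP; left; apply/eqP.
rewrite exchange_big /=; apply: eq_bigr => v _; under eq_bigr do rewrite -mulrA.
by rewrite -mulr_suml w1 mul1r.
Qed.

Lemma rcode_unit n (eps : R) : {ffun 'I_n -> X1} -> {ffun 'I_n -> X2} -> 0 <= eps ->
  rcode W q n unit unit eps.
Proof.
move=> s t eps0; exists unit, (fun=> 1), (fun _ _ => s), (fun _ _ _ => t); split=> //.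
  by rewrite big_const card_unit /= addr0.
move=> m; rewrite big1 // => o _; rewrite mul1r /pair_err big1 // => y _.
rewrite (_ : [forall _, _] = true) ?mulr0 //; apply/forallP => -[[] []].
by case: m => -[] []; rewrite eqxx.
Qed.

Lemma rcode_pad n n' (M1 M2 : finType) eps (x1 : X1) (x2 : X2) : (n' <= n)%N ->
  rcode W q n' M1 M2 eps -> rcode W q n M1 M2 eps.
Proof.
move=> nn h; rewrite -(subnKC nn).
have := rcode_cat h (@rcode_unit (n - n') 0 [ffun=> x1] [ffun=> x2] (lexx _)).
by rewrite addr0; apply: rcode_sub => //; rewrite card_prod card_unit muln1.
Qed.

(* Codes occupying a fraction [t] of the block and carrying [n a] and [n b] message bits. *)
Definition block_rate (t a b : R) : Prop := forall del eps : R, 0 < del -> 0 < eps ->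
  exists N : nat, forall n, (N <= n)%N -> exists2 n' : nat, n'%:R <= n%:R * t &
    rcode W q n' 'I_(csz n (a - del)) 'I_(csz n (b - del)) eps.

Lemma csz_mul_ge n (a b r : R) : r <= a + b -> (csz n r <= csz n a * csz n b)%N.
Proof.
move=> /(csz_prod_ge n); rewrite card_prod !card_ord; exact: csz_le.
Qed.

Lemma block_rateD t a b t' a' b' : block_rate t a b -> block_rate t' a' b' ->
  block_rate (t + t') (a + a') (b + b').
Proof.
move=> h h' del eps del0 eps0.
have d0 : 0 < del / 2 by lra.
have e0 : 0 < eps / 2 by lra.
have [N HN] := h _ _ d0 e0; have [N' HN'] := h' _ _ d0 e0.
exists (maxn N N') => n; rewrite geq_max => /andP[/HN[n1 n1t c1] /HN'[n2 n2t c2]].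
exists (n1 + n2)%N; first by rewrite natrD mulrDr lerD.
have := rcode_cat c1 c2; rewrite -splitr; apply: rcode_sub => //;
  rewrite card_prod !card_ord csz_mul_ge //; lra.
Qed.

(** Length zero is used since the empty word exists even over an empty alphabet. *)
Lemma rcode0 n (eps r1 r2 : R) : 0 < eps -> r1 <= 0 -> r2 <= 0 ->
  rcode W q 0 'I_(csz n r1) 'I_(csz n r2) eps.
Proof.
move=> e0 h1 h2.
have s1 : {ffun 'I_0 -> X1} by apply: finfun => -[].
have s2 : {ffun 'I_0 -> X2} by apply: finfun => -[].
have := rcode_unit s1 s2 (ltW e0).
by apply: rcode_sub => //; rewrite card_unit card_ord csz_eq1.
Qed.

Lemma block_rate0 : block_rate 0 0 0.
Proof.
move=> del eps del0 eps0; exists 0%N => n _; exists 0%N; first by rewrite mulr0.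
by apply: rcode0 => //; lra.
Qed.

(** Rounding [n w] down loses at most one symbol, hence at most [r] bits, which half of [n del]
    covers; the other half pays for the rate reduction [del / (2 w)]. *)
Lemma csz_block n n' (w r del : R) : 0 < w -> 0 < del ->
  n'%:R <= n%:R * w -> n%:R * w - 1 <= n'%:R -> 2 * r <= n%:R * del ->
  (csz n (w * r - del) <= csz n' (r - del / (2 * w)))%N.
Proof.
move=> w0 del0 h1 h2 h3; apply: csz_le; apply: le_trans (csz_ge _ _); rewrite ler_pow2.
set d := del / (2 * w).
have dE : w * d = del / 2 by rewrite /d; field; exact: lt0r_neq0.
have d0 : 0 < d by rewrite divr_gt0 // mulr_gt0.
have key : n%:R * w * (r - d) = n%:R * (w * r) - n%:R * (del / 2) by rewrite -dE; ring.
have nd : 0 <= n%:R * del by rewrite mulr_ge0 // ltW.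
have [rd|rd] := leP 0 (r - d).
  have := ler_wpM2r rd h2; rewrite mulrBl key mul1r; lra.
have := ler_wpM2r (ltW (_ : 0 < d - r)) h1; rewrite subr_gt0 -subr_lt0 => /(_ rd).
lra.
Qed.

Lemma rate_ok_block w r : 0 <= w -> rate_ok W q r -> block_rate w (w * r.1) (w * r.2).
Proof.
rewrite le_eqVlt => /predU1P[<- _|w0 h]; first by rewrite !mul0r; exact: block_rate0.
move=> del eps del0 eps0.
have d0 : 0 < del / (2 * w) by rewrite divr_gt0 // mulr_gt0.
have [N HN] := h _ _ d0 eps0.
exists (maxn (Num.bound ((N%:R + 1) / w)) (Num.bound (2 * (`|r.1| + `|r.2|) / del))) => n.
rewrite geq_max => /andP[hn1 hn2].
have {}hn1 : N%:R + 1 <= n%:R * w.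
  rewrite -ler_pdivrMr //; apply/ltW/(lt_le_trans (archi_boundP _)); last by rewrite ler_nat.
  by rewrite divr_ge0 ?(ltW w0) // addr_ge0.
have {}hn2 : 2 * (`|r.1| + `|r.2|) <= n%:R * del.
  rewrite -ler_pdivrMr //; apply/ltW/(lt_le_trans (archi_boundP _)); last by rewrite ler_nat.
  by rewrite divr_ge0 ?(ltW del0) // mulr_ge0 // addr_ge0.
have nw0 : 0 <= n%:R * w by rewrite mulr_ge0 // ltW.
pose n' := Num.truncn (n%:R * w).
have n'1 : n'%:R <= n%:R * w by rewrite truncn_le.
have n'2 : n%:R * w - 1 <= n'%:R.
  by have := truncnS_gt (n%:R * w); rewrite -/n' -natr1; lra.
exists n' => //.
have Nn : (N <= n')%N by rewrite -(ler_nat R); lra.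
have a1 := normr_ge0 r.1; have a2 := normr_ge0 r.2.
have b1 := ler_norm r.1; have b2 := ler_norm r.2.
apply: rcode_sub (HN _ Nn) => //; rewrite !card_ord; apply: csz_block => //; lra.
Qed.

Lemma conv_hull_block (S : set (R * R)) z : (forall r, S r -> rate_ok W q r) ->
  conv_hull S z -> block_rate 1 z.1 z.2.
Proof.
move=> hS [n [w [p [w0 <- hp ->]]]] /=.
elim/big_rec3: _ => [|i a b c _ IH]; first exact: block_rate0.
by apply: block_rateD => //; apply: rate_ok_block => //; exact: hS.
Qed.

End Concatenation.

(** * Deterministic codes and closures *)

Section FinalStep.
Variables (R : realType) (X1 X2 Y : finType) (W : X1 -> X2 -> {ffun Y -> R}).
Variables (q : X1 -> X2 -> Y -> R).
Hypothesis hW : forall x1 x2, is_pmf (W x1 x2).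

Lemma err_prob_pair n M1 M2 (f1 : 'I_M1 -> {ffun 'I_n -> X1})
    (f2 : 'I_M1 -> 'I_M2 -> {ffun 'I_n -> X2}) i j :
  err_prob q W (fun i => f1 i) (fun i j => f2 i j) i j =
  pair_err W q (fun m : 'I_M1 * 'I_M2 => f1 m.1) (fun m => f2 m.1 m.2) (i, j).
Proof.
rewrite /err_prob /pair_err big_mkcond; apply: eq_bigr => y _ /=.
rewrite (_ : decoded _ _ _ _ _ _ = [forall m' : 'I_M1 * 'I_M2, (m' != (i, j)) ==>
  (scn q (f1 m'.1) (f2 m'.1 m'.2) y < scn q (f1 i) (f2 i j) y)%R]).
  by case: ifP => h; rewrite ?mulr1 ?mulr0.
apply/forallP/forallP => [h [i' j']|h i'].
  exact: (forallP (h i') j').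
by apply/forallP => j'; exact: (h (i', j')).
Qed.

Lemma rcode_avg_err n M1 M2 eps : (0 < M1)%N -> (0 < M2)%N ->
  rcode W q n 'I_M1 'I_M2 eps ->
  exists (f1 : 'I_M1 -> 'I_n -> X1) (f2 : 'I_M1 -> 'I_M2 -> 'I_n -> X2),
    avg_err q W f1 f2 <= eps.
Proof.
move=> M10 M20 [Om [w [f1 [f2 [w0 w1 H]]]]].
pose S u := \sum_(m : 'I_M1 * 'I_M2) pair_err W q (fun m => f1 u m.1) (fun m => f2 u m.1 m.2) m.
have [u ho] : exists u, S u <= eps * (M1 * M2)%:R.
  apply: contrapT => /forallNP h.
  have hS u : eps * (M1 * M2)%:R < S u by rewrite ltNge; apply/negP; exact: h.
  have : \sum_u w u * S u <= eps * (M1 * M2)%:R.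
    under eq_bigr do rewrite mulr_sumr.
    rewrite exchange_big /=; apply: (@le_trans _ _ (\sum_(m : 'I_M1 * 'I_M2) eps)).
      by apply: ler_sum => m _; exact: H.
    by rewrite sumr_const card_prod !card_ord mulr_natr.
  (* An outcome of positive weight is needed for the weighted average to exceed the bound
     strictly. *)
  have [u wo] : exists u, 0 < w u.
    apply: contrapT => /forallNP hw; move: w1; rewrite big1 => [/esym/eqP|u _].
      by rewrite oner_eq0.
    by apply/eqP; rewrite eq_le w0 andbT leNgt; apply/negP; exact: hw.
  rewrite leNgt => /negP; apply.
  rewrite -[ltLHS]mul1r -[X in X * _]w1 mulr_suml [ltLHS](bigD1 u) //= [ltRHS](bigD1 u) //=.
  apply: ltr_leD; first by rewrite ltr_pM2l.
  by apply: ler_sum => v _; rewrite ler_wpM2l // ltW.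
exists (fun i => f1 u i), (fun i j => f2 u i j).
rewrite /avg_err ler_pdivrMr ?ltr0n ?muln_gt0 ?M10 //.
apply: le_trans ho; rewrite /S -(pair_bigA _ (fun i j => pair_err W q
  (fun m => f1 u m.1) (fun m => f2 u m.1 m.2) (i, j))) /=.
by apply: ler_sum => i _; apply: ler_sum => j _; rewrite err_prob_pair.
Qed.

Lemma nmsg_gt0 n (r : R) : 0 <= r -> (0 < nmsg n r)%N.
Proof.
move=> r0; rewrite /nmsg powR2E truncn_gt0 // pow2_ge1 //; exact: mulr_ge0.
Qed.

Lemma nmsg_le_csz n (r d : R) : (nmsg n (Num.max 0 (r - d))%R <= csz n (r - d)%R)%N.
Proof.
have [h|h] := leP (r - d) 0.
  by rewrite /nmsg mulr0 powRr0 truncn1 csz_gt0.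
rewrite -(ler_nat R) /nmsg powR2E; apply: le_trans (csz_ge _ _).
by rewrite truncn_le // pow2_ge0.
Qed.

(** Rates are truncated at 0 because [achievable] asks for nonnegative ones; at rate 0 there is a
    single message, which fits in any code. *)
Lemma block_rate_achievable (z : R * R) (del : R) (x1 : X1) (x2 : X2) :
  block_rate W q 1 z.1 z.2 -> 0 < del ->
  achievable q W (Num.max 0 (z.1 - del), Num.max 0 (z.2 - del)).
Proof.
move=> hz del0; have m0 (x : R) : 0 <= Num.max 0 x by rewrite le_max lexx.
split; first exact: m0; split; first exact: m0.
move=> eps eps0; have [N HN] := hz _ _ del0 eps0.
exists N => n /HN[n']; rewrite mulr1 ler_nat => /(rcode_pad hW x1 x2) h /h {h} h.
apply: rcode_avg_err; rewrite ?nmsg_gt0 //=.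
by apply: rcode_sub h => //; rewrite !card_ord nmsg_le_csz.
Qed.

Lemma block_rate_closure (z : R * R) (x1 : X1) (x2 : X2) : 0 <= z.1 -> 0 <= z.2 ->
  block_rate W q 1 z.1 z.2 -> closure (achievable q W) z.
Proof.
move=> z10 z20 hz B /nbhs_ballP[e /= e0 eB].
have d0 : 0 < e / 2 by rewrite divr_gt0.
exists (Num.max 0 (z.1 - e / 2), Num.max 0 (z.2 - e / 2)); split.
  exact: (block_rate_achievable x1 x2 hz d0).
apply: eB; have near0 (x : R) : 0 <= x -> ball x e (Num.max 0 (x - e / 2)).
  move=> x0; rewrite /ball /= ltr_norml; have [h|h] := leP (x - e / 2) 0; apply/andP; split; lra.
by split; apply: near0.
Qed.

End FinalStep.

Theorem theorem6 (R : realType) (X1 X2 Y : finType)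
  (W : X1 -> X2 -> {ffun Y -> R}) (q : X1 -> X2 -> Y -> R)
  (hW : forall x1 x2, is_pmf (W x1 x2)) :
  Rbin_cog q W `<=` capacity_region q W.
Proof.
apply: (@subset_trans _ (closure (closure (achievable q W)))); last first.
  by rewrite -((closure_id _).1 (@closed_closure _ (achievable q W))).
apply: closureS => z hz.
(* Nonnegativity of the limit point keeps the truncated rates close to it. *)
have pos_star r : Rbin_union q W r -> 0 <= r.1 /\ 0 <= r.2.
  move=> [Q [_ [a [b [a0 [b0 [r2 [-> _]]]]]]]]; split=> //; exact: addr_ge0.
have hb : block_rate W q 1 z.1 z.2.
  apply: (conv_hull_block hW _ hz) => r [Q [hQ hr]]; exact: (Rbin_star_rate_ok hW hQ hr).
have [n [w [p [w0 w1 hp zE]]]] := hz.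
have [z10 z20] : 0 <= z.1 /\ 0 <= z.2.
  rewrite zE; split; apply: sumr_ge0 => i _; rewrite mulr_ge0 //.
    exact: (pos_star _ (hp i)).1.
  exact: (pos_star _ (hp i)).2.
have [i _] : exists i : 'I_n, True.
  case: n w p w0 w1 hp zE => [w p _|n *]; last by exists ord0.
  by rewrite big_ord0 => /esym/eqP; rewrite oner_eq0.
(* A distribution of total mass 1 shows that the input alphabets are nonempty, which padding
   requires. *)
have [Q [[_ Q1s] _]] := hp i.
have [x _] : exists x : X1 * X2, True.
  have [x _|none] := pickP (fun _ : X1 * X2 => true); first by exists x.
  by move: Q1s; rewrite big_pred0 // => /esym/eqP; rewrite oner_eq0.
exact: (block_rate_closure hW x.1 x.2 z10 z20 hb).
Qed.
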